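(* The set of all $f\in\mathbb{N}^\mathbb{N}$ that name a presentation of $\ell^2$ is $\Pi^0_2$-complete, and for each $n\ge 1$ the set of all $f\in\mathbb{N}^\mathbb{N}$ that name a presentation of $\ell^2_n$ is $\Pi^0_2$-complete.
   Context: The scalar field $\mathbb{F}$ is $\mathbb{R}$ or $\mathbb{C}$; $\mathbb{F}_\mathbb{Q}=\mathbb{F}\cap\mathbb{Q}(i)$. A presentation of a Banach space $\mathcal{B}$ is a pair $(\mathcal{B},R)$ with $R:\mathbb{N}\to\mathcal{B}$ having linearly dense range. Its rational vectors are the finite $\mathbb{F}_\mathbb{Q}$-linear combinations of the $R(n)$, coded via a fixed Gödel numbering of formal expressions. With $I_n$ the $n$-th rational open interval in a fixed effective enumeration, the diagram is the set of codes of pairs $(m,n)$ with the norm of the $m$-th rational vector in $I_n$. A name of the presentation is any $f\in\mathbb{N}^\mathbb{N}$ whose range is its diagram; $f$ names a presentation of $X$ if it names a presentation of a space isometrically isomorphic to $X$. $\ell^2_n$ is $\mathbb{F}^n$ with the Euclidean norm. A set $S\subseteq\mathbb{N}^\mathbb{N}$ is $\Pi^0_2$-complete if it is (lightface) $\Pi^0_2$ and for every $\Pi^0_2$ set $P\subseteq\mathbb{N}^\mathbb{N}$ there is a computable operator $F$ with $P(f)\iff F(f)\in S$. *)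

(* Defs.v *)
From HB Require Import structures.
From mathcomp Require Import all_boot all_order all_algebra.
From mathcomp Require Import all_classical all_reals all_analysis.
From mathcomp Require Import complex.
Set Implicit Arguments. Unset Strict Implicit. Unset Printing Implicit Defensive.
Import Order.TTheory GRing.Theory Num.Theory.
Import numFieldNormedType.Exports.
Local Open Scope classical_set_scope.
Local Open Scope ring_scope.

Definition npair (x y : nat) : nat := (2 ^ x * (y.*2.+1)).-1.
Definition nfst (z : nat) : nat := logn 2 z.+1.
Definition nsnd (z : nat) : nat := (z.+1 %/ 2 ^ nfst z).-1./2.

Fixpoint seqcode (s : seq nat) : nat :=
  match s with [::] => 0%N | a :: s' => (npair a (seqcode s')).+1 end.

Definition prefix_code (f : nat -> nat) (m : nat) : nat := seqcode (mkseq f m).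

Inductive prf : Type :=
| PZero | PSucc | PFst | PSnd
| PPair of prf & prf
| PComp of prf & prf
| PRec of prf & prf
| PMu of prf.

Inductive peval : prf -> nat -> nat -> Prop :=
| ev_zero x : peval PZero x 0
| ev_succ x : peval PSucc x x.+1
| ev_fst x : peval PFst x (nfst x)
| ev_snd x : peval PSnd x (nsnd x)
| ev_pair f g x a b : peval f x a -> peval g x b -> peval (PPair f g) x (npair a b)
| ev_comp f g x y z : peval g x y -> peval f y z -> peval (PComp f g) x z
| ev_rec0 f g x a : peval f x a -> peval (PRec f g) (npair x 0) a
| ev_recS f g x y a b : peval (PRec f g) (npair x y) a ->
    peval g (npair x (npair y a)) b -> peval (PRec f g) (npair x y.+1) b
| ev_mu f x y : peval f (npair x y) 0 ->
    (forall z, (z < y)%N -> exists2 v, v <> 0%N & peval f (npair x z) v) ->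
    peval (PMu f) x y.

Definition computable (h : nat -> nat) : Prop :=
  exists c : prf, forall x, peval c x (h x).

(* Lightface Pi^0_2 subsets of Baire space (Kleene normal form):
   f in P  <->  forall n, exists m, R(n, f|m)  with R computable. *)
Definition Pi02 (P : (nat -> nat) -> Prop) : Prop :=
  exists r : nat -> nat, computable r /\
    forall f, P f <-> forall n, exists m, r (npair n (prefix_code f m)) = 0%N.

(* Computable (total) operators N^N -> N^N: F f n is computed from finite
   prefixes of f by a computable h: F f n + 1 is the first nonzero value of
   h <n, f|m>, m = 0,1,2,..., and such a nonzero value always exists. *)
Definition computable_operator (F : (nat -> nat) -> (nat -> nat)) : Prop :=
  exists h : nat -> nat, computable h /\
    forall f n, exists m,
      h (npair n (prefix_code f m)) = (F f n).+1 /\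
      forall k, (k < m)%N -> h (npair n (prefix_code f k)) = 0%N.

Definition Pi02_complete (S : (nat -> nat) -> Prop) : Prop :=
  Pi02 S /\
  forall P : (nat -> nat) -> Prop, Pi02 P ->
    exists F, computable_operator F /\ forall f, P f <-> S (F f).

(* The scalars of F_Q = F cap Q(i), enumerated (with repetitions) by nat. *)
Definition qscalR (R : realType) (k : nat) : R :=
  ratr (odflt 0%Q (unpickle k : option rat)).

Local Open Scope complex_scope.
Definition qscalC (R : realType) (k : nat) : R[i] :=
  let: (a, b) := odflt (0%Q, 0%Q) (unpickle k : option (rat * rat)) in
  (ratr a) +i* (ratr b).
Local Close Scope complex_scope.

(* Rational vectors: the m-th formal expression (a finite list of pairs
   (code of a scalar q, index j), standing for sum q R(j)); codes that do not
   decode stand for the empty sum. *)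
Definition rat_vector (K : numFieldType) (V : lmodType K) (qs : nat -> K)
    (Rp : nat -> V) (m : nat) : V :=
  \sum_(p <- odflt [::] (unpickle m : option (seq (nat * nat)))) qs p.1 *: Rp p.2.

(* The n-th rational open interval: codes (a, d) |-> (a, a + e), with e = d
   if d > 0 and e = 1 otherwise; this enumerates all nonempty rational
   open intervals. *)
Definition rat_interval (n : nat) : rat * rat :=
  let: (a, d) := odflt (0%Q, 0%Q) (unpickle n : option (rat * rat)) in
  (a, a + (if (0 < d)%R then d else 1)).

Definition in_rat_interval (K : numFieldType) (x : K) (n : nat) : bool :=
  (ratr (rat_interval n).1 < x) && (x < ratr (rat_interval n).2).

Definition diagram (K : numFieldType) (B : normedModType K) (qs : nat -> K)
    (Rp : nat -> B) : set nat :=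
  [set k | exists m n, k = pickle (m, n) /\
             in_rat_interval `|rat_vector qs Rp m| n].

Definition lin_span (K : numFieldType) (V : lmodType K) (Rp : nat -> V) : set V :=
  [set v | exists s : seq (K * nat), v = \sum_(p <- s) p.1 *: Rp p.2].

Definition presentation (K : numFieldType) (B : completeNormedModType K)
    (Rp : nat -> B) : Prop :=
  closure (lin_span Rp) = setT.

Definition names (K : numFieldType) (B : normedModType K) (qs : nat -> K)
    (f : nat -> nat) (Rp : nat -> B) : Prop :=
  range f = diagram qs Rp.

Definition iso_l2 (K : numFieldType) (B : normedModType K) : Prop :=
  exists T : B -> nat -> K,
    (forall (a : K) (u v : B) (i : nat), T (a *: u + v) i = a * T u i + T v i) /\
    (forall x : nat -> K,
        cvgn (series (fun i => `|x i| ^+ 2)) <-> exists b, T b = x) /\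
    (forall b : B, `|b| ^+ 2 = limn (series (fun i => `|T b i| ^+ 2))).

Definition iso_l2n (K : numFieldType) (n : nat) (B : normedModType K) : Prop :=
  exists T : B -> 'I_n -> K,
    (forall (a : K) (u v : B) (i : 'I_n), T (a *: u + v) i = a * T u i + T v i) /\
    (forall x : 'I_n -> K, exists b, T b = x) /\
    (forall b : B, `|b| ^+ 2 = \sum_(i < n) `|T b i| ^+ 2).

Definition names_pres_of (K : numFieldType) (qs : nat -> K)
    (X : normedModType K -> Prop) (f : nat -> nat) : Prop :=
  exists (B : completeNormedModType K) (Rp : nat -> B),
    presentation Rp /\ names qs f Rp /\ X B.

(* Main.v *)
Require Import Defs.
From HB Require Import structures.
From mathcomp Require Import all_boot all_order all_algebra.
From mathcomp Require Import all_classical all_reals all_analysis.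
From mathcomp Require Import complex zify ring lra.
Set Implicit Arguments. Unset Strict Implicit. Unset Printing Implicit Defensive.

(** Upper bound. A set of codes is the diagram of a presentation of a
    Hilbert space of the right dimension iff (i) every finite part of it is
    realised by finitely many rational vectors in a rational Euclidean space
    (of dimension [n] in the case of [l2_n]), (ii) the intervals attached to
    each rational vector form a round, upward closed family with arbitrarily
    short members, and (iii) it contains evidence of large almost
    orthonormal systems. Each condition has the form "for all t there is w
    such that ...", with a decidable matrix. Conversely, by (i) and (ii) the
    norms of the rational models converge; by polarization the limit comes
    from a positive semidefinite hermitian form, and Gram-Schmidt embeds the
    formal vectors isometrically in [l2], with dense span by (iii).

    Lower bound. A proper subset of a diagram is never a diagram: every
    rational interval around one of its norms would also contain the
    corresponding norm of the full diagram, so the two norms would agree.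
    Hence, given a [Pi02] set, it suffices to enumerate the decidable
    diagram of the standard basis, releasing its i-th element only once the
    first i requirements of the [Pi02] condition are witnessed. *)

(** * Computable functions *)

(** A diagram gives norms only through open intervals, so no equality can be tested, not even the
    vanishing of a vector. This shapes both dimension bounds: linear independence is replaced by a
    Gram matrix whose entries differ from those of the identity by less than 1 in total, which
    already forces the rank ([approx_identity]). The same estimate shows that a limit of models of
    dimension n has dimension at most n, and that the evidence in (iii) makes it at least n. Passing
    to the limit loses strictness twice. The limit form can be degenerate, so Gram-Schmidt has to
    skip null residuals and its expansions hold only inside the form. And the limit norms satisfy
    the listed intervals only weakly, which is what roundness repairs. Models are rational so that
    every norm is the square root of a rational number, and membership in a rational interval is
    decided by comparing squares. That a true diagram satisfies (i) holds because finitely many of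
    its entries are open conditions, hence survive a small rational perturbation of the
    generators. *)

Lemma npairS x y : (npair x y).+1 = 2 ^ x * y.*2.+1.
Proof. by rewrite /npair prednK // muln_gt0 expn_gt0. Qed.

Lemma nfst_pair x y : nfst (npair x y) = x.
Proof.
rewrite /nfst npairS lognM ?expn_gt0 // pfactorK //.
by rewrite logn_coprime ?addn0 // coprime2n /= odd_double.
Qed.

Lemma nsnd_pair x y : nsnd (npair x y) = y.
Proof. by rewrite /nsnd nfst_pair npairS mulKn ?expn_gt0 //= doubleK. Qed.

Lemma npair_eta z : npair (nfst z) (nsnd z) = z.
Proof.
apply: succn_inj; rewrite npairS /nsnd.
have /dvdnP[q eq_q] : 2 ^ nfst z %| z.+1 by exact: pfactor_dvdnn.
have q_odd : odd q.
  rewrite -[odd q]negbK -dvdn2; apply/negP => /dvdnP[p eq_p].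
  have : 2 ^ (nfst z).+1 %| z.+1.
    by rewrite eq_q eq_p expnS -mulnA; apply: dvdn_mull.
  by rewrite pfactor_dvdn // ltnn.
rewrite eq_q mulnK ?expn_gt0 // mulnC; congr (_ * _).
have := odd_double_half q; rewrite q_odd add1n => q_eq.
by rewrite -{1}q_eq /= doubleK q_eq.
Qed.

Lemma nfst_le z : nfst z <= z.
Proof.
by rewrite -ltnS (leq_trans (ltn_expl (nfst z) (ltnSn 1))) // dvdn_leq ?pfactor_dvdnn.
Qed.

Lemma nsnd_le z : nsnd z <= z.
Proof.
rewrite -{2}(npair_eta z) -ltnS npairS.
by rewrite (@leq_trans (1 * (nsnd z).*2.+1)) ?leq_mul ?expn_gt0 // mul1n ltnS -addnn leq_addr.
Qed.

Lemma npair_le2 x y : y <= npair x y.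
Proof. by rewrite -{1}(nsnd_pair x y) nsnd_le. Qed.

Lemma npair_lt1 x y : 0 < y -> x < npair x y.
Proof.
move=> y0; rewrite -ltnS npairS.
apply: (@leq_trans (2 ^ x * 2)); last by rewrite leq_mul2l; apply/orP; right; lia.
have := ltn_expl x (ltnSn 1); lia.
Qed.

Lemma computable_ext f g : f =1 g -> computable f -> computable g.
Proof. by move=> fg [c cP]; exists c => x; rewrite -fg. Qed.

Lemma computable_comp f g :
  computable f -> computable g -> computable (fun x => f (g x)).
Proof. by move=> [c cP] [d dP]; exists (PComp c d) => x; apply: ev_comp. Qed.

Lemma computable_pair f g :
  computable f -> computable g -> computable (fun x => npair (f x) (g x)).
Proof. by move=> [c cP] [d dP]; exists (PPair c d) => x; apply: ev_pair. Qed.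

Lemma computable_id : computable (fun x => x).
Proof.
exists (PPair PFst PSnd) => x; rewrite -{2}(npair_eta x).
by apply: ev_pair; constructor.
Qed.

Lemma computable_fst f : computable f -> computable (fun x => nfst (f x)).
Proof. by apply: computable_comp; exists PFst => x; constructor. Qed.

Lemma computable_snd f : computable f -> computable (fun x => nsnd (f x)).
Proof. by apply: computable_comp; exists PSnd => x; constructor. Qed.

Lemma computable_succ f : computable f -> computable (fun x => (f x).+1).
Proof. by apply: computable_comp; exists PSucc => x; constructor. Qed.

Lemma computable_const k : computable (fun _ => k).
Proof.
elim: k => [|k IHk]; last exact: computable_succ.
by exists PZero => x; constructor.
Qed.

(** Bounded iteration is the only form of recursion in what follows. [PRec] hands the parameter [x]
    to each step, packed with the counter and the accumulator. *)
Lemma computable_iteri n s f :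
    computable n -> computable f ->
    computable (fun z => s (nfst z) (nfst (nsnd z)) (nsnd (nsnd z))) ->
  computable (fun x => iteri (n x) (s x) (f x)).
Proof.
move=> cn [c cP] [d dP].
have cr : computable (fun z => iteri (nsnd z) (s (nfst z)) (f (nfst z))).
  exists (PRec c d) => z; rewrite -{1}(npair_eta z).
  elim: (nsnd z) => [|k IHk]; first by apply: ev_rec0; apply: cP.
  apply: ev_recS IHk _; have := dP (npair (nfst z) (npair k (iteri k (s (nfst z)) (f (nfst z))))).
  by rewrite !(nfst_pair, nsnd_pair).
apply: computable_ext (computable_comp cr (computable_pair computable_id cn)) => x.
by rewrite nfst_pair nsnd_pair.
Qed.

Lemma computable_pred f : computable f -> computable (fun x => (f x).-1).
Proof.
move=> cf; apply: (@computable_ext (fun x => iteri (f x) (fun i _ => i) 0)).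
  by move=> x; case: (f x).
by apply: computable_iteri => //;
  [exact: computable_const | exact/computable_fst/computable_snd/computable_id].
Qed.

Lemma computable_iter n s f :
    computable n -> computable f ->
    computable (fun z => s (nfst z) (nsnd z)) ->
  computable (fun x => iter (n x) (s x) (f x)).
Proof.
move=> cn cf cs.
apply: (@computable_ext (fun x => iteri (n x) (fun _ => s x) (f x))).
  by move=> x; elim: (n x) => //= k ->.
apply: computable_iteri => //.
apply: computable_ext (computable_comp cs (computable_pair
  (computable_fst computable_id) (computable_snd (computable_snd computable_id)))) => z.
by rewrite nfst_pair nsnd_pair.
Qed.

Lemma computable_add f g :
  computable f -> computable g -> computable (fun x => f x + g x).
Proof.
move=> cf cg; apply: (@computable_ext (fun x => iter (f x) succn (g x))).
  by move=> x; rewrite iter_succn addnC.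
by apply: computable_iter => //; exact/computable_succ/computable_snd/computable_id.
Qed.

Lemma computable_sub f g :
  computable f -> computable g -> computable (fun x => f x - g x).
Proof.
move=> cf cg; apply: (@computable_ext (fun x => iter (g x) predn (f x))).
  by move=> x; elim: (g x) => [|k /= ->]; rewrite ?subn0 ?subnS.
by apply: computable_iter => //; exact/computable_pred/computable_snd/computable_id.
Qed.

Lemma computable_mul f g :
  computable f -> computable g -> computable (fun x => f x * g x).
Proof.
move=> cf cg; apply: (@computable_ext (fun x => iter (f x) (addn (g x)) 0)).
  by move=> x; rewrite iter_addn_0 mulnC.
apply: computable_iter => //; first exact: computable_const.
by apply: computable_add; [apply: computable_comp cg _; apply: computable_fst
  | apply: computable_snd]; apply: computable_id.
Qed.

Definition decidable_pred (b : nat -> bool) := computable (fun x => nat_of_bool (b x)).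

Lemma decidable_pred_ext b c : b =1 c -> decidable_pred b -> decidable_pred c.
Proof. by move=> bc; apply: computable_ext => x; rewrite bc. Qed.

Lemma computable_if b f g :
    decidable_pred b -> computable f -> computable g ->
  computable (fun x => if b x then f x else g x).
Proof.
move=> cb cf cg.
apply: (@computable_ext (fun x => b x * f x + (1 - b x) * g x)).
  by move=> x; case: (b x); rewrite ?mul1n ?mul0n ?addn0.
by apply: computable_add; apply: computable_mul => //; apply: computable_sub => //;
  exact: computable_const.
Qed.

Lemma decidable_eq0 f : computable f -> decidable_pred (fun x => f x == 0).
Proof.
move=> cf; apply: (@computable_ext (fun x => 1 - f x)); first by move=> x; case: (f x) => [|[]].
by apply: computable_sub => //; exact: computable_const.
Qed.

Lemma decidable_leq f g :
  computable f -> computable g -> decidable_pred (fun x => f x <= g x).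
Proof. by move=> cf cg; apply: decidable_eq0; apply: computable_sub. Qed.

Lemma decidable_true : decidable_pred (fun=> true).
Proof. exact: computable_const. Qed.

Lemma decidable_neg b : decidable_pred b -> decidable_pred (fun x => ~~ b x).
Proof.
by move=> cb; apply: decidable_pred_ext (decidable_eq0 cb) => x; case: (b x).
Qed.

Lemma decidable_and b c :
  decidable_pred b -> decidable_pred c -> decidable_pred (fun x => b x && c x).
Proof.
move=> cb cc; apply: (computable_ext _ (computable_mul cb cc)) => x.
by case: (b x); case: (c x).
Qed.

Lemma decidable_or b c :
  decidable_pred b -> decidable_pred c -> decidable_pred (fun x => b x || c x).
Proof.
move=> cb cc; apply: (decidable_pred_ext (b := fun x => ~~ (~~ b x && ~~ c x))).
  by move=> x; rewrite negb_and !negbK.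
by apply/decidable_neg/decidable_and; apply: decidable_neg.
Qed.

Lemma decidable_imply b c :
  decidable_pred b -> decidable_pred c -> decidable_pred (fun x => b x ==> c x).
Proof.
move=> cb cc; apply: (decidable_pred_ext (b := fun x => ~~ b x || c x)).
  by move=> x; rewrite implybE.
by apply: decidable_or => //; apply: decidable_neg.
Qed.

Lemma decidable_if b c d :
    decidable_pred b -> decidable_pred c -> decidable_pred d ->
  decidable_pred (fun x => if b x then c x else d x).
Proof.
move=> cb cc cd; apply: (computable_ext _ (computable_if cb cc cd)) => x.
by case: (b x).
Qed.

Lemma decidable_eq f g :
  computable f -> computable g -> decidable_pred (fun x => f x == g x).
Proof.
move=> cf cg; apply: (decidable_pred_ext (b := fun x => (f x <= g x) && (g x <= f x))).
  by move=> x; rewrite eqn_leq.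
by apply: decidable_and; apply: decidable_leq.
Qed.

Definition all_below (n : nat) (P : nat -> bool) : bool := all P (iota 0 n).

Lemma all_belowP n (P : nat -> bool) : reflect (forall i, i < n -> P i) (all_below n P).
Proof.
apply: (iffP allP) => allP i; first by move=> lt_in; apply: allP; rewrite mem_iota.
by rewrite mem_iota add0n => /andP[_]; apply: allP.
Qed.

Lemma decidable_all_below n (P : nat -> nat -> bool) :
    computable n -> decidable_pred (fun z => P (nfst z) (nsnd z)) ->
  decidable_pred (fun x => all_below (n x) (P x)).
Proof.
move=> cn cP.
apply: (@computable_ext (fun x => iteri (n x) (fun i a => P x i * a) 1)).
  move=> x; rewrite /all_below; elim: (n x) => // k IHk; rewrite iteriS IHk -addn1.
  by rewrite iotaD all_cat /= add0n andbT andbC; case: (P x k); case: (all _ _).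
apply: computable_iteri => //; first exact: computable_const.
apply: computable_mul; last exact/computable_snd/computable_snd/computable_id.
have := computable_comp cP (computable_pair (computable_fst computable_id)
  (computable_fst (computable_snd computable_id))).
by apply: computable_ext => z; rewrite nfst_pair nsnd_pair.
Qed.

Create HintDb computable.
#[global] Hint Resolve computable_id computable_const computable_pair computable_fst
  computable_snd computable_succ computable_pred computable_iteri computable_iter
  computable_add computable_sub computable_mul computable_if decidable_eq0
  decidable_leq decidable_true decidable_neg decidable_and decidable_or decidable_imply
  decidable_if decidable_eq decidable_all_below : computable.

Import Order.TTheory GRing.Theory Num.Theory.

(** * Coded lists *)

(** The coding of prefixes is the one that underlies [pickle] on lists, so a single list arithmetic
    serves both the oracle and the formal expressions. *)
Lemma seqcodeE : seqcode =1 CodeSeq.code.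
Proof. by elim=> //= a s ->; rewrite npairS. Qed.

Lemma seqcodeK : cancel seqcode CodeSeq.decode.
Proof. by move=> s; rewrite seqcodeE CodeSeq.codeK. Qed.

Lemma decodeK c : seqcode (CodeSeq.decode c) = c.
Proof. by rewrite seqcodeE CodeSeq.decodeK. Qed.

(** On the code 0 of the empty list both [hdc] and [tlc] return 0, so reading past the end of a list
    yields 0 and every number is a legitimate list code. *)
Definition hdc c := nfst c.-1.
Definition tlc c := nsnd c.-1.
Definition dropc i c := iter i tlc c.
Definition nthc c i := hdc (dropc i c).
(** The code of a list bounds its length, so the nonempty suffixes can be counted over a bounded
    range. *)
Definition sizec c := \sum_(i < c) (dropc i c != 0).
Definition catc a b :=
  iteri (sizec a) (fun k acc => (npair (nthc a (sizec a - k.+1)) acc).+1) b.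

Lemma hdc_code s : hdc (seqcode s) = head 0 s.
Proof. by case: s => [|a s]; rewrite /hdc /= ?nfst_pair // /nfst logn1. Qed.

Lemma tlc_code s : tlc (seqcode s) = seqcode (behead s).
Proof.
by case: s => [|a s]; rewrite /tlc /= ?nsnd_pair.
Qed.

Lemma dropc_code i s : dropc i (seqcode s) = seqcode (drop i s).
Proof.
rewrite /dropc; elim: i => [|i IHi] /=; first by rewrite drop0.
by rewrite IHi tlc_code; congr seqcode; rewrite -drop1 drop_drop.
Qed.

Lemma nthc_code s i : nthc (seqcode s) i = nth 0 s i.
Proof. by rewrite /nthc dropc_code hdc_code -nth0 nth_drop addn0. Qed.

Lemma seqcode_eq0 s : (seqcode s == 0) = (s == [::]).
Proof. by case: s. Qed.

Lemma size_seqcode s : size s <= seqcode s.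
Proof.
elim: s => //= a s IHs; rewrite ltnS (leq_trans IHs) //; exact: npair_le2.
Qed.

Lemma sizec_code s : sizec (seqcode s) = size s.
Proof.
rewrite /sizec (eq_bigr (fun i : 'I__ => (i < size s)%N : nat)); last first.
  by move=> i _; rewrite dropc_code seqcode_eq0 -size_eq0 size_drop subn_eq0 -ltnNge.
rewrite -(big_mkord xpredT (fun i => (i < size s)%N : nat)).
rewrite (@big_cat_nat _ _ _ (size s)) ?size_seqcode //=.
rewrite [X in (_ + X)%N]big_nat_cond [X in (_ + X)%N]big1 ?addn0; last first.
  by move=> i /andP[/andP[le_si _] _]; rewrite ltnNge le_si.
rewrite (eq_big_nat _ _ (F2 := fun=> 1%N)) => [|i /andP[_ ->] //].
by rewrite sum_nat_const_nat subn0 muln1.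
Qed.

Lemma nthc_le c i : nthc c i <= c.
Proof.
have tl_le k x : dropc k x <= x.
  elim: k => //= k IHk; apply: leq_trans IHk.
  by apply: (leq_trans (nsnd_le _)); apply: leq_pred.
apply: leq_trans (tl_le i c).
by apply: (leq_trans (nfst_le _)); apply: leq_pred.
Qed.

Lemma catc_code s t : catc (seqcode s) (seqcode t) = seqcode (s ++ t).
Proof.
rewrite /catc sizec_code.
suff H k : k <= size s ->
    iteri k (fun k acc => (npair (nthc (seqcode s) (size s - k.+1)) acc).+1) (seqcode t)
    = seqcode (drop (size s - k) s ++ t).
  by rewrite H // subnn drop0.
elim: k => [|k IHk] lt_ks; first by rewrite subn0 drop_size.
rewrite /= IHk ?(ltnW lt_ks) // nthc_code.
rewrite [in RHS](drop_nth 0) ?subnSK //=; lia.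
Qed.

Lemma computable_hdc f : computable f -> computable (fun x => hdc (f x)).
Proof. by move=> cf; rewrite /hdc; auto with computable. Qed.

Lemma computable_tlc f : computable f -> computable (fun x => tlc (f x)).
Proof. by move=> cf; rewrite /tlc; auto with computable. Qed.
#[global] Hint Resolve computable_hdc computable_tlc : computable.

Lemma computable_dropc f g :
  computable f -> computable g -> computable (fun x => dropc (f x) (g x)).
Proof. by move=> cf cg; rewrite /dropc; auto with computable. Qed.
#[global] Hint Resolve computable_dropc : computable.

Lemma computable_nthc f g :
  computable f -> computable g -> computable (fun x => nthc (f x) (g x)).
Proof. by move=> cf cg; rewrite /nthc; auto with computable. Qed.
#[global] Hint Resolve computable_nthc : computable.

Lemma computable_nat_of_bool b :
  decidable_pred b -> computable (fun x => nat_of_bool (b x)).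
Proof. by []. Qed.
#[global] Hint Resolve computable_nat_of_bool : computable.

Lemma computable_sizec f : computable f -> computable (fun x => sizec (f x)).
Proof.
apply: computable_comp.
apply: (@computable_ext (fun x => iteri x (fun i a => a + (dropc i x != 0)) 0)).
  move=> x; rewrite /sizec.
  have H k : iteri k (fun i a => a + (dropc i x != 0)) 0 = \sum_(i < k) (dropc i x != 0).
    by elim: k => [|k IHk]; rewrite ?big_ord0 // big_ord_recr /= IHk.
  exact: H.
by auto 20 with computable.
Qed.
#[global] Hint Resolve computable_sizec : computable.


Lemma computable_app2 (F : nat -> nat -> nat) f g :
    computable (fun z => F (nfst z) (nsnd z)) -> computable f -> computable g ->
  computable (fun x => F (f x) (g x)).
Proof.
move=> cF cf cg; apply: computable_ext (computable_comp cF (computable_pair cf cg)) => x.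
by rewrite nfst_pair nsnd_pair.
Qed.

Lemma computable_catc f g :
  computable f -> computable g -> computable (fun x => catc (f x) (g x)).
Proof.
by apply: computable_app2; rewrite /catc; auto 20 with computable.
Qed.
#[global] Hint Resolve computable_catc : computable.

(** * Coded rational numbers *)

Local Open Scope ring_scope.

(** The sign comes from a difference of two naturals and the denominator is shifted by one: every
    natural number is then a valid code, and arithmetic needs neither normalization nor case
    analysis. Codes are not unique. *)
HB.lock Definition qval (c : nat) : rat :=
  ((nfst (nfst c))%:R - (nsnd (nfst c))%:R) / (nsnd c).+1%:R.

Definition qcode (a b d : nat) := npair (npair a b) d.-1.

Definition qaddc (x y : nat) : nat :=
  qcode (nfst (nfst x) * (nsnd y).+1 + nfst (nfst y) * (nsnd x).+1)%N
        (nsnd (nfst x) * (nsnd y).+1 + nsnd (nfst y) * (nsnd x).+1)%N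
        ((nsnd x).+1 * (nsnd y).+1)%N.

Definition qmulc (x y : nat) : nat :=
  qcode (nfst (nfst x) * nfst (nfst y) + nsnd (nfst x) * nsnd (nfst y))%N
        (nfst (nfst x) * nsnd (nfst y) + nsnd (nfst x) * nfst (nfst y))%N
        ((nsnd x).+1 * (nsnd y).+1)%N.

Definition qoppc (x : nat) : nat := npair (npair (nsnd (nfst x)) (nfst (nfst x))) (nsnd x).

Definition qltc (x y : nat) : bool :=
  (nfst (nfst x) * (nsnd y).+1 + nsnd (nfst y) * (nsnd x).+1
   < nfst (nfst y) * (nsnd x).+1 + nsnd (nfst x) * (nsnd y).+1)%N.

Definition qsumc (n : nat) (F : nat -> nat) : nat :=
  iteri n (fun i acc => qaddc acc (F i)) 0%N.

Lemma qval_code a b d : (0 < d)%N -> qval (qcode a b d) = (a%:R - b%:R) / d%:R.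
Proof. by move=> d0; rewrite unlock /qcode !(nfst_pair, nsnd_pair) prednK. Qed.

Lemma qval0 : qval 0 = 0.
Proof.
have f0 : nfst 0 = 0%N by rewrite /nfst logn1.
by rewrite unlock /nsnd !f0 subrr mul0r.
Qed.

Lemma qvalD x y : qval (qaddc x y) = qval x + qval y.
Proof.
rewrite qval_code ?muln_gt0 // unlock !(natrD, natrM).
by field; rewrite !nat1r !pnatr_eq0.
Qed.

Lemma qvalM x y : qval (qmulc x y) = qval x * qval y.
Proof.
rewrite qval_code ?muln_gt0 // unlock !(natrD, natrM).
by field; rewrite !nat1r !pnatr_eq0.
Qed.

Lemma qvalN x : qval (qoppc x) = - qval x.
Proof. by rewrite unlock /qoppc !(nfst_pair, nsnd_pair); field; rewrite !nat1r !pnatr_eq0. Qed.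

Lemma qval_lt x y : qltc x y = (qval x < qval y).
Proof.
rewrite unlock ltr_pdivrMr ?ltr0n // mulrAC ltr_pdivlMr ?ltr0n //.
rewrite /qltc -(ltr_nat rat) !(natrD, natrM) !mulrBl -!natrM.
by rewrite ltrBlDr [X in _ = (_ < X)]addrAC ltrBrDr.
Qed.

Lemma qval_sum n F : qval (qsumc n F) = \sum_(i < n) qval (F i).
Proof.
elim: n => [|n IHn]; first by rewrite big_ord0 qval0.
by rewrite big_ord_recr /= -IHn -qvalD.
Qed.

Lemma qval_surj (q : rat) : exists c, qval c = q.
Proof.
exists (qcode (if numq q is Posz p then p else 0%N) (if numq q is Negz p then p.+1 else 0%N)
  `|denq q|%N).
rewrite qval_code ?absz_gt0 ?denq_neq0 // -[RHS]divq_num_den.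
have -> : (denq q)%:~R = `|denq q|%N%:R :> rat by rewrite pmulrn absz_denq.
congr (_ / _).
by case: (numq q) => p; rewrite ?subr0 // sub0r NegzE mulrNz.
Qed.

Lemma computable_qaddc f g :
  computable f -> computable g -> computable (fun x => qaddc (f x) (g x)).
Proof. by apply: computable_app2; rewrite /qaddc /qcode; auto 20 with computable. Qed.

Lemma computable_qmulc f g :
  computable f -> computable g -> computable (fun x => qmulc (f x) (g x)).
Proof. by apply: computable_app2; rewrite /qmulc /qcode; auto 20 with computable. Qed.

Lemma computable_qoppc f : computable f -> computable (fun x => qoppc (f x)).
Proof. by move=> cf; rewrite /qoppc; auto 20 with computable. Qed.

Lemma decidable_qltc f g :
  computable f -> computable g -> decidable_pred (fun x => qltc (f x) (g x)).
Proof. by move=> cf cg; rewrite /qltc; auto 20 with computable. Qed.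
#[global] Hint Resolve computable_qaddc computable_qmulc computable_qoppc
  decidable_qltc : computable.

Lemma computable_qsumc n F :
    computable n -> computable (fun z => F (nfst z) (nsnd z)) ->
  computable (fun x => qsumc (n x) (F x)).
Proof.
move=> cn cF; rewrite /qsumc; apply: computable_iteri => //; first exact: computable_const.
apply: computable_qaddc; first by auto with computable.
by apply: computable_app2 cF _ _; auto with computable.
Qed.
#[global] Hint Resolve computable_qsumc : computable.

(** * Decoding the pickled scalars and intervals *)

Definition is_pairc c := [&& c != 0, tlc c != 0 & tlc (tlc c) == 0]%N.
Definition sndc c := hdc (tlc c).

Lemma is_pairc_code s : is_pairc (seqcode s) = (size s == 2%N).
Proof.
by rewrite /is_pairc !tlc_code !seqcode_eq0; case: s => [|a [|b []]].
Qed.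

Lemma unpickle_pair (T1 T2 : countType) c :
  (unpickle c : option (T1 * T2)) =
  if is_pairc c then obind (fun a => omap (pair a) (unpickle (sndc c))) (unpickle (hdc c))
  else None.
Proof.
rewrite /unpickle /= /pcomp /= /unpickle /= /unpickle_tagged.
rewrite -{2 3 4}[c]decodeK is_pairc_code /sndc tlc_code !hdc_code.
case: (CodeSeq.decode c) => [|a [|b []]] //=.
by rewrite /unpickle; case: (Choice_isCountable.unpickle _ a) => //= x; case: (Choice_isCountable.unpickle _ b).
Qed.

Lemma pickle_pairE (a b : nat) : pickle (a, b) = seqcode [:: a; b].
Proof. by rewrite seqcodeE. Qed.

Lemma unpickle_natpair c :
  (unpickle c : option (nat * nat)) = if is_pairc c then Some (hdc c, sndc c) else None.
Proof. by rewrite unpickle_pair. Qed.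

(** An integer is pickled as a pair of options, one for each sign, with 0 for [None]. The second
    component wins when both are present, and [Negz n] is -(n + 1), whence the successor in
    [int_negc]. *)
Definition int_okc c := is_pairc c && ((sndc c != 0) || (hdc c != 0))%N.
Definition int_posc c := if (sndc c == 0)%N then hdc (hdc c) else 0%N.
Definition int_negc c := if (sndc c == 0)%N then 0%N else (hdc (sndc c)).+1.

Lemma unpickle_opt_nat c :
  (unpickle c : option (option nat)) = Some (if (c == 0)%N then None else Some (hdc c)).
Proof.
rewrite /unpickle /= /pcomp /= /unpickle_seq.
rewrite -{2 3}[c]decodeK seqcode_eq0 hdc_code.
by case: (CodeSeq.decode c).
Qed.

Lemma unpickle_int c :
  (unpickle c : option int) =
  if int_okc c then Some ((int_posc c)%:Z - (int_negc c)%:Z) else None.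
Proof.
rewrite /unpickle /= /pcomp /= /unpickle /= /pcomp /= unpickle_pair.
rewrite /int_okc /int_posc /int_negc; case: is_pairc => //.
rewrite !unpickle_opt_nat /=; case: (sndc c == 0%N) => /=; last by rewrite sub0r -NegzE.
by case: (hdc c == 0%N) => //=; rewrite subr0.
Qed.

(** Trial division over bounded ranges, so that computability follows from [all_below] alone. *)
Definition coprimec m n :=
  all_below n.+1 (fun d => (d == 1)%N ||
    all_below m.+1 (fun x => (x * d != m)%N) || all_below n.+1 (fun x => (x * d != n)%N)).

Lemma coprimecE m n : (0 < n)%N -> coprimec m n = coprime m n.
Proof.
have no_div a d : ~~ all_below a.+1 (fun x => (x * d != a)%N) -> (d %| a)%N.
  by move=> /allPn[x _]; rewrite negbK => /eqP<-; rewrite dvdn_mull.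
move=> n0; apply/all_belowP/idP => [H | mn d _].
  rewrite /coprime eq_sym eqn_leq gcdn_gt0 n0 orbT /=.
  have := H (gcdn m n); rewrite ltnS dvdn_leq ?dvdn_gcdr // => /(_ isT).
  case/orP => [/orP[/eqP->// | /all_belowP nm] | /all_belowP nn].
    have /dvdnP[x eq_x] := dvdn_gcdl m n.
    have le_x : (x < m.+1)%N by rewrite ltnS [X in (_ <= X)%N]eq_x leq_pmulr // gcdn_gt0 n0 orbT.
    by have := nm _ le_x; rewrite -eq_x eqxx.
  have /dvdnP[x eq_x] := dvdn_gcdr m n.
  have le_x : (x < n.+1)%N by rewrite ltnS [X in (_ <= X)%N]eq_x leq_pmulr // gcdn_gt0 n0 orbT.
  by have := nn _ le_x; rewrite -eq_x eqxx.
apply: contraT; rewrite !negb_or -andbA => /and3P[d1 /no_div dm /no_div dn].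
have : (d %| gcdn m n)%N by rewrite dvdn_gcd dm.
by rewrite (eqP mn) dvdn1 (negbTE d1).
Qed.

(** A fraction that is not in lowest terms, or has a nonpositive denominator, does not decode and
    falls back to the default value 0. The enumeration of scalars and intervals depends on this, so
    the test has to be computed. *)
Definition rat_okc c :=
  [&& is_pairc c, int_okc (hdc c), int_okc (sndc c), (0 < int_posc (sndc c))%N &
      coprimec (int_posc (hdc c) + int_negc (hdc c)) (int_posc (sndc c))].

Definition ratc c :=
  if rat_okc c then
    qcode (int_posc (hdc c)) (int_negc (hdc c)) (int_posc (sndc c))
  else 0%N.

Lemma int_posneg0 c : int_posc c = 0%N \/ int_negc c = 0%N.
Proof. by rewrite /int_posc /int_negc; case: ifP; [right | left]. Qed.

Arguments qcode : simpl never.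
Arguments coprimec : simpl never.

Lemma unpickle_rat c :
  (unpickle c : option rat) = if rat_okc c then Some (qval (ratc c)) else None.
Proof.
rewrite /unpickle /= /pcomp /= unpickle_pair /ratc /rat_okc.
case: is_pairc => [|//]; rewrite !unpickle_int.
case: (int_okc (hdc c)) => [|//]; case: (int_okc (sndc c)) => [|//].
set p := int_posc (sndc c); set q := int_negc (sndc c).
set a := int_posc (hdc c); set b := int_negc (hdc c).
have -> : obind insub (obind (fun x => omap (pair x) (Some (p%:Z - q%:Z)%R)) (Some (a%:Z - b%:Z)%R))
  = insub (a%:Z - b%:Z, p%:Z - q%:Z) :> option rat by [].
have absab : `|a%:Z - b%:Z|%N = (a + b)%N.
  by case: (int_posneg0 (hdc c)); rewrite -/a -/b => ->; lia.
rewrite !andTb; case: (posnP p) => [p0 | p0].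
  rewrite insubF // p0; apply/negbTE; rewrite negb_and; apply/orP; left.
  by rewrite -leNgt; change (0%:Z - q%:Z <= 0)%R; lia.
have q0 : q = 0%N by have [|//] := int_posneg0 (sndc c); rewrite -/p => p0'; lia.
rewrite q0 subr0 andTb coprimecE //.
have pq0 : (0 < p%:Z)%R by lia.
have okE : (0 < p%:Z)%R && coprime `|a%:Z - b%:Z| `|p%:Z| = coprime (a + b) p.
  by rewrite pq0 absab.
case: ifP => cop; last by rewrite insubF // okE.
rewrite insubT ?okE // => H; congr Some; rewrite cop qval_code //.
by rewrite -[LHS]divq_num_den /numq /denq [valq _]/= rmorphB -!pmulrn.
Qed.

Lemma qval_ratc c : qval (ratc c) = odflt 0 (unpickle c : option rat).
Proof. by rewrite unpickle_rat; case: ifP => // H; rewrite /ratc H qval0. Qed.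

Definition rat_pair_okc c := [&& is_pairc c, rat_okc (hdc c) & rat_okc (sndc c)].
Definition rat_fstc c := if rat_pair_okc c then ratc (hdc c) else 0%N.
Definition rat_sndc c := if rat_pair_okc c then ratc (sndc c) else 0%N.

Lemma unpickle_rat_pair c :
  odflt (0, 0) (unpickle c : option (rat * rat)) = (qval (rat_fstc c), qval (rat_sndc c)).
Proof.
rewrite unpickle_pair !unpickle_rat /rat_fstc /rat_sndc /rat_pair_okc.
by case: is_pairc; rewrite ?qval0 //=; do 2!case: rat_okc; rewrite ?qval0.
Qed.

Definition qone := npair (npair 1 0) 0.

Lemma qval1 : qval qone = 1.
Proof. by rewrite unlock /qone !(nfst_pair, nsnd_pair) subr0 divr1. Qed.

Definition lo_c n := rat_fstc n.
Definition hi_c n := qaddc (rat_fstc n) (if qltc 0 (rat_sndc n) then rat_sndc n else qone).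

Lemma rat_intervalE n : rat_interval n = (qval (lo_c n), qval (hi_c n)).
Proof.
rewrite /rat_interval unpickle_rat_pair /hi_c qvalD qval_lt qval0.
by case: ifP; rewrite ?qval1.
Qed.

Lemma decidable_is_pairc f : computable f -> decidable_pred (fun x => is_pairc (f x)).
Proof. by move=> cf; rewrite /is_pairc; auto 20 with computable. Qed.
Lemma computable_sndc f : computable f -> computable (fun x => sndc (f x)).
Proof. by move=> cf; rewrite /sndc; auto 20 with computable. Qed.
#[global] Hint Resolve decidable_is_pairc computable_sndc : computable.

Lemma decidable_int_okc f : computable f -> decidable_pred (fun x => int_okc (f x)).
Proof. by move=> cf; rewrite /int_okc; auto 20 with computable. Qed.
Lemma computable_int_posc f : computable f -> computable (fun x => int_posc (f x)).
Proof. by move=> cf; rewrite /int_posc; auto 20 with computable. Qed.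
Lemma computable_int_negc f : computable f -> computable (fun x => int_negc (f x)).
Proof. by move=> cf; rewrite /int_negc; auto 20 with computable. Qed.
Lemma decidable_coprimec f g :
  computable f -> computable g -> decidable_pred (fun x => coprimec (f x) (g x)).
Proof.
have c2 : decidable_pred (fun z => coprimec (nfst z) (nsnd z)).
  by rewrite /coprimec; auto 30 with computable.
move=> cf cg; apply: (computable_ext _ (computable_comp c2 (computable_pair cf cg))) => x.
by rewrite nfst_pair nsnd_pair.
Qed.
#[global] Hint Resolve decidable_int_okc computable_int_posc computable_int_negc
  decidable_coprimec : computable.

Lemma decidable_rat_okc f : computable f -> decidable_pred (fun x => rat_okc (f x)).
Proof. by move=> cf; rewrite /rat_okc; auto 20 with computable. Qed.
#[global] Hint Resolve decidable_rat_okc : computable.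

Lemma computable_ratc f : computable f -> computable (fun x => ratc (f x)).
Proof. by move=> cf; rewrite /ratc /qcode; auto 20 with computable. Qed.
#[global] Hint Resolve computable_ratc : computable.

Lemma computable_rat_fstc f : computable f -> computable (fun x => rat_fstc (f x)).
Proof. by move=> cf; rewrite /rat_fstc /rat_pair_okc; auto 20 with computable. Qed.
Lemma computable_rat_sndc f : computable f -> computable (fun x => rat_sndc (f x)).
Proof. by move=> cf; rewrite /rat_sndc /rat_pair_okc; auto 20 with computable. Qed.
#[global] Hint Resolve computable_rat_fstc computable_rat_sndc : computable.

Lemma computable_lo_c f : computable f -> computable (fun x => lo_c (f x)).
Proof. by move=> cf; rewrite /lo_c; auto 20 with computable. Qed.
Lemma computable_hi_c f : computable f -> computable (fun x => hi_c (f x)).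
Proof. by move=> cf; rewrite /hi_c; auto 20 with computable. Qed.
#[global] Hint Resolve computable_lo_c computable_hi_c : computable.

Import numFieldNormedType.Exports.
Local Open Scope classical_set_scope.

(** * Scalars *)

(* Both scalar fields are handled at once: a scalar is a pair of real
   coordinates, the second one being frozen to 0 when the field is real. *)
Record scalars (R : realType) := Scalars {
  scal :> numFieldType;
  is_cplx : bool;
  re : scal -> R;
  im : scal -> R;
  mk : R -> R -> scal;
  mk_eta : forall z, mk (re z) (im z) = z;
  re_mk : forall a b, re (mk a b) = a;
  im_mk : forall a b, im (mk a b) = if is_cplx then b else 0;
  reD : forall x y, re (x + y) = re x + re y;
  imD : forall x y, im (x + y) = im x + im y;
  reM : forall x y, re (x * y) = re x * re y - im x * im y;
  imM : forall x y, im (x * y) = re x * im y + im x * re y;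
  re1 : re 1 = 1;
  im1 : im 1 = 0;
  norm_mk : forall z, `|z| = mk (Num.sqrt (re z ^+ 2 + im z ^+ 2)) 0;
  mk_le : forall a b, (mk a 0 <= mk b 0) = (a <= b);
  qs : nat -> scal;
  qre : nat -> nat;
  qim : nat -> nat;
  re_qs : forall k, re (qs k) = ratr (qval (qre k));
  im_qs : forall k, im (qs k) = ratr (qval (qim k));
  qs_surj : forall a b : rat, exists k, qval (qre k) = a /\
              qval (qim k) = if is_cplx then b else 0;
  computable_qre : computable qre;
  computable_qim : computable qim }.

(** Closed with [Defined], like the complex instance: the final theorem is obtained by converting
    the projections of these records back to the concrete fields and to [qscalR], [qscalC]. *)
Definition real_scalars (R : realType) : scalars R.
Proof.
apply: (@Scalars R R false (fun z => z) (fun=> 0) (fun a _ => a)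
  _ _ _ _ _ _ _ _ _ _ _ (@qscalR R) ratc (fun=> 0%N)) => //=.
- by move=> x y; rewrite addr0.
- by move=> x y; rewrite mulr0 subr0.
- by move=> x y; rewrite mulr0 mul0r addr0.
- by move=> z; rewrite expr0n addr0 sqrtr_sqr.
- by move=> k; rewrite qval_ratc.
- by move=> k; rewrite qval0 rmorph0.
- by move=> a _; exists (pickle a); rewrite qval_ratc pickleK qval0.
- by apply: computable_ratc; exact: computable_id.
- exact: computable_const.
Defined.

Definition complex_scalars (R : realType) : scalars R.
Proof.
apply: (@Scalars R R[i] true (@complex.Re R) (@complex.Im R) (@Complex R)
  _ _ _ _ _ _ _ _ _ _ _ (@qscalC R) rat_fstc rat_sndc) => //=.
- by case.
- by case=> a b [c d].
- by case=> a b [c d].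
- by case=> a b [c d].
- by case=> a b [c d].
- by case=> a b; rewrite normc_def.
- by move=> a b; rewrite lecE /= eqxx.
- by move=> k; rewrite /qscalC unpickle_rat_pair.
- by move=> k; rewrite /qscalC unpickle_rat_pair.
- move=> a b; exists (pickle (a, b)); have := unpickle_rat_pair (pickle (a, b)).
  by rewrite pickleK /= => -[<- <-].
- by apply: computable_rat_fstc; exact: computable_id.
- by apply: computable_rat_sndc; exact: computable_id.
Defined.

Section ScalarTheory.
Variables (R : realType) (S : scalars R).
Implicit Types (x y z : S) (a b : R).

Lemma scal_eq x y : re x = re y -> im x = im y -> x = y.
Proof. by move=> rxy ixy; rewrite -(mk_eta x) -(mk_eta y) rxy ixy. Qed.

Lemma re0 : re (0 : S) = 0.
Proof. by apply: (addrI (re (0 : S))); rewrite -reD !addr0. Qed.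

Lemma im0 : im (0 : S) = 0.
Proof. by apply: (addrI (im (0 : S))); rewrite -imD !addr0. Qed.

Lemma reN x : re (- x) = - re x.
Proof. by apply: (addrI (re x)); rewrite -reD !subrr re0. Qed.

Lemma imN x : im (- x) = - im x.
Proof. by apply: (addrI (im x)); rewrite -imD !subrr im0. Qed.

Lemma re_sum I (r : seq I) (P : pred I) (F : I -> S) :
  re (\sum_(i <- r | P i) F i) = \sum_(i <- r | P i) re (F i).
Proof. by apply: (big_morph (@re R S)); [exact: reD | exact: re0]. Qed.

Lemma im_sum I (r : seq I) (P : pred I) (F : I -> S) :
  im (\sum_(i <- r | P i) F i) = \sum_(i <- r | P i) im (F i).
Proof. by apply: (big_morph (@im R S)); [exact: imD | exact: im0]. Qed.

Lemma im_real x : is_cplx S = false -> im x = 0.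
Proof. by move=> cS; rewrite -(mk_eta x) im_mk cS. Qed.

Definition rl a : S := mk S a 0.

Lemma re_rl a : re (rl a) = a. Proof. exact: re_mk. Qed.
Lemma im_rl a : im (rl a) = 0. Proof. by rewrite im_mk; case: ifP. Qed.

Definition scalE := (re_rl, im_rl, re_mk, reD, imD, reM, imM, reN, imN, re0, im0, re1, im1).

Lemma rl_inj : injective rl.
Proof. by move=> a b /(congr1 (@re R S)); rewrite !re_rl. Qed.

Fact rl_zmod_morphism : zmod_morphism rl.
Proof. by move=> a b; apply: scal_eq; rewrite !scalE // subrr. Qed.

Fact rl_monoid_morphism : monoid_morphism rl.
Proof.
split=> [|a b]; apply: scal_eq; rewrite !scalE //; first by rewrite mulr0 subr0.
by rewrite mulr0 mul0r addr0.
Qed.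

HB.instance Definition _ := GRing.isZmodMorphism.Build R S rl rl_zmod_morphism.
HB.instance Definition _ := GRing.isMonoidMorphism.Build R S rl rl_monoid_morphism.

Lemma rl_le a b : (rl a <= rl b) = (a <= b). Proof. exact: mk_le. Qed.
Lemma rl_lt a b : (rl a < rl b) = (a < b).
Proof. by rewrite !lt_neqAle rl_le (inj_eq rl_inj). Qed.

Definition nsq x : R := re x ^+ 2 + im x ^+ 2.

Lemma nsq_ge0 x : 0 <= nsq x.
Proof. by rewrite addr_ge0 ?sqr_ge0. Qed.

Lemma nsq0 : nsq 0 = 0.
Proof. by rewrite /nsq !scalE expr0n addr0. Qed.

Lemma nsq_rl a : nsq (rl a) = a ^+ 2.
Proof. by rewrite /nsq !scalE expr0n addr0. Qed.

Lemma nsqM x y : nsq (x * y) = nsq x * nsq y.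
Proof. by rewrite /nsq !scalE; ring. Qed.

Lemma nsqN x : nsq (- x) = nsq x.
Proof. by rewrite /nsq !scalE; ring. Qed.

Lemma nsq_eq0 x : nsq x = 0 -> x = 0.
Proof.
move=> /eqP; rewrite paddr_eq0 ?sqr_ge0 // !sqrf_eq0 => /andP[/eqP rx /eqP ix].
by apply: scal_eq; rewrite ?rx ?ix ?scalE.
Qed.

Lemma normE x : `|x| = rl (Num.sqrt (nsq x)).
Proof. exact: norm_mk. Qed.

Lemma norm_sqr x : `|x| ^+ 2 = rl (nsq x).
Proof. by rewrite normE -rmorphXn /= sqr_sqrtr // nsq_ge0. Qed.

Lemma ge0_rl x : 0 <= x -> x = rl (re x).
Proof. by move=> /ger0_norm; rewrite normE => <-; rewrite re_rl. Qed.

Lemma gt0_re x : 0 < x -> 0 < re x.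
Proof. by move=> x0; have := x0; rewrite (ge0_rl (ltW x0)) -(rmorph0 rl) rl_lt re_rl. Qed.

Lemma rl_ratr q : rl (ratr q) = ratr q.
Proof. exact: fmorph_rat. Qed.

Lemma in_rat_interval_rl a n :
  in_rat_interval (rl a) n = (ratr (qval (lo_c n)) < a < ratr (qval (hi_c n))).
Proof. by rewrite /in_rat_interval rat_intervalE /= -!rl_ratr !rl_lt. Qed.

End ScalarTheory.

Lemma cvgr_sum (K : numFieldType) (V : normedModType K) (T I : Type)
    (F : set_system T) {FF : Filter F} (r : seq I) (P : pred I) (f : I -> T -> V) (l : I -> V) :
  (forall i, P i -> f i @ F --> l i) ->
  (fun x => \sum_(i <- r | P i) f i x) @ F --> \sum_(i <- r | P i) l i.
Proof.
by move=> fl; apply: cvg_big => //; exact: add_continuous.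
Qed.

(** * The spaces [l2] and [l2_n] *)

Section Truncations.
Variables (R : realType) (S : scalars R).
Implicit Types x y : nat -> S.

Definition trunc (N : nat) x : R := \sum_(i < N) nsq (x i).

Lemma trunc_ge0 N x : 0 <= trunc N x.
Proof. by apply: sumr_ge0 => i _; apply: nsq_ge0. Qed.

Lemma truncS N x : trunc N.+1 x = trunc N x + nsq (x N).
Proof. by rewrite /trunc big_ord_recr. Qed.

Lemma trunc_mono x M N : (M <= N)%N -> trunc M x <= trunc N x.
Proof.
move=> /subnK<-; elim: (N - M)%N => //= k IHk.
by rewrite addSn truncS (le_trans IHk) // lerDl nsq_ge0.
Qed.

(** The real part of the scalar product of the first [N] coordinates, which is all that norms of
    sums can see. *)
Definition cross (N : nat) x y : R :=
  \sum_(i < N) (re (x i) * re (y i) + im (x i) * im (y i)).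

Lemma nsqD (a b : S) : nsq (a + b) = nsq a + nsq b + (re a * re b + im a * im b) *+ 2.
Proof. by rewrite /nsq !scalE; ring. Qed.

Lemma trunc_add N x y :
  trunc N (fun i => x i + y i) = trunc N x + trunc N y + cross N x y *+ 2.
Proof.
rewrite /trunc /cross -sumrMnl -!big_split /=.
by apply: eq_bigr => i _; rewrite nsqD.
Qed.

Lemma cauchy_schwarz_cross N x y : cross N x y ^+ 2 <= trunc N x * trunc N y.
Proof.
elim: N => [|N IHN]; first by rewrite /cross /trunc !big_ord0 mulr0 expr0n.
rewrite !truncS /cross big_ord_recr /= -/(cross N x y).
have := trunc_ge0 N x; have := trunc_ge0 N y; move: IHN.
have := nsq_ge0 (x N); have := nsq_ge0 (y N).
have : (re (x N) * re (y N) + im (x N) * im (y N)) ^+ 2 <= nsq (x N) * nsq (y N).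
  rewrite -subr_ge0 (_ : _ - _ = (re (x N) * im (y N) - im (x N) * re (y N)) ^+ 2) ?sqr_ge0 //.
  by rewrite /nsq; ring.
move: (nsq (x N)) (nsq (y N)) (trunc N x) (trunc N y) (cross N x y).
move: (_ + _) => p a b A B d pab b0 a0 dAB B0 A0.
(* Here [d] is the old sum and [p] the new term; only the mixed term of (d + p)^2 needs a bound. It
   follows from (dp)^2 <= (Ab)(aB) and the inequality of arithmetic and geometric means. *)
suff : 2 * (d * p) <= A * b + a * B by nra.
have [dp_neg|dp_pos] := leP (d * p) 0.
  by rewrite (@le_trans _ _ 0) ?addr_ge0 ?mulr_ge0 // pmulr_rle0.
have dp2 : 0 <= 2 * (d * p) by rewrite pmulr_rge0 // ltW.
have s0 : 0 <= A * b + a * B by rewrite addr_ge0 ?mulr_ge0.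
rewrite -(@ler_pXn2r _ 2) ?nnegrE //.
have : (d ^+ 2) * (p ^+ 2) <= (A * B) * (a * b) by rewrite ler_pM ?sqr_ge0.
have := sqr_ge0 (A * b - a * B); nra.
Qed.

Lemma trunc_minkowski N x y :
  Num.sqrt (trunc N (fun i => x i + y i)) <= Num.sqrt (trunc N x) + Num.sqrt (trunc N y).
Proof.
rewrite -(@ler_pXn2r _ 2) ?nnegrE ?addr_ge0 ?sqrtr_ge0 // sqrrD.
rewrite !sqr_sqrtr ?trunc_ge0 // trunc_add.
suff : cross N x y <= Num.sqrt (trunc N x) * Num.sqrt (trunc N y).
  by move: (_ * _) => p H; lra.
apply: (le_trans (ler_norm _)).
by rewrite -sqrtrM ?trunc_ge0 // -sqrtr_sqr ler_sqrt ?mulr_ge0 ?trunc_ge0 ?cauchy_schwarz_cross.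
Qed.

End Truncations.

Section L2Space.
Variables (R : realType) (S : scalars R) (D : option nat).

(** [None] stands for l2 itself and [Some n] for the copy of F^n inside it, so that both halves of
    the theorem share one space and one proof. *)
Definition in_dim (i : nat) : bool := if D is Some n then (i < n)%N else true.

Definition l2_pred : {pred nat -> S} := fun x =>
  `[< (exists C, forall N, trunc N x <= C) /\ forall i, ~~ in_dim i -> x i = 0 >].

Lemma truncZ N (a : S) (x : nat -> S) : trunc N (fun i => a * x i) = nsq a * trunc N x.
Proof. by rewrite /trunc mulr_sumr; apply: eq_bigr => i _; rewrite nsqM. Qed.

Fact l2_submod : GRing.submod_closed l2_pred.
Proof.
split=> [|a x y].
  rewrite unfold_in; apply/asboolP; split=> //.
  by exists 0 => N; rewrite /trunc big1 // => i _; exact: nsq0.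
rewrite !unfold_in => /asboolP[[C xC] x0] /asboolP[[B yB] y0]; apply/asboolP.
split=> [|i iD]; last by rewrite -[LHS]/(a * x i + y i) x0 // y0 // mulr0 addr0.
exists ((Num.sqrt (nsq a * C) + Num.sqrt B) ^+ 2) => N.
have le_a : nsq a * trunc N x <= nsq a * C by rewrite ler_wpM2l ?nsq_ge0.
rewrite -[X in X <= _]sqr_sqrtr ?trunc_ge0 // ler_pXn2r ?nnegrE ?addr_ge0 ?sqrtr_ge0 //.
apply: (le_trans (trunc_minkowski N (fun i => a * x i) y)).
rewrite truncZ lerD // ler_sqrt //; first by rewrite (le_trans _ le_a) // mulr_ge0 ?nsq_ge0 ?trunc_ge0.
by rewrite (le_trans (trunc_ge0 0 y)).
Qed.

HB.instance Definition _ := GRing.isSubmodClosed.Build S (nat -> S) l2_pred l2_submod.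

Record l2 := L2 { l2fun :> nat -> S; l2funP : l2fun \in l2_pred }.

HB.instance Definition _ := [isSub for l2fun].
HB.instance Definition _ := [Choice of l2 by <:].
HB.instance Definition _ := [SubChoice_isSubLmodule of l2 by <:].

Implicit Types x y : l2.

Lemma l2_eq x y : (forall i, x i = y i) -> x = y.
Proof. by move=> xy; apply/val_inj/funext. Qed.

Lemma l2D x y i : (x + y) i = x i + y i. Proof. by []. Qed.
Lemma l2N x i : (- x) i = - x i. Proof. by []. Qed.
Lemma l20 i : (0 : l2) i = 0. Proof. by []. Qed.
Lemma l2Z (a : S) x i : (a *: x) i = a * x i. Proof. by []. Qed.

Lemma l2_bound x : exists C, forall N, trunc N x <= C.
Proof. by have := l2funP x; rewrite unfold_in => /asboolP[]. Qed.

Lemma l2_dim x i : ~~ in_dim i -> x i = 0.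
Proof. by have := l2funP x; rewrite unfold_in => /asboolP[_]; apply. Qed.

Definition sqn x : R := limn (fun N => trunc N x).

Lemma trunc_cvg x : trunc N x @[N --> \oo] --> sqn x.
Proof.
apply: nondecreasing_is_cvgn; first by move=> M N; apply: trunc_mono.
by have [C xC] := l2_bound x; exists C => _ [N _ <-].
Qed.

Lemma trunc_le_sqn N x : trunc N x <= sqn x.
Proof.
apply: (@nondecreasing_cvgn_le _ (fun N => trunc N x)); first by move=> M N'; apply: trunc_mono.
exact: trunc_cvg.
Qed.

Lemma sqn_le x C : (forall N, trunc N x <= C) -> sqn x <= C.
Proof. by move=> xC; apply: limr_le; [exact: trunc_cvg | apply: nearW]. Qed.

Lemma sqn_ge0 x : 0 <= sqn x.
Proof. exact: le_trans (trunc_ge0 0 x) (trunc_le_sqn 0 x). Qed.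

Lemma sqn_trunc x N : (forall i, (N <= i)%N -> x i = 0) -> sqn x = trunc N x.
Proof.
move=> x0; apply/le_anti; rewrite trunc_le_sqn andbT; apply: sqn_le => M.
have [le_MN|/ltnW le_NM] := leqP M N; first exact: trunc_mono.
rewrite -(subnK le_NM); elim: (M - N)%N => //= k IHk.
by rewrite addSn truncS x0 ?leq_addl // nsq0 addr0.
Qed.

Definition rnorm x : R := Num.sqrt (sqn x).

Lemma rnorm_sqr x : rnorm x ^+ 2 = sqn x.
Proof. by rewrite sqr_sqrtr // sqn_ge0. Qed.

Lemma rnorm_ge0 x : 0 <= rnorm x. Proof. exact: sqrtr_ge0. Qed.

Lemma rnorm_le x C : 0 <= C -> (forall N, trunc N x <= C ^+ 2) -> rnorm x <= C.
Proof.
move=> C0 /sqn_le xC; rewrite -(@ler_pXn2r _ 2) ?nnegrE ?rnorm_ge0 //.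
by rewrite rnorm_sqr.
Qed.

Lemma sqrt_trunc_le N x : Num.sqrt (trunc N x) <= rnorm x.
Proof. by rewrite ler_sqrt ?sqn_ge0 // trunc_le_sqn. Qed.

Lemma rnormD x y : rnorm (x + y) <= rnorm x + rnorm y.
Proof.
apply: rnorm_le => [|N]; first by rewrite addr_ge0 ?rnorm_ge0.
rewrite -[X in X <= _]sqr_sqrtr ?trunc_ge0 // ler_pXn2r ?nnegrE ?addr_ge0 ?rnorm_ge0 ?sqrtr_ge0 //.
by apply: (le_trans (trunc_minkowski N x y)); rewrite lerD ?sqrt_trunc_le.
Qed.

Lemma sqnZ (a : S) x : sqn (a *: x) = nsq a * sqn x.
Proof.
apply: cvg_lim => //.
rewrite (_ : (fun N => trunc N (a *: x)) = (fun N => nsq a * trunc N x)); last first.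
  by apply/funext => N; rewrite -truncZ.
by apply: cvgMr; exact: trunc_cvg.
Qed.

Lemma rnormZ (a : S) x : rnorm (a *: x) = Num.sqrt (nsq a) * rnorm x.
Proof. by rewrite /rnorm sqnZ sqrtrM ?nsq_ge0. Qed.

Lemma rnormN x : rnorm (- x) = rnorm x.
Proof.
by rewrite -scaleN1r rnormZ nsqN /nsq re1 im1 expr1n expr0n addr0 sqrtr1 mul1r.
Qed.

Lemma rnorm_eq0 x : rnorm x = 0 -> x = 0.
Proof.
move=> rx0; have x0 : sqn x = 0 by rewrite -rnorm_sqr rx0 expr0n.
apply: l2_eq => i; apply: nsq_eq0; apply/le_anti; rewrite nsq_ge0 andbT.
rewrite -x0 (le_trans _ (trunc_le_sqn i.+1 x)) // truncS lerDr trunc_ge0 //.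
Qed.

Definition l2_norm x : S := rl S (rnorm x).

Fact l2_normD x y : l2_norm (x + y) <= l2_norm x + l2_norm y.
Proof. by rewrite /l2_norm -rmorphD /= rl_le rnormD. Qed.

Fact l2_normZ (a : S) x : l2_norm (a *: x) = `|a| * l2_norm x.
Proof. by rewrite /l2_norm rnormZ normE rmorphM. Qed.

Fact l2_norm_eq0 x : l2_norm x = 0 -> x = 0.
Proof. by rewrite /l2_norm -(rmorph0 (rl S)) => /(@rl_inj _ S)/rnorm_eq0. Qed.

HB.instance Definition _ :=
  @Lmodule_isNormed.Build S l2 l2_norm l2_normD l2_normZ l2_norm_eq0.

Lemma l2_normE x : `|x| = rl S (rnorm x). Proof. by []. Qed.

Lemma ball_l2 x (e : R) y : ball x (rl S e) y <-> rnorm (x - y) < e.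
Proof. by rewrite -ball_normE /ball_ /= l2_normE rl_lt. Qed.

Lemma nsq_coord_le x i : nsq (x i) <= sqn x.
Proof. by rewrite (le_trans _ (trunc_le_sqn i.+1 x)) // truncS lerDr trunc_ge0. Qed.

Lemma re_coord_le x i : `|re (x i)| <= rnorm x.
Proof.
rewrite -sqrtr_sqr ler_sqrt ?sqn_ge0 // (le_trans _ (nsq_coord_le x i)) //.
by rewrite lerDl sqr_ge0.
Qed.

Lemma im_coord_le x i : `|im (x i)| <= rnorm x.
Proof.
rewrite -sqrtr_sqr ler_sqrt ?sqn_ge0 // (le_trans _ (nsq_coord_le x i)) //.
by rewrite lerDr sqr_ge0.
Qed.

(** The only completeness at hand is that of [R], so the limit [y] is built coordinatewise from real
    and imaginary parts. Convergence in norm then follows from bounds on the truncations that are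
    uniform in the length. *)
Fact l2_complete (F : set_system l2) : ProperFilter F -> cauchy F -> cvg F.
Proof.
move=> FF /cauchyP Fc.
have Fball (e : R) : 0 < e -> exists x, F [set y | rnorm (x - y) < e].
  move=> e0; have [|x Fx] := Fc (rl S e); first by rewrite -(rmorph0 (rl S)) rl_lt.
  by exists x; apply: filterS Fx => y /ball_l2.
have cvg_coord (g : S -> R) i : (forall u v : S, g (u - v) = g u - g v) ->
    (forall x, `|g (x i)| <= rnorm x) -> cvg ((fun x : l2 => g (x i)) @ F).
  move=> gB gle; apply: cauchy_cvg; apply/cauchyP => e e0.
  have [x Fx] := Fball e e0; exists (g (x i)).
  suff H : F [set y : l2 | ball (g (x i)) e (g (y i))] by exact: H.
  apply: filterS Fx => y /= xy.
  by rewrite -ball_normE /ball_ /= -gB (le_lt_trans _ xy) // -l2N -l2D gle.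
have cre i : cvg ((fun x : l2 => re (x i)) @ F).
  by apply: cvg_coord => [u v|x]; rewrite ?reD ?reN ?re_coord_le.
have cim i : cvg ((fun x : l2 => im (x i)) @ F).
  by apply: cvg_coord => [u v|x]; rewrite ?imD ?imN ?im_coord_le.
pose y i : S := mk S (lim ((fun x : l2 => re (x i)) @ F)) (lim ((fun x : l2 => im (x i)) @ F)).
have im_y i : im (y i) = lim ((fun x : l2 => im (x i)) @ F).
  rewrite im_mk; case: ifP => // cS; apply/esym/cvg_lim => //.
  under eq_fun do rewrite im_real //.
  exact: cvg_cst.
have cvg_nsq i : (fun x : l2 => nsq (x i - y i)) @ F --> (0 : R).
  rewrite /nsq (_ : 0 = (re (y i) - re (y i)) ^+ 2 + (im (y i) - im (y i)) ^+ 2); last first.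
    by rewrite !subrr expr0n addr0.
  under eq_fun do rewrite !(reD, reN, imD, imN) !expr2.
  apply: cvgD; rewrite expr2; apply: cvgM; apply: cvgB; try exact: cvg_cst.
  - by rewrite re_mk; exact: cre.
  - by rewrite re_mk; exact: cre.
  - by rewrite im_y; exact: cim.
  - by rewrite im_y; exact: cim.
have cvg_tr N : (fun x : l2 => trunc N (fun i => x i - y i)) @ F --> (0 : R).
  have <- : \sum_(i < N) (0 : R) = 0 by rewrite big1.
  by apply: cvgr_sum => i _; exact: cvg_nsq.
(* The 3 collects e + e from two points of one ball of radius e, and e from a point [x'] close to
   [y] on the first [N] coordinates. Only [x'] depends on [N], not the set [A]. *)
have key (e : R) : 0 < e ->
    exists2 A, F A & forall x N, A x -> trunc N (fun i => x i - y i) <= (3 * e) ^+ 2.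
  move=> e0; have [x0 Fx0] := Fball e e0; exists [set x | rnorm (x0 - x) < e] => //.
  move=> x N /= x0x.
  have /cvgrPdist_lt/(_ (e ^+ 2)) := cvg_tr N; rewrite exprn_gt0 // => /(_ isT) Fn.
  have [x' [x0x' trx']] := @filter_ex _ _ FF _ (filterI Fx0 Fn).
  rewrite /= sub0r normrN ger0_norm ?trunc_ge0 // in trx'.
  rewrite -[X in X <= _]sqr_sqrtr ?trunc_ge0 // ler_pXn2r ?nnegrE ?sqrtr_ge0 //; last first.
    by rewrite mulr_ge0 // ltW.
  have -> : trunc N (fun i => x i - y i) = trunc N (fun i => (x - x') i + (x' i - y i)).
    by apply: eq_bigr => i _; rewrite l2D l2N addrA subrK.
  apply: (le_trans (trunc_minkowski _ _ _)).
  have h1 : Num.sqrt (trunc N (x - x')) <= e + e.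
    apply: (le_trans (sqrt_trunc_le N (x - x'))).
    have -> : x - x' = (x0 - x') - (x0 - x) by rewrite opprB [RHS]addrC addrA subrK.
    apply: (le_trans (rnormD _ _)); by rewrite lerD ?rnormN ?ltW.
  have h2 : Num.sqrt (trunc N (fun i => x' i - y i)) <= e.
    by rewrite -(ger0_norm (ltW e0)) -sqrtr_sqr ler_sqrt ?sqr_ge0 // ltW.
  by rewrite (le_trans (lerD h1 h2)) //; lra.
have yP : y \in l2_pred.
  have [A FA AP] := key 1 ltr01; have [x Ax] := @filter_ex _ _ FF _ FA.
  rewrite unfold_in; apply/asboolP; split; last first.
    move=> i iD; apply: scal_eq; rewrite ?re_mk ?im_y !scalE; apply: cvg_lim => //.
      by under eq_fun do rewrite l2_dim // scalE; exact: cvg_cst.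
    by under eq_fun do rewrite l2_dim // scalE; exact: cvg_cst.
  exists ((3 * 1 + rnorm x) ^+ 2) => N.
  rewrite -[X in X <= _]sqr_sqrtr ?trunc_ge0 // ler_pXn2r ?nnegrE ?sqrtr_ge0 ?addr_ge0 ?rnorm_ge0 //.
  have -> : trunc N y = trunc N (fun i => - (x i - y i) + x i).
    by apply: eq_bigr => i _; rewrite opprB subrK.
  apply: (le_trans (trunc_minkowski _ _ _)); rewrite lerD ?sqrt_trunc_le //.
  have -> : trunc N (fun i => - (x i - y i)) = trunc N (fun i => x i - y i).
    by apply: eq_bigr => i _; rewrite nsqN.
  have := AP x N Ax; rewrite -[X in X <= _]sqr_sqrtr ?trunc_ge0 // ler_pXn2r ?nnegrE ?sqrtr_ge0 //.
apply/cvg_ex; exists (L2 yP); apply/cvgrPdist_lt => e e0.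
have e4 : 0 < re e / 4 by rewrite divr_gt0 ?gt0_re.
have [A FA AP] := key _ e4; apply: filterS FA => x Ax.
rewrite distrC l2_normE (ge0_rl (ltW e0)) rl_lt.
apply: (@le_lt_trans _ _ (3 * (re e / 4))).
  by apply: rnorm_le => [|N]; [rewrite mulr_ge0 // ltW | exact: AP].
by have := gt0_re e0; lra.
Qed.

HB.instance Definition _ := Uniform_isComplete.Build l2 l2_complete.

Definition l2_space : completeNormedModType S := l2.

End L2Space.

(** * Presentations and isometric copies *)

Lemma presentationP (K : numFieldType) (B : completeNormedModType K) (Rp : nat -> B) :
  presentation Rp <->
  forall (x : B) (e : K), 0 < e -> exists2 y, lin_span Rp y & `|x - y| < e.
Proof.
split=> [pR x e e0|H].
  have : closure (lin_span Rp) x by rewrite pR.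
  move=> /(_ (ball x e) (nbhsx_ballx _ _ e0))[y [Ay]].
  by rewrite -ball_normE => xy; exists y.
apply/seteqP; split=> // x _ U /nbhs_ballP[e e0 xU].
have [y Ay xy] := H x e e0; exists y; split=> //.
by apply: xU; rewrite -ball_normE.
Qed.

Section Isometry.
Variables (R : realType) (S : scalars R).

Lemma norm_rl (a : R) : `|rl S a| = rl S `|a|.
Proof. by rewrite normE nsq_rl sqrtr_sqr. Qed.

Lemma cvg_rl (u : nat -> R) (l : R) : u @ \oo --> l -> (fun n => rl S (u n)) @ \oo --> rl S l.
Proof.
move=> /cvgrPdist_lt ul; apply/cvgrPdist_lt => e e0.
have := ul _ (gt0_re e0); apply: filterS => n.
by rewrite [X in _ -> (_ < X)%R](ge0_rl (ltW e0)) -rmorphB /= norm_rl rl_lt.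
Qed.

Lemma series_normE (x : nat -> S) :
  series (fun i => `|x i| ^+ 2) = (fun N => rl S (trunc N x)).
Proof.
apply/funext => N; rewrite /series /= big_mkord /trunc rmorph_sum.
by apply: eq_bigr => i _; rewrite norm_sqr.
Qed.

Lemma cvg_series_norm (x : nat -> S) :
  cvgn (series (fun i => `|x i| ^+ 2)) <-> exists C, forall N, trunc N x <= C.
Proof.
rewrite series_normE; split=> [cv|[C xC]].
  have /cvgrPdist_lt/(_ 1 ltr01)[N _ HN] := cv.
  exists (re (limn (fun N => rl S (trunc N x))) + 1) => M.
  have := HN (maxn M N) (leq_maxr _ _).
  move: (limn _) => l /=; rewrite normE -(rmorph1 (rl S)) rl_lt => H.
  apply: (le_trans (trunc_mono x (leq_maxl M N))).
  rewrite -lerBlDl; apply: le_trans (ltW H).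
  apply: (le_trans (ler_norm _)); rewrite -normrN opprB -sqrtr_sqr ler_sqrt ?nsq_ge0 //.
  by rewrite /nsq !scalE lerDl sqr_ge0.
have /cvg_ex[l xl] : cvgn (fun N => trunc N x).
  apply: nondecreasing_is_cvgn; first by move=> M N; apply: trunc_mono.
  by exists C => _ [N _ <-].
by apply/cvg_ex; exists (rl S l); apply: cvg_rl.
Qed.

Lemma limn_series_norm D (x : l2 S D) :
  limn (series (fun i => `|x i| ^+ 2)) = `|x| ^+ 2.
Proof.
rewrite series_normE l2_normE -rmorphXn /= rnorm_sqr.
by apply: cvg_lim => //; apply: cvg_rl; exact: trunc_cvg.
Qed.

(** The quantifier over abstract Banach spaces is removed: a surjective linear isometry preserves
    density and all norms, hence the diagram, so the presentation can be moved into the concrete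
    space. *)
Definition hilbert_name D (f : nat -> nat) : Prop :=
  exists Rp : nat -> l2_space S D, presentation Rp /\ names (@qs _ S) f Rp.

Lemma isometry_names D (B : completeNormedModType S) (T : B -> l2_space S D)
    (Rp : nat -> B) f :
    (forall (a : S) u v, T (a *: u + v) = a *: T u + T v) ->
    (forall y, exists b, T b = y) -> (forall b, `|T b| = `|b|) ->
    presentation Rp -> names (@qs _ S) f Rp ->
  hilbert_name D f.
Proof.
move=> Tlin Tsurj Tnorm /presentationP pR nR.
have T0 : T 0 = 0 by apply/eqP; rewrite -normr_eq0 Tnorm normr0.
have Tsum (I : Type) (s : seq I) (c : I -> S) (v : I -> B) :
    T (\sum_(i <- s) c i *: v i) = \sum_(i <- s) c i *: T (v i).
  by elim: s => [|i s IHs]; rewrite ?big_nil // !big_cons Tlin IHs.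
exists (T \o Rp); split; last first.
  rewrite /names nR; apply/seteqP.
  by split=> k [m [n [-> H]]]; exists m, n; split=> //; move: H;
    rewrite /rat_vector -?Tsum ?Tnorm //= -(Tsum _ _ (fun p => qs S p.1) (fun p => Rp p.2)) Tnorm.
apply/presentationP => y e e0; have [b <-] := Tsurj y.
have [c [s ->] bc] := pR b e e0; exists (T (\sum_(p <- s) p.1 *: Rp p.2)).
  by exists s; rewrite Tsum.
have -> : T b - T (\sum_(p <- s) p.1 *: Rp p.2) = T (b - \sum_(p <- s) p.1 *: Rp p.2).
  by rewrite [LHS]addrC -scaleN1r -Tlin scaleN1r addrC.
by rewrite Tnorm.
Qed.

Lemma eq_norm (V W : normedModType S) (v : V) (w : W) : `|v| ^+ 2 = `|w| ^+ 2 -> `|v| = `|w|.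
Proof. by move/eqP; rewrite eqrXn2 // => /eqP. Qed.

Lemma names_pres_l2 f : names_pres_of (@qs _ S) (@iso_l2 S) f <-> hilbert_name None f.
Proof.
split=> [[B [Rp [pR [nR [T [Tlin [Timg Tnorm]]]]]]]|[Rp [pR nR]]]; last first.
  exists (l2_space S None), Rp; split=> //; split=> //.
  exists (fun x : l2 S None => x : nat -> S); split=> //; split; last first.
    by move=> b; rewrite limn_series_norm.
  move=> x; rewrite cvg_series_norm; split=> [xC|[b <-]]; last exact: l2_bound.
  have xP : x \in l2_pred None by rewrite unfold_in; apply/asboolP.
  by exists (L2 xP).
have TP b : T b \in l2_pred None.
  by rewrite unfold_in; apply/asboolP; split=> //; apply/cvg_series_norm/Timg; exists b.
apply: (@isometry_names _ _ (fun b => L2 (TP b)) Rp) => //.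
- by move=> a u v; apply: l2_eq => i; rewrite l2D l2Z /= Tlin.
- move=> y; have [b by_] : exists b, T b = y by apply/Timg/cvg_series_norm/l2_bound.
  by exists b; apply: l2_eq => i; rewrite /= by_.
- by move=> b; apply: eq_norm; rewrite Tnorm -limn_series_norm.
Qed.

Lemma names_pres_l2n n f :
  names_pres_of (@qs _ S) (@iso_l2n S n) f <-> hilbert_name (Some n) f.
Proof.
pose ext (x : 'I_n -> S) (i : nat) : S := if insub i is Some j then x j else 0.
have extP x : ext x \in l2_pred (Some n).
  rewrite unfold_in; apply/asboolP; split=> [|i iD]; last by rewrite /ext insubF //; apply/negbTE.
  exists (trunc n (ext x)) => N; have [le_Nn|/ltnW le_nN] := leqP N n; first exact: trunc_mono.
  rewrite -(subnK le_nN); elim: (N - n)%N => //= k IHk.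
  by rewrite addSn truncS [ext x _]/ext insubF ?nsq0 ?addr0 //; apply/negbTE; rewrite -leqNgt leq_addl.
have norm_ext (x : l2 S (Some n)) : `|x| ^+ 2 = \sum_(i < n) `|x i| ^+ 2.
  rewrite l2_normE -rmorphXn /= rnorm_sqr (@sqn_trunc _ _ _ _ n); last first.
    by move=> i le_ni; apply: l2_dim; rewrite /= -leqNgt.
  by rewrite rmorph_sum; apply: eq_bigr => i _; rewrite norm_sqr.
have ext_ord x (i : 'I_n) : ext x i = x i.
  by rewrite /ext (insubT (fun k => (k < n)%N) (ltn_ord i)); congr x; apply: val_inj.
split=> [[B [Rp [pR [nR [T [Tlin [Tsurj Tnorm]]]]]]]|[Rp [pR nR]]]; last first.
  exists (l2_space S (Some n)), Rp; split=> //; split=> //.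
  exists (fun (x : l2 S (Some n)) (i : 'I_n) => x i); split=> //; split=> // x.
  by exists (L2 (extP x)); apply/funext => i /=.
apply: (@isometry_names _ _ (fun b => L2 (extP (T b))) Rp) => //.
- move=> a u v; apply: l2_eq => i; rewrite l2D l2Z /= /ext.
  by case: insub => [j|]; rewrite ?Tlin // mulr0 addr0.
- move=> y; have [b by_] := Tsurj (fun i => y i).
  exists b; apply: l2_eq => i; rewrite /= by_; rewrite /ext.
  case: insubP => [j _ <- //|iD]; by rewrite l2_dim.
- move=> b; apply: eq_norm; rewrite Tnorm norm_ext.
  by apply: eq_bigr => i _; rewrite /= ext_ord.
Qed.

End Isometry.

(** * Truncated vectors and the standard basis *)

Section Cut.
Variables (R : realType) (S : scalars R) (D : option nat).
Implicit Types (x : nat -> S) (y : l2 S D).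

Definition cutf x (N : nat) (i : nat) : S := if (i < N)%N && in_dim D i then x i else 0.

Fact cutf_in x N : cutf x N \in l2_pred D.
Proof.
rewrite unfold_in; apply/asboolP; split=> [|i /negbTE iD]; last by rewrite /cutf iD andbF.
exists (trunc N (cutf x N)) => M; have [le_MN|/ltnW le_NM] := leqP M N; first exact: trunc_mono.
rewrite -(subnK le_NM); elim: (M - N)%N => //= k IHk.
by rewrite addSn truncS /cutf ltnNge leq_addl nsq0 addr0.
Qed.

Definition l2cut x N : l2 S D := L2 (cutf_in x N).

Lemma cutE x N i : l2cut x N i = if (i < N)%N && in_dim D i then x i else 0.
Proof. by []. Qed.

Lemma cut_out x N i : (N <= i)%N -> l2cut x N i = 0.
Proof. by rewrite cutE ltnNge => ->. Qed.

Lemma sqn_cut y N : sqn (y - l2cut y N) <= sqn y - trunc N y.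
Proof.
apply: sqn_le => M; rewrite lerBrDr.
apply: le_trans (trunc_le_sqn (maxn M N) y).
apply: (@le_trans _ _ (trunc (maxn M N) (y - l2cut y N) + trunc N y)).
  by rewrite lerD2r trunc_mono ?leq_maxl.
suff -> : trunc (maxn M N) y = trunc (maxn M N) (y - l2cut y N) + trunc N y by [].
have le_N := leq_maxr M N; rewrite -(subnK le_N); elim: (_ - N)%N => [|k IHk].
  rewrite add0n -[LHS]add0r; congr (_ + _); rewrite /trunc big1 // => i _.
  rewrite l2D l2N cutE ltn_ord /=; case: ifP => [|/negbT iD]; first by rewrite subrr nsq0.
  by rewrite l2_dim // subr0 nsq0.
rewrite addSn !truncS IHk [RHS]addrAC; congr (_ + nsq _).
by rewrite l2D l2N cut_out ?leq_addl // subr0.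
Qed.

Lemma cut_approx y (e : R) : 0 < e -> exists N, rnorm (y - l2cut y N) < e.
Proof.
move=> e0; have /cvgrPdist_lt/(_ (e ^+ 2)) := @trunc_cvg _ _ _ y.
rewrite exprn_gt0 // => /(_ isT)[N _ /(_ N (leqnn N))] /= H.
exists N; rewrite -(@ltr_pXn2r _ 2) ?nnegrE ?rnorm_ge0 ?(ltW e0) // rnorm_sqr.
by apply: (le_lt_trans (sqn_cut y N)); apply: le_lt_trans H; exact: ler_norm.
Qed.

(** Outside the dimension this is the zero vector, because [l2cut] erases the coordinates that [D]
    forbids. *)
Definition l2delta l : l2 S D := l2cut (fun i => (i == l)%:R) l.+1.

Lemma deltaE l i : in_dim D l -> l2delta l i = (i == l)%:R.
Proof.
move=> lD; rewrite cutE; have [->|ne_il] := eqVneq i l; first by rewrite ltnSn lD.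
by case: ifP.
Qed.

Lemma cut_delta x N : l2cut x N = \sum_(l < N | in_dim D l) x l *: l2delta l.
Proof.
have sumE i : (\sum_(l < N | in_dim D l) x l *: l2delta l : l2 S D) i =
    \sum_(l < N | in_dim D l) x l * l2delta l i.
  by elim/big_rec2: _ => // l a b _ IH; rewrite l2D l2Z IH.
apply: l2_eq => i; rewrite cutE sumE; case: ifP => [/andP[lt_iN iD]|iN].
  rewrite (bigD1 (Ordinal lt_iN)) // deltaE // eqxx mulr1 big1 => [|l /andP[lD ne_li]]; first exact/esym/addr0.
  rewrite deltaE // (_ : (i == l) = false) ?mulr0 //.
  by apply: contra_neqF ne_li => /eqP il; apply: val_inj.
rewrite big1 // => l lD; rewrite deltaE // (_ : (i == l) = false) ?mulr0 //.
by apply: contraFF iN => /eqP->; rewrite ltn_ord lD.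
Qed.

End Cut.

(** If d < k, some nonzero row c satisfies cA = 0. Then c equals minus its product with the error AB
    - 1, so the sum of the |c_j| is at most itself times the total error, which is less than 1. The
    lemma is used over [S] to bound the dimension of the limit from above, and over [R] to bound it
    from below. *)
Lemma approx_identity (F : numFieldType) (k d : nat) (A : 'M[F]_(k, d)) (B : 'M[F]_(d, k)) :
  \sum_i \sum_j `|(A *m B) i j - (i == j)%:R| < 1 -> (k <= d)%N.
Proof.
move=> lt1; rewrite leqNgt; apply/negP => lt_dk.
have : kermx A != 0.
  rewrite -mxrank_eq0 mxrank_ker subn_eq0 -ltnNge.
  exact: leq_ltn_trans (rank_leq_col A) lt_dk.
case/rowV0Pn => c /sub_kermxP cA0 c_neq0.
set T := \sum_i _ in lt1.
have cE j : c 0 j = - \sum_i c 0 i * ((A *m B) i j - (i == j)%:R).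
  have : (c *m (A *m B)) 0 j = 0 by rewrite mulmxA cA0 mul0mx mxE.
  rewrite mxE => cAB; under eq_bigr do rewrite mulrBr.
  rewrite sumrB cAB sub0r opprK (bigD1 j) //= eqxx mulr1 big1 ?addr0 // => i /negbTE->.
  by rewrite mulr0.
have le_c : \sum_j `|c 0 j| <= (\sum_i `|c 0 i|) * T.
  have Tij i : \sum_j `|(A *m B) i j - (i == j)%:R| <= T.
    rewrite /T [X in _ <= X](bigD1 i) //= lerDl sumr_ge0 // => ? _.
    by apply: sumr_ge0 => ? _.
  apply: (@le_trans _ _ (\sum_j \sum_i `|c 0 i| * `|(A *m B) i j - (i == j)%:R|)).
    apply: ler_sum => j _; rewrite {1}cE normrN (le_trans (ler_norm_sum _ _ _)) //.
    by apply: ler_sum => i _; rewrite normrM.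
  rewrite exchange_big mulr_suml; apply: ler_sum => i _ /=.
  by rewrite -mulr_sumr ler_wpM2l.
have c_gt0 : 0 < \sum_j `|c 0 j|.
  rewrite lt0r sumr_ge0 // andbT; apply: contraNneq c_neq0 => /eqP.
  rewrite psumr_eq0 // => /allP c0; apply/eqP/rowP => j; rewrite mxE.
  by apply/eqP; rewrite -normr_eq0; apply: c0; rewrite mem_index_enum.
have : (\sum_i `|c 0 i|) * T < \sum_j `|c 0 j| by rewrite gtr_pMr.
by move=> /(le_lt_trans le_c); rewrite ltxx.
Qed.

(** * Conjugation, and Gram-Schmidt for semidefinite forms *)

Section Conjugation.
Variables (R : realType) (S : scalars R).
Implicit Types (x y z : S).

Definition cj z : S := mk S (re z) (- im z).

Lemma re_cj z : re (cj z) = re z. Proof. exact: re_mk. Qed.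
Lemma im_cj z : im (cj z) = - im z.
Proof.
by rewrite im_mk; case: (boolP (is_cplx S)) => // /negbTE cS; rewrite im_real ?oppr0.
Qed.

Definition cjE := (re_cj, im_cj).

Lemma cjK : involutive cj.
Proof. by move=> z; apply: scal_eq; rewrite !cjE // opprK. Qed.
Lemma cjD x y : cj (x + y) = cj x + cj y.
Proof. by apply: scal_eq; rewrite !(cjE, scalE) // opprD. Qed.
Lemma cjN x : cj (- x) = - cj x.
Proof. by apply: scal_eq; rewrite !(cjE, scalE). Qed.
Lemma cjM x y : cj (x * y) = cj x * cj y.
Proof. by apply: scal_eq; rewrite !(cjE, scalE) //; ring. Qed.
Lemma cj_rl a : cj (rl S a) = rl S a.
Proof. by apply: scal_eq; rewrite !(cjE, scalE) // oppr0. Qed.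
Lemma cj0 : cj 0 = 0. Proof. by rewrite -(rmorph0 (rl S)) cj_rl. Qed.
Lemma cj_sum I (r : seq I) (P : pred I) (F : I -> S) :
  cj (\sum_(i <- r | P i) F i) = \sum_(i <- r | P i) cj (F i).
Proof. by apply: (big_morph cj); [exact: cjD | exact: cj0]. Qed.
Lemma nsq_cj z : nsq (cj z) = nsq z.
Proof. by rewrite /nsq !cjE sqrrN. Qed.
Lemma norm_cj z : `|cj z| = `|z|.
Proof. by rewrite !normE nsq_cj. Qed.
Lemma mulr_cj z : z * cj z = rl S (nsq z).
Proof. by apply: scal_eq; rewrite !(cjE, scalE) /nsq; ring. Qed.
End Conjugation.

Section GramSchmidt.
Variables (R : realType) (S : scalars R) (V : lmodType S) (h : V -> V -> S).
Hypothesis hl : forall (a : S) u v w, h (a *: u + v) w = a * h u w + h v w.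
Hypothesis hc : forall u v, h v u = cj (h u v).
Hypothesis hp : forall u, 0 <= re (h u u).

Lemma h0l u : h 0 u = 0.
Proof.
apply: (addrI (h 0 u)); rewrite addr0.
by have := hl 1 0 0 u; rewrite scaler0 addr0 mul1r => /esym.
Qed.

Lemma hDl u v w : h (u + v) w = h u w + h v w.
Proof. by have := hl 1 u v w; rewrite scale1r mul1r. Qed.

Lemma hZl (a : S) u w : h (a *: u) w = a * h u w.
Proof. by have := hl a u 0 w; rewrite addr0 h0l addr0. Qed.

Lemma hBl u v w : h (u - v) w = h u w - h v w.
Proof. by rewrite hDl -scaleN1r hZl mulN1r. Qed.

Lemma h_suml I (r : seq I) (P : pred I) (F : I -> V) w :
  h (\sum_(i <- r | P i) F i) w = \sum_(i <- r | P i) h (F i) w.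
Proof. by apply: (big_morph (h ^~ w)); [move=> x y; exact: hDl | exact: h0l]. Qed.

Lemma h0r u : h u 0 = 0. Proof. by rewrite hc h0l cj0. Qed.
Lemma hDr u v w : h w (u + v) = h w u + h w v.
Proof. by rewrite hc hDl cjD -!hc. Qed.
Lemma hZr (a : S) u w : h w (a *: u) = cj a * h w u.
Proof. by rewrite hc hZl cjM -hc. Qed.

Lemma h_diag u : h u u = rl S (re (h u u)).
Proof.
apply: scal_eq; rewrite !scalE //.
by have := congr1 (@im R S) (hc u u); rewrite im_cj => ?; lra.
Qed.

(** Positivity at u + t h(u,v) v gives 0 <= q (2t + t^2 b) for all real t, with q = |h(u,v)|^2 and b
    = h(v,v). At t = -1/(1 + b) the bracket is negative, so q = 0. This is what allows null
    residuals to be dropped. *)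
Lemma h_null u v : re (h u u) = 0 -> h u v = 0.
Proof.
move=> u0; apply: nsq_eq0; set q := nsq _; set b := re (h v v).
have key (t : R) : 0 <= q * (t * 2 + t ^+ 2 * b).
  have := hp (u + rl S t * h u v *: v).
  rewrite hDl !hDr !hZl !hZr (hc u v) cjM cj_rl (h_diag v) -/b !reD u0 => /le_trans; apply.
  by rewrite le_eqVlt; apply/orP; left; apply/eqP; rewrite /q /nsq !(scalE, cjE); ring.
apply/le_anti; rewrite nsq_ge0 andbT -/q.
have b0 : 0 <= b := hp v.
have := key (- (1 + b)^-1); have b1 : 0 < 1 + b by rewrite ltr_pwDl.
have -> : q * (- (1 + b)^-1 * 2 + (- (1 + b)^-1) ^+ 2 * b) = - (q * ((2 + b) / (1 + b) ^+ 2)).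
  by field; rewrite gt_eqF.
rewrite oppr_ge0 pmulr_lle0 // divr_gt0 ?exprn_gt0 //; lra.
Qed.

Variable w : nat -> V.

Definition residual (es : seq V) (x : V) := x - \sum_(e <- es) h x e *: e.

(** A null residual cannot be normalized and is skipped, so the number of vectors found after j
    steps may be smaller than j. *)
Definition gs_step (es : seq V) (x : V) : seq V :=
  let p := residual es x in
  if re (h p p) == 0 then es else rcons es (rl S (Num.sqrt (re (h p p)))^-1 *: p).

Fixpoint gs (j : nat) : seq V := if j is j'.+1 then gs_step (gs j') (w j') else [::].

Definition orthonormal_seq (es : seq V) := forall i l, (i < size es)%N -> (l < size es)%N ->
  h (nth 0 es i) (nth 0 es l) = (i == l)%:R.

Lemma residual_orth es x l : orthonormal_seq es -> (l < size es)%N ->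
  h (residual es x) (nth 0 es l) = 0.
Proof.
move=> es_on lt_l; rewrite hBl h_suml (big_nth 0) big_mkord.
rewrite (bigD1 (Ordinal lt_l)) //= hZl es_on // eqxx mulr1 big1 ?addr0 ?subrr // => i ne_il.
rewrite hZl es_on // (_ : (_ == _) = false) ?mulr0 //.
by apply: contra_neqF ne_il => /eqP il; apply: val_inj.
Qed.

Lemma gs_orthonormal j : orthonormal_seq (gs j).
Proof.
elim: j => [|j IHj] //=; rewrite /gs_step; case: eqP => // /eqP q_neq0.
set p := residual _ _ in q_neq0 *; set q := re (h p p) in q_neq0 *.
have q0 : 0 < q by rewrite lt0r q_neq0 hp.
set c := rl S _.
have cc : c * cj c * rl S q = 1.
  rewrite /c cj_rl -!rmorphM /= -invfM -expr2 sqr_sqrtr ?(ltW q0) // mulVf ?rmorph1 //.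
have hp0 l : (l < size (gs j))%N -> h p (nth 0 (gs j) l) = 0 by exact: residual_orth.
move=> i l; rewrite size_rcons !ltnS !nth_rcons => le_i le_l.
case: (ltngtP i (size (gs j))) le_i => // [lt_i|eq_i] _;
  case: (ltngtP l (size (gs j))) le_l => // [lt_l|eq_l] _.
- exact: IHj.
- by rewrite hZr hc hp0 // cj0 mulr0 eq_l ltn_eqF.
- by rewrite hZl hp0 // mulr0 eq_i gtn_eqF.
- by rewrite eq_i eq_l eqxx hZl hZr (h_diag p) mulrA cc.
Qed.

(** In a degenerate form [w i] need not equal its projection on the orthonormal vectors. The
    difference is null, however, hence invisible to the form by [h_null], and the expansion holds
    after pairing with any [v]. *)
Lemma gs_repr j i v : (i < j)%N ->
  h (w i) v = \sum_(e <- gs j) h (w i) e * h e v.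
Proof.
elim: j i v => // j IHj i v; rewrite ltnS /= /gs_step => le_ij.
set p := residual _ _; set q := re (h p p).
have hw u : h (w j) u = \sum_(e <- gs j) h (w j) e * h e u + h p u.
  rewrite -[in LHS](subrK (\sum_(e <- gs j) h (w j) e *: e) (w j)) addrC hDl h_suml.
  by congr (_ + _); apply: eq_bigr => e _; rewrite hZl.
case: eqP => [q0|/eqP q_neq0].
  move: le_ij; rewrite leq_eqVlt => /orP[/eqP->|]; last exact: IHj.
  by rewrite hw h_null // addr0.
have q0 : 0 < q by rewrite lt0r q_neq0 hp.
set e0 := _ *: p.
have pe0 : p = rl S (Num.sqrt q) *: e0.
  by rewrite /e0 scalerA -rmorphM /= mulfV ?rmorph1 ?scale1r // gt_eqF // sqrtr_gt0.
have on := @gs_orthonormal j.+1; rewrite /= /gs_step -/p -/q (negbTE q_neq0) -/e0 in on.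
have orth e : e \in gs j -> h e e0 = 0.
  move=> /(nthP 0)[l lt_l <-]; have := on l (size (gs j)).
  rewrite size_rcons ltnS (ltnW lt_l) ltnSn => /(_ isT isT).
  by rewrite !nth_rcons lt_l ltnn eqxx => ->; rewrite ltn_eqF.
have he0 : h e0 e0 = 1.
  have := on (size (gs j)) (size (gs j)); rewrite size_rcons ltnSn => /(_ isT isT).
  by rewrite nth_rcons ltnn eqxx => ->.
rewrite -cats1 big_cat big_seq1 /=.
move: le_ij; rewrite leq_eqVlt => /orP[/eqP->|lt_ij].
  rewrite [LHS]hw pe0 hZl; congr (_ + _); congr (_ * _).
  rewrite hw big_seq big1 ?add0r; first by rewrite pe0 hZl he0 mulr1.
  by move=> e /orth->; rewrite mulr0.
rewrite [in LHS]IHj // (IHj _ e0) // [X in _ + X * _]big_seq [X in _ + X * _]big1 ?mul0r ?addr0 //.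
by move=> e /orth->; rewrite mulr0.
Qed.

Lemma gs_prefix j k i : (j <= k)%N -> (i < size (gs j))%N ->
  (size (gs j) <= size (gs k))%N /\ nth 0 (gs k) i = nth 0 (gs j) i.
Proof.
move=> /subnK<-; elim: (k - j)%N => [|m IHm] //= lt_i.
have [le_s eq_n] := IHm lt_i; rewrite /gs_step; case: ifP => // _.
by rewrite size_rcons (leq_trans le_s) // nth_rcons (leq_trans lt_i le_s).
Qed.

(** The growing lists are merged into one sequence [eps], with [r j] the number of vectors obtained
    from the first [j] inputs. Indices that are never reached, which occur when the form has finite
    rank, receive the vector 0. *)
Lemma gram_schmidt : exists (r : nat -> nat) (eps : nat -> V),
  [/\ {homo r : j k / (j <= k)%N >-> (j <= k)%N},
      forall j i l, (i < r j)%N -> (l < r j)%N -> h (eps i) (eps l) = (i == l)%:R,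
      forall i, (forall j, (r j <= i)%N) -> eps i = 0 &
      forall i j v, (i < j)%N ->
        h (w i) v = \sum_(l < r j) h (w i) (eps l) * h (eps l) v].
Proof.
pose r j := size (gs j).
(* Any stage at which index [i] is present will do, since later lists extend earlier ones. *)
pose eps i := nth 0 (gs (xget 0%N [set j | (i < r j)%N])) i.
have r_mono : {homo r : j k / (j <= k)%N >-> (j <= k)%N}.
  move=> j k le_jk; rewrite /r; case E: (size (gs j)) => // [n].
  by have [|] := @gs_prefix j k 0 le_jk; rewrite ?E.
have epsE j i : (i < r j)%N -> eps i = nth 0 (gs j) i.
  move=> lt_i; rewrite /eps; case: xgetP => [k _ /= lt_ik|/(_ j)]; last by [].
  case/orP: (leq_total j k) => le_jk; first by have [] := gs_prefix le_jk lt_i.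
  by have [] := gs_prefix le_jk lt_ik.
exists r, eps; split=> //.
- move=> j i l lt_i lt_l; rewrite !(epsE j) //; exact: gs_orthonormal.
- move=> i rle; rewrite /eps; case: xgetP => [k _ /=|_]; last by rewrite nth_nil.
  by rewrite ltnNge rle.
- move=> i j v lt_ij; rewrite (gs_repr v lt_ij) (big_nth 0) big_mkord.
  by apply: eq_bigr => l _; rewrite (epsE j).
Qed.

End GramSchmidt.

(** * Limits of rational models *)

Section RatVector.
Variables (R : realType) (S : scalars R).

(** Thanks to this the norm of a sum of two rational vectors can be read off the diagram, as
    polarization requires. *)
Lemma rat_vector_catc (V : lmodType S) (Rp : nat -> V) a b :
  rat_vector (@qs _ S) Rp (catc a b) = rat_vector (@qs _ S) Rp a + rat_vector (@qs _ S) Rp b.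
Proof.
rewrite /rat_vector -[a in LHS]decodeK -[b in LHS]decodeK catc_code.
rewrite /unpickle /= /unpickle_seq seqcodeK /=.
by rewrite pmap_cat big_cat.
Qed.

Lemma rat_vector_pickle (V : lmodType S) (Rp : nat -> V) (s : seq (nat * nat)) :
  rat_vector (@qs _ S) Rp (pickle s) = \sum_(p <- s) qs S p.1 *: Rp p.2.
Proof. by rewrite /rat_vector pickleK. Qed.

Lemma l2_sum D (I : Type) (r : seq I) (P : pred I) (F : I -> l2 S D) c :
  (\sum_(i <- r | P i) F i) c = \sum_(i <- r | P i) F i c.
Proof. by elim/big_rec2: _ => // i a b _ IH; rewrite l2D IH. Qed.

Lemma rat_vector_coord D (Rp : nat -> l2 S D) m c :
  rat_vector (@qs _ S) Rp m c =
  \sum_(p <- odflt [::] (unpickle m : option (seq (nat * nat)))) qs S p.1 * Rp p.2 c.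
Proof. by rewrite /rat_vector l2_sum. Qed.

Lemma qs_one : exists k, qs S k = 1.
Proof.
have [k [rk ik]] := qs_surj S 1 0; exists k.
by apply: scal_eq; rewrite ?re_qs ?im_qs ?rk ?ik !scalE ?rmorph1 //; case: is_cplx; rewrite rmorph0.
Qed.

(** Over the reals [mk S 0 1] is 0, so formulas that involve the imaginary unit remain valid for
    both fields. *)
Lemma qs_imag : exists k, qs S k = mk S 0 1.
Proof.
have [k [rk ik]] := qs_surj S 0 1; exists k.
by apply: scal_eq; rewrite ?re_qs ?im_qs ?rk ?ik ?re_mk ?im_mk ?rmorph0 //; case: is_cplx; rewrite ?rmorph1 ?rmorph0.
Qed.

Lemma scal_decomp (z : S) : z = rl S (re z) + rl S (im z) * mk S 0 1.
Proof.
apply: scal_eq; rewrite !scalE ?mul0r ?mulr0 ?subr0 ?addr0 // im_mk add0r.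
by case: (boolP (is_cplx S)) => [_|/negbTE cS]; [rewrite mulr1 | rewrite (im_real z cS) mulr0].
Qed.

Lemma cvg_scal (u : nat -> S) (a b : R) :
  re (u n) @[n --> \oo] --> a -> im (u n) @[n --> \oo] --> b ->
  u @ \oo --> rl S a + rl S b * mk S 0 1.
Proof.
move=> ua ub; rewrite (_ : u = fun n => rl S (re (u n)) + rl S (im (u n)) * mk S 0 1); last first.
  by apply/funext => n; exact: scal_decomp.
by apply: cvgD; [exact: cvg_rl | apply: cvgM; [exact: cvg_rl | exact: cvg_cst]].
Qed.

Lemma cvg_re (u : nat -> S) (l : S) : u @ \oo --> l -> re (u n) @[n --> \oo] --> re l.
Proof.
move=> /cvgrPdist_lt ul; apply/cvgrPdist_lt => e e0.
have rle0 : 0 < rl S e by rewrite -(rmorph0 (rl S)) rl_lt.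
have := ul _ rle0; apply: filterS => n; rewrite normE rl_lt; apply: le_lt_trans.
by rewrite -sqrtr_sqr ler_sqrt ?nsq_ge0 // /nsq !scalE lerDl sqr_ge0.
Qed.

Lemma cvg_cj (u : nat -> S) (l : S) : u @ \oo --> l -> cj (u n) @[n --> \oo] --> cj l.
Proof.
move=> /cvgrPdist_lt ul; apply/cvgrPdist_lt => e e0.
by have := ul _ e0; apply: filterS => n; rewrite -cjN -cjD norm_cj.
Qed.

Definition dot (N : nat) (x y : nat -> S) : S := \sum_(c < N) x c * cj (y c).

Lemma re_dot N x y : re (dot N x y) = cross N x y.
Proof.
by rewrite re_sum; apply: eq_bigr => c _; rewrite reM re_cj im_cj mulrN opprK.
Qed.

(** The imaginary part of a scalar product with y is a real part of one with iy, so norms determine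
    the whole hermitian form. *)
Lemma im_dot N x y : im (dot N x y) = cross N x (fun c => mk S 0 1 * y c).
Proof.
rewrite im_sum; apply: eq_bigr => c _; rewrite !(scalE, cjE) im_mk.
case: (boolP (is_cplx S)) => [_|/negbTE cS]; first by ring.
by rewrite !(@im_real _ S _ cS); ring.
Qed.

Lemma cross_sqn D (x y : l2 S D) N :
  (forall c, (N <= c)%N -> x c = 0) -> (forall c, (N <= c)%N -> y c = 0) ->
  cross N x y = (sqn (x + y) - sqn x - sqn y) / 2.
Proof.
move=> x0 y0; rewrite !(@sqn_trunc _ _ _ _ N) //; last first.
  by move=> c le_c; rewrite l2D x0 // y0 // addr0.
rewrite (_ : trunc N (x + y) = trunc N (fun c => x c + y c)) // trunc_add.
by rewrite addrAC -!addrA [X in _ + X]addrC; field.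
Qed.

Lemma dot_widen N M x y : (forall c, (N <= c)%N -> x c = 0) ->
  (forall c, (M <= c)%N -> x c = 0) -> dot N x y = dot M x y.
Proof.
have dotN A B : (A <= B)%N -> (forall c, (A <= c)%N -> x c = 0) -> dot B x y = dot A x y.
  move=> /subnK<- x0; elim: (B - A)%N => // k IHk; rewrite addSn /dot big_ord_recr /=.
  by rewrite -/(dot (k + A) x y) IHk x0 ?leq_addl // mul0r addr0.
by case/orP: (leq_total N M) => le_NM xN xM; [apply/esym|]; apply: dotN.
Qed.

End RatVector.

Section LinSpan.
Variables (K : numFieldType) (V : lmodType K) (Rp : nat -> V).

Lemma lin_spanD x y : lin_span Rp x -> lin_span Rp y -> lin_span Rp (x + y).
Proof. by move=> [s ->] [t ->]; exists (s ++ t); rewrite big_cat. Qed.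

Lemma lin_spanZ (a : K) x : lin_span Rp x -> lin_span Rp (a *: x).
Proof.
move=> [s ->]; exists [seq (a * p.1, p.2) | p <- s].
by rewrite big_map scaler_sumr; apply: eq_bigr => p _; rewrite scalerA.
Qed.

Lemma lin_span_sum I (r : seq I) (P : pred I) (F : I -> V) :
  (forall i, P i -> lin_span Rp (F i)) -> lin_span Rp (\sum_(i <- r | P i) F i).
Proof.
move=> FP; elim/big_rec: _ => [|i x Pi]; first by exists [::]; rewrite big_nil.
by apply: lin_spanD; exact: FP.
Qed.

Lemma lin_span_gen j : lin_span Rp (Rp j).
Proof. by exists [:: (1, j)]; rewrite big_seq1 scale1r. Qed.

End LinSpan.

Section LimitOfModels.
Variables (R : realType) (S : scalars R) (D : option nat).
Variables (v : nat -> nat -> l2 S D) (d : nat -> nat) (nm : nat -> R).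
Hypothesis v_out : forall s j c, (d s <= c)%N -> v s j c = 0.
Hypothesis nm_cvg : forall m,
  rnorm (rat_vector (@qs _ S) (v s) m) @[s --> \oo] --> nm m.

(** Polynomials serve as the free vector space on the generators, with ['X^j] for the j-th one;
    [lift s] evaluates such a formal vector in the s-th model. *)
Let lift s (p : {poly S}) : l2 S D := \sum_(j < size p) p`_j *: v s j.

Let liftE s (p : {poly S}) n : (size p <= n)%N -> lift s p = \sum_(j < n) p`_j *: v s j.
Proof.
move=> le_n; rewrite /lift (big_ord_widen n (fun j => p`_j *: v s j)) //.
rewrite big_mkcond; apply: eq_bigr => j _; case: ltnP => // le_j.
by rewrite nth_default // scale0r.
Qed.

Let lift_lin s (a : S) (p q : {poly S}) : lift s (a *: p + q) = a *: lift s p + lift s q.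
Proof.
pose n := maxn (size p) (size q).
have le_n : (size (a *: p + q)%R <= n)%N.
  by rewrite (leq_trans (size_polyD _ _)) // geq_max !leq_max size_scale_leq leqnn orbT.
rewrite (liftE s le_n) (liftE s (leq_maxl (size p) (size q))).
rewrite (liftE s (leq_maxr (size p) (size q))) scaler_sumr -big_split /=.
by apply: eq_bigr => j _; rewrite coefD coefZ scalerDl scalerA.
Qed.

Let lift_X s j : lift s 'X^j = v s j.
Proof.
rewrite /lift size_polyXn big_ord_recr /= coefXn eqxx scale1r big1 ?add0r // => i _.
by rewrite coefXn ltn_eqF ?scale0r.
Qed.

Let lift_out s p c : (d s <= c)%N -> lift s p c = 0.
Proof. by move=> le_c; rewrite l2_sum big1 // => j _; rewrite l2Z v_out ?mulr0. Qed.

Let lift_sum s I (r : seq I) (c : I -> S) (p : I -> {poly S}) :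
  lift s (\sum_(i <- r) c i *: p i) = \sum_(i <- r) c i *: lift s (p i).
Proof.
elim: r => [|i r IHr]; last by rewrite !big_cons lift_lin IHr.
by rewrite !big_nil /lift size_poly0 big_ord0.
Qed.

Let form s (p q : {poly S}) : S := dot (d s) (lift s p) (lift s q).

Let form_linear s (a : S) (p q w : {poly S}) : form s (a *: p + q) w = a * form s p w + form s q w.
Proof.
rewrite /form lift_lin /dot.
under eq_bigr do rewrite l2D l2Z mulrDl -mulrA.
by rewrite big_split -mulr_sumr.
Qed.

Let form_conj s p q : form s q p = cj (form s p q).
Proof.
by rewrite /form /dot cj_sum; apply: eq_bigr => c _; rewrite cjM cjK mulrC.
Qed.

Let form0 s q : form s 0 q = 0.
Proof. by rewrite /form /dot big1 // => c _; rewrite /lift size_poly0 big_ord0 l20 mul0r. Qed.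

Let form_suml s I (r : seq I) (c : I -> S) (p : I -> {poly S}) q :
  form s (\sum_(i <- r) c i *: p i) q = \sum_(i <- r) c i * form s (p i) q.
Proof.
by elim: r => [|i r IHr]; rewrite ?big_nil ?form0 // !big_cons form_linear IHr.
Qed.

Let nm_sqr_cvg m : sqn (rat_vector (@qs _ S) (v s) m) @[s --> \oo] --> nm m ^+ 2.
Proof.
have -> : (fun s => sqn (rat_vector (@qs _ S) (v s) m)) =
  (fun s => rnorm (rat_vector (@qs _ S) (v s) m) * rnorm (rat_vector (@qs _ S) (v s) m)).
  by apply/funext => s; rewrite -expr2 rnorm_sqr.
by rewrite expr2; apply: cvgM.
Qed.

(* Polarization: the scalar products of the model vectors are combinations of
   squared norms of rational vectors, which converge by assumption. *)
Let form_XX_cvg i j : cvgn (fun s => form s 'X^i 'X^j).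
Proof.
have [k1 k1E] := qs_one S; have [k2 k2E] := qs_imag S.
have cross_cvg k : exists l,
    cross (d s) (v s i) (qs S k *: v s j) @[s --> \oo] --> (l : R).
  pose ei := pickle [:: (k1, i)]; pose ej := pickle [:: (k, j)].
  pose eij := pickle [:: (k1, i); (k, j)].
  exists ((nm eij ^+ 2 - nm ei ^+ 2 - nm ej ^+ 2) / 2).
  have -> : (fun s => cross (d s) (v s i) (qs S k *: v s j)) = (fun s =>
      (sqn (rat_vector (@qs _ S) (v s) eij) - sqn (rat_vector (@qs _ S) (v s) ei)
       - sqn (rat_vector (@qs _ S) (v s) ej)) / 2).
    apply/funext => s; rewrite cross_sqn.
    - by rewrite !rat_vector_pickle !big_cons !big_nil /= k1E !addr0 scale1r.
    - by move=> c; exact: v_out.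
    - by move=> c le_c; rewrite l2Z v_out ?mulr0.
  by apply: cvgM; [apply: cvgB; [apply: cvgB|] | exact: cvg_cst]; exact: nm_sqr_cvg.
have [a ca] := cross_cvg k1; have [b cb] := cross_cvg k2.
apply/cvg_ex; exists (rl S a + rl S b * mk S 0 1); apply: cvg_scal.
  under eq_fun do rewrite /form re_dot !lift_X -[v _ j]scale1r -k1E.
  exact: ca.
under eq_fun do rewrite /form im_dot !lift_X -k2E.
exact: cb.
Qed.

Let form_cvg p q : cvgn (fun s => form s p q).
Proof.
have pE r : r = \sum_(i < size r) r`_i *: 'X^i :> {poly S} by rewrite -poly_def coefK.
have -> : (fun s => form s p q) =
    (fun s => \sum_(i < size p) p`_i * \sum_(j < size q) cj q`_j * form s 'X^i 'X^j).
  apply/funext => s; rewrite {1}(pE p) form_suml; apply: eq_bigr => i _; congr (_ * _).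
  rewrite {1}(pE q) form_conj form_suml cj_sum.
  by apply: eq_bigr => j _; rewrite cjM -form_conj.
apply/cvg_ex; eexists; apply: cvgr_sum => i _.
apply: cvgM; first exact: cvg_cst.
apply: cvgr_sum => j _; apply: cvgM; [exact: cvg_cst | exact: form_XX_cvg].
Qed.

Let h p q : S := limn (fun s => form s p q).

Let h_cvg p q : form s p q @[s --> \oo] --> h p q.
Proof. exact: form_cvg. Qed.

Let h_linear (a : S) (p q w : {poly S}) : h (a *: p + q) w = a * h p w + h q w.
Proof.
apply: cvg_lim => //; under eq_fun do rewrite form_linear.
by apply: cvgD; [apply: cvgM; [exact: cvg_cst|]|]; exact: h_cvg.
Qed.

Let h_conj p q : h q p = cj (h p q).
Proof.
apply: cvg_lim => //; under eq_fun do rewrite form_conj.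
exact/cvg_cj/h_cvg.
Qed.

Let h_ge0 p : 0 <= re (h p p).
Proof.
have := cvg_re (@h_cvg p p) => cr; rewrite -(cvg_lim _ cr) //.
apply: limr_ge; first by apply/cvg_ex; exists (re (h p p)).
apply: nearW => s; rewrite /form re_dot; apply: sumr_ge0 => c _.
by rewrite addr_ge0 // -expr2 sqr_ge0.
Qed.

Let expr_poly m : {poly S} := rat_vector (@qs _ S) (fun j => 'X^j) m.

Let h_expr m : re (h (expr_poly m) (expr_poly m)) = nm m ^+ 2.
Proof.
apply: (cvg_unique _ (cvg_re (@h_cvg _ _))) => //.
rewrite (_ : (fun s => re _) = (fun s => sqn (rat_vector (@qs _ S) (v s) m))); first exact: nm_sqr_cvg.
apply/funext => s; have -> : rat_vector (@qs _ S) (v s) m = lift s (expr_poly m).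
  rewrite /expr_poly {2}/rat_vector (lift_sum s _ (fun p : nat * nat => qs S p.1) (fun p => 'X^(p.2))).
  by apply: eq_bigr => p _; rewrite lift_X.
rewrite /form re_dot (@sqn_trunc _ _ _ _ (d s)) /cross; last by move=> c; exact: lift_out.
by apply: eq_bigr => c _; rewrite /nsq !expr2.
Qed.

Let kappa := (if is_cplx S then 2 else 1)%N.
(** By polarization, and since [catc] adds vectors, the fraction is the real scalar product of the
    vectors coded by [u i] and [u l]. A total error below 1 is the hypothesis of
    [approx_identity]. *)
Hypothesis nm_indep : forall k, (if D is Some n then (k <= kappa * n)%N else true) ->
  exists u : 'I_k -> nat,
  \sum_i \sum_l `|(nm (catc (u i) (u l)) ^+ 2 - nm (u i) ^+ 2 - nm (u l) ^+ 2) / 2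
                  - (i == l)%:R| < 1.

(** A formal vector p is sent to the sequence of its coefficients h(p, eps_l). This map preserves
    the limit form by the Gram-Schmidt expansion. It remains to see that exactly the indices allowed
    by [D] carry a vector eps_l. *)
Lemma limit_of_models : exists Rp : nat -> l2_space S D,
  presentation Rp /\ forall m, rnorm (rat_vector (@qs _ S) Rp m) = nm m.
Proof.
have nm_ge0 m : 0 <= nm m.
  have := @nm_cvg m => /cvgP/limr_ge; rewrite (cvg_lim _ (@nm_cvg m)) //; apply.
  by apply: nearW => s; exact: rnorm_ge0.
have [r [eps [r_mono on eps0 repr]]] := gram_schmidt h_linear h_conj h_ge0 (fun j => 'X^j).
have h0r := h0r h_linear h_conj.
have hsum := h_suml h_linear.
have hZl := hZl h_linear.
(* More than n orthonormal vectors for the limit form would be almost orthonormal in a late model.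
   Their Gram matrix there factors through n coordinates, against [approx_identity]. *)
have r_dim n j : D = Some n -> (r j <= n)%N.
  move=> Dn; rewrite leqNgt; apply/negP => lt_n.
  pose E s : S := \sum_(i < n.+1) \sum_(l < n.+1) `|form s (eps i) (eps l) - (i == l)%:R|.
  have E0 : E @ \oo --> (0 : S).
    have -> : 0 = \sum_(i < n.+1) \sum_(l < n.+1) `|(i == l)%:R - (i == l)%:R| :> S.
      by rewrite big1 // => i _; rewrite big1 // => l _; rewrite subrr normr0.
    apply: cvgr_sum => i _; apply: cvgr_sum => l _; apply: cvg_norm; apply: cvgB; last exact: cvg_cst.
    by rewrite -(@on j) ?(leq_trans (ltn_ord _)) //; exact: h_cvg.
  have /cvgrPdist_lt/(_ 1 ltr01)[s _ /(_ s (leqnn s))] := E0.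
  rewrite /= sub0r normrN ger0_norm; last by do 2![apply: sumr_ge0 => ? _].
  pose A : 'M[S]_(n.+1, n) := \matrix_(i, c) lift s (eps i) c.
  pose B : 'M[S]_(n, n.+1) := \matrix_(c, l) cj (lift s (eps l) c).
  have ABE i l : (A *m B) i l = form s (eps i) (eps l).
    rewrite mxE /form (@dot_widen _ _ (d s) n); last 2 first.
    - by move=> c; exact: lift_out.
    - by move=> c le_c; apply: l2_dim; rewrite Dn /= -leqNgt.
    by apply: eq_bigr => c _; rewrite !mxE.
  have -> : E s = \sum_i \sum_l `|(A *m B) i l - (i == l)%:R|.
    by apply: eq_bigr => i _; apply: eq_bigr => l _; rewrite ABE.
  by move/approx_identity; rewrite ltnn.
have live_dim j l : (l < r j)%N -> in_dim D l.
  rewrite /in_dim; case E : D => [n|//] lt_l; exact: leq_trans lt_l (r_dim _ _ E).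
have poly_sum (p : {poly S}) : p = \sum_(i < size p) p`_i *: 'X^i by rewrite -poly_def coefK.
have h_poly p u : h p u = \sum_(i < size p) p`_i * h 'X^i u.
  by rewrite {1}(poly_sum p) hsum; apply: eq_bigr => i _; rewrite hZl.
have repr_poly p u : h p u = \sum_(l < r (size p)) h p (eps l) * h (eps l) u.
  rewrite h_poly.
  transitivity (\sum_(i < size p) \sum_(l < r (size p)) p`_i * h 'X^i (eps l) * h (eps l) u).
    apply: eq_bigr => i _; rewrite (@repr i (size p)) // mulr_sumr.
    by apply: eq_bigr => l _; rewrite mulrA.
  rewrite exchange_big; apply: eq_bigr => l _.
  by rewrite [X in _ = X * _]h_poly mulr_suml.
have h_out (p : {poly S}) l : (r (size p) <= l)%N -> h p (eps l) = 0.
  move=> le_l; rewrite repr_poly big1 // => l' _.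
  have [[j lt_l]|dead] := pselect (exists j, (l < r j)%N); last first.
    rewrite (@eps0 l) ?h0r ?mulr0 // => j; rewrite leqNgt; apply/negP => lt_l.
    by apply: dead; exists j.
  have lt_l'l := leq_trans (ltn_ord l') le_l.
  by rewrite (@on j) ?(ltn_trans lt_l'l) // ltn_eqF // mulr0.
(* A polynomial of size k involves only the first k generators, so by [h_out] its coefficients
   vanish from index r k on and cutting there loses nothing. *)
pose T (p : {poly S}) : l2 S D := l2cut D (fun l => h p (eps l)) (r (size p)).
have TE p l : T p l = h p (eps l).
  rewrite cutE; case: (ltnP l (r (size p))) => [lt_l|/h_out-> //].
  by rewrite (live_dim _ _ lt_l).
pose Rp j : l2_space S D := T 'X^j.
have TRp m : rat_vector (@qs _ S) Rp m = T (expr_poly m).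
  apply: l2_eq => l; rewrite rat_vector_coord TE /expr_poly /rat_vector hsum.
  by apply: eq_bigr => p _; rewrite TE hZl.
have sqnT p : sqn (T p) = re (h p p).
  rewrite (@sqn_trunc _ _ _ _ (r (size p))); last by move=> l; rewrite TE; exact: h_out.
  rewrite repr_poly re_sum; apply: eq_bigr => l _.
  by rewrite TE (h_conj p (eps l)) mulr_cj re_rl.
have sqnRp m : sqn (rat_vector (@qs _ S) Rp m) = nm m ^+ 2 by rewrite TRp sqnT h_expr.
have nmE m : rnorm (rat_vector (@qs _ S) Rp m) = nm m.
  by rewrite /rnorm sqnRp sqrtr_sqr ger0_norm.
(* If index l were never reached, every vector in the image of [T] would have at most l nonzero
   coordinates, hence live in real dimension kappa l. The hypothesis supplies kappa l + 1 almost
   orthonormal vectors. *)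
have live l : in_dim D l -> exists j, (l < r j)%N.
  move=> lD; apply: contrapT => dead.
  have r_le j : (r j <= l)%N by rewrite leqNgt; apply/negP => lt_l; apply: dead; exists j.
  have [|u] := nm_indep (k := (kappa * l).+1).
    move: lD; rewrite /in_dim; case: (D) => // n lt_ln.
    by rewrite (@leq_trans (kappa * l.+1)) ?leq_mul // mulnS -addn1 addnC leq_add2r /kappa; case: ifP.
  set k := (kappa * l).+1 in u *.
  pose y i : l2 S D := rat_vector (@qs _ S) Rp (u i).
  have y_out i c : (l <= c)%N -> y i c = 0.
    by move=> le_lc; rewrite /y TRp TE h_out // (leq_trans (r_le _)).
  (* Only real scalar products are controlled, so real and imaginary parts are placed side by side
     as real columns: 2l of them over the complex numbers, l over the reals. *)
  pose A : 'M[R]_(k, l + (if is_cplx S then l else 0)) :=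
    row_mx (\matrix_(i, c) re (y i c)) (\matrix_(i, c) im (y i c)).
  have AE i j : (A *m A^T) i j = cross l (y i) (y j).
    rewrite tr_row_mx mul_row_col mxE /cross big_split /= !mxE; congr (_ + _).
      by apply: eq_bigr => c _; rewrite !mxE.
    case: (boolP (is_cplx S)) => cS; first by apply: eq_bigr => c _; rewrite !mxE.
    rewrite big_ord0 big1 // => c _; rewrite (im_real (y i c)) ?mul0r //.
    by apply/negbTE.
  have -> : \sum_i \sum_j `|(nm (catc (u i) (u j)) ^+ 2 - nm (u i) ^+ 2 - nm (u j) ^+ 2) / 2
     - (i == j)%:R| = \sum_i \sum_j `|(A *m A^T) i j - (i == j)%:R|.
    apply: eq_bigr => i _; apply: eq_bigr => j _; rewrite AE cross_sqn; last 2 first.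
    - exact: y_out.
    - exact: y_out.
    by rewrite -rat_vector_catc !sqnRp.
  move=> /approx_identity; rewrite /k /kappa; case: (is_cplx S); lia.
(* The unit vectors are thus images of formal vectors, which gives the density of the span. *)
have T_eps l : in_dim D l -> T (eps l) = l2delta S D l.
  move=> lD; apply: l2_eq => i; rewrite deltaE // TE eq_sym.
  have [j lt_l] := live _ lD.
  have [[j' lt_i]|dead] := pselect (exists j, (i < r j)%N).
    by rewrite (@on (maxn j j')) ?(leq_trans lt_l) ?(leq_trans lt_i) ?r_mono ?leq_maxl ?leq_maxr.
  have ei0 : eps i = 0.
    by apply: eps0 => j'; rewrite leqNgt; apply/negP => lt_i; apply: dead; exists j'.
  rewrite ei0 h0r; case: eqP => // li; case: dead; by exists j; rewrite -li.
have T_span p : lin_span Rp (T p).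
  have -> : T p = \sum_(i < size p) p`_i *: Rp i.
    apply: l2_eq => l; rewrite TE h_poly l2_sum; apply: eq_bigr => i _.
    by rewrite l2Z TE.
  by apply: lin_span_sum => i _; apply: lin_spanZ; exact: lin_span_gen.
exists Rp; split=> //; apply/presentationP => x e e0.
have [N xN] := cut_approx x (gt0_re e0); exists (l2cut D x N).
  rewrite cut_delta; apply: lin_span_sum => l lD; apply: lin_spanZ.
  by rewrite -T_eps.
by rewrite l2_normE (ge0_rl (ltW e0)) rl_lt.
Qed.

End LimitOfModels.

(** * Norms of rational vectors in rational models *)

Lemma computable_app1 (F : nat -> nat) f :
  computable F -> computable f -> computable (fun x => F (f x)).
Proof. exact: computable_comp. Qed.

Lemma is_paircE x : is_pairc x -> x = pickle (hdc x, sndc x).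
Proof.
rewrite -[x]decodeK is_pairc_code pickle_pairE /sndc tlc_code !hdc_code.
by case: (CodeSeq.decode x) => [|a [|b []]].
Qed.

Lemma pickle_is_pairc (m n : nat) :
  [/\ is_pairc (pickle (m, n)), hdc (pickle (m, n)) = m & sndc (pickle (m, n)) = n].
Proof. by rewrite pickle_pairE is_pairc_code /sndc tlc_code !hdc_code. Qed.

Definition pairc (a b : nat) := (npair a (npair b 0).+1).+1.

Lemma paircE a b : pairc a b = pickle (a, b).
Proof. by rewrite pickle_pairE. Qed.

Lemma computable_pairc f g :
  computable f -> computable g -> computable (fun x => pairc (f x) (g x)).
Proof. by move=> cf cg; rewrite /pairc; auto 20 with computable. Qed.
#[global] Hint Resolve computable_pairc : computable.

Lemma interval_code (a b : rat) : a < b ->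
  exists n, qval (lo_c n) = a /\ qval (hi_c n) = b.
Proof.
move=> ab; exists (pickle (a, b - a)).
have := rat_intervalE (pickle (a, b - a)); rewrite /rat_interval pickleK /= subr_gt0 ab.
by move=> -[<- <-]; rewrite addrC subrK.
Qed.

Lemma qltc_ratr (R : realType) x y : qltc x y = (ratr (qval x) < ratr (qval y) :> R).
Proof. by rewrite qval_lt ltr_rat. Qed.

(** Decides whether the square root of q lies in the n-th interval without taking roots. A negative
    lower end is always below it, and an upper end must be positive before squares are compared. *)
Definition in_sqrtc (q n : nat) : bool :=
  (qltc (lo_c n) 0 || qltc (qmulc (lo_c n) (lo_c n)) q) &&
  (qltc 0 (hi_c n) && qltc q (qmulc (hi_c n) (hi_c n))).

Lemma in_sqrtcE (R : realType) (y : R) q n : 0 <= y -> y ^+ 2 = ratr (qval q) ->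
  in_sqrtc q n = (ratr (qval (lo_c n)) < y < ratr (qval (hi_c n))).
Proof.
have sqrE c : ratr (qval (qmulc c c)) = (ratr (qval c)) ^+ 2 :> R by rewrite qvalM rmorphM expr2.
have ratr0 : ratr (qval 0) = 0 :> R by rewrite qval0 rmorph0.
move=> y0 yq; rewrite /in_sqrtc !(qltc_ratr R) (sqrE (lo_c n)) (sqrE (hi_c n)) ratr0 -yq.
move: (ratr (qval (lo_c n))) (ratr (qval (hi_c n))) => a b; congr andb.
  have [a0|a0] := ltP a 0; first by rewrite (lt_le_trans a0 y0).
  by rewrite /= ltr_pXn2r ?nnegrE.
have [b0|b0] := ltP 0 b; first by rewrite /= ltr_pXn2r ?nnegrE ?(ltW b0).
by rewrite /= ltNge (le_trans b0 y0).
Qed.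

Lemma decidable_in_sqrtc f g :
  computable f -> computable g -> decidable_pred (fun x => in_sqrtc (f x) (g x)).
Proof. by move=> cf cg; rewrite /in_sqrtc; auto 20 with computable. Qed.
#[global] Hint Resolve decidable_in_sqrtc : computable.

Section NormCode.
Variables (R : realType) (S : scalars R).

Lemma computable_qreE f : computable f -> computable (fun x => qre S (f x)).
Proof. exact: computable_app1 (computable_qre S). Qed.
Lemma computable_qimE f : computable f -> computable (fun x => qim S (f x)).
Proof. exact: computable_app1 (computable_qim S). Qed.
#[local] Hint Resolve computable_qreE computable_qimE : computable.

(* [cre j c] and [cim j c] code the real and imaginary part of the c-th
   coordinate of the j-th vector. *)
Definition term_rec (cre cim : nat -> nat -> nat) (e c : nat) : nat :=
  if is_pairc e then
    qaddc (qmulc (qre S (hdc e)) (cre (sndc e) c))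
          (qoppc (qmulc (qim S (hdc e)) (cim (sndc e) c)))
  else 0%N.

Definition term_imc (cre cim : nat -> nat -> nat) (e c : nat) : nat :=
  if is_pairc e then
    qaddc (qmulc (qre S (hdc e)) (cim (sndc e) c))
          (qmulc (qim S (hdc e)) (cre (sndc e) c))
  else 0%N.

Definition coord_rec cre cim (m c : nat) := qsumc m (fun i => term_rec cre cim (nthc m i) c).
Definition coord_imc cre cim (m c : nat) := qsumc m (fun i => term_imc cre cim (nthc m i) c).

Definition normsqc cre cim (m N : nat) : nat :=
  qsumc N (fun c => qaddc (qmulc (coord_rec cre cim m c) (coord_rec cre cim m c))
                          (qmulc (coord_imc cre cim m c) (coord_imc cre cim m c))).

(** The range [m] is long enough because a code bounds the length of its list. Positions past the
    end read 0, which does not code a pair and contributes nothing. *)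
Lemma rat_vector_nthc (V : lmodType S) (Rp : nat -> V) m :
  rat_vector (@qs _ S) Rp m =
  \sum_(i < m) if is_pairc (nthc m i) then qs S (hdc (nthc m i)) *: Rp (sndc (nthc m i)) else 0.
Proof.
pose F e : V := if is_pairc e then qs S (hdc e) *: Rp (sndc e) else 0.
have F0 : F 0%N = 0 by [].
rewrite {1}/rat_vector; transitivity (\sum_(e <- CodeSeq.decode m) F e).
  have -> : odflt [::] (unpickle m : option (seq (nat * nat))) =
      pmap (fun e => if is_pairc e then Some (hdc e, sndc e) else None) (CodeSeq.decode m).
    by apply: eq_pmap => e; exact: unpickle_natpair.
  elim: (CodeSeq.decode m) => [|e s IHs]; first by rewrite !big_nil.
  rewrite big_cons -IHs /= /F.
  by case: is_pairc => /=; rewrite ?big_cons ?add0r.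
rewrite (big_nth 0%N) big_mkord.
have le_sm : (size (CodeSeq.decode m) <= m)%N by rewrite -[X in (_ <= X)%N]decodeK size_seqcode.
rewrite (big_ord_widen m (fun i => F (nth 0%N (CodeSeq.decode m) i))) // big_mkcond.
apply: eq_bigr => i _; rewrite -/(F (nthc m i)) -{5}[m]decodeK nthc_code.
by case: ltnP => // le_i; rewrite nth_default.
Qed.

Variables (D : option nat) (cre cim : nat -> nat -> nat) (v : nat -> l2 S D) (N : nat).
Hypothesis re_v : forall j c, (c < N)%N -> re (v j c) = ratr (qval (cre j c)).
Hypothesis im_v : forall j c, (c < N)%N -> im (v j c) = ratr (qval (cim j c)).
Hypothesis v_out : forall j c, (N <= c)%N -> v j c = 0.

Lemma normsqcE m :
  ratr (qval (normsqc cre cim m N)) = sqn (rat_vector (@qs _ S) v m).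
Proof.
rewrite (@sqn_trunc _ _ _ _ N); last first.
  by move=> c le_c; rewrite rat_vector_coord big1 // => p _; rewrite v_out ?mulr0.
have coordE c : rat_vector (@qs _ S) v m c = \sum_(i < m)
    if is_pairc (nthc m i) then qs S (hdc (nthc m i)) * v (sndc (nthc m i)) c else 0.
  by rewrite rat_vector_nthc l2_sum; apply: eq_bigr => i _; case: ifP.
have reE c : (c < N)%N -> re (rat_vector (@qs _ S) v m c) = ratr (qval (coord_rec cre cim m c)).
  move=> lt_c; rewrite coordE re_sum /coord_rec qval_sum rmorph_sum.
  apply: eq_bigr => i _; rewrite /term_rec; case: ifP => _; last by rewrite qval0 rmorph0 re0.
  by rewrite qvalD qvalN !qvalM rmorphB !rmorphM reM re_qs im_qs re_v // im_v.
have imE c : (c < N)%N -> im (rat_vector (@qs _ S) v m c) = ratr (qval (coord_imc cre cim m c)).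
  move=> lt_c; rewrite coordE im_sum /coord_imc qval_sum rmorph_sum.
  apply: eq_bigr => i _; rewrite /term_imc; case: ifP => _; last by rewrite qval0 rmorph0 im0.
  by rewrite qvalD !qvalM rmorphD !rmorphM imM re_qs im_qs re_v // im_v.
rewrite /normsqc qval_sum rmorph_sum; apply: eq_bigr => c _.
by rewrite /nsq reE // imE // qvalD !qvalM rmorphD !rmorphM !expr2.
Qed.

End NormCode.

Section ComputableNorm.
Variables (R : realType) (S : scalars R).
Variables (cre cim : nat -> nat -> nat -> nat).
Hypothesis c_cre : forall f g k, computable f -> computable g -> computable k ->
  computable (fun x => cre (f x) (g x) (k x)).
Hypothesis c_cim : forall f g k, computable f -> computable g -> computable k ->
  computable (fun x => cim (f x) (g x) (k x)).

Lemma computable_normsqc p f g : computable p -> computable f -> computable g ->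
  computable (fun x => normsqc S (cre (p x)) (cim (p x)) (f x) (g x)).
Proof.
move=> cp cf cg.
have H := @computable_app2 (fun a b => normsqc S (cre a) (cim a) (nfst b) (nsnd b)) p
   (fun x => npair (f x) (g x)).
apply: computable_ext (H _ cp (computable_pair cf cg)) => [x|]; first by rewrite nfst_pair nsnd_pair.
have := computable_qreE S; have := computable_qimE S => cq1 cq2.
rewrite /normsqc /coord_rec /coord_imc /term_rec /term_imc.
by auto 40 with computable.
Qed.
End ComputableNorm.

Section Models.
Variables (R : realType) (S : scalars R) (D : option nat).

(** A model is coded by a dimension and a matrix whose entries pair the codes of a real and an
    imaginary part. For [Some n] the coded dimension is overridden by n, which is how the upper
    bound on the dimension enters. *)
Definition model_dim (M : nat) : nat := if D is Some n then n else nfst M.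
Definition model_rec (M j c : nat) : nat := nfst (nthc (nthc (nsnd M) j) c).
Definition model_imc (M j c : nat) : nat :=
  if is_cplx S then nsnd (nthc (nthc (nsnd M) j) c) else 0%N.

Definition model_vec (M j : nat) : l2_space S D :=
  l2cut D (fun c => mk S (ratr (qval (model_rec M j c))) (ratr (qval (model_imc M j c))))
    (model_dim M).

Definition satisfiesc (M x : nat) : bool :=
  is_pairc x &&
  in_sqrtc (normsqc S (model_rec M) (model_imc M) (hdc x) (model_dim M)) (sndc x).

Lemma model_dimP M c : (c < model_dim M)%N -> in_dim D c.
Proof. by rewrite /model_dim /in_dim; case: D. Qed.

Lemma satisfiescP M x : satisfiesc M x <->
  is_pairc x /\ ratr (qval (lo_c (sndc x))) < rnorm (rat_vector (@qs _ S) (model_vec M) (hdc x))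
     < ratr (qval (hi_c (sndc x))).
Proof.
rewrite /satisfiesc (@in_sqrtcE _ (rnorm (rat_vector (@qs _ S) (model_vec M) (hdc x)))).
- by split=> [/andP[]|[-> ->]].
- exact: rnorm_ge0.
rewrite rnorm_sqr; apply/esym/normsqcE => j c lt_c.
- by rewrite cutE lt_c (model_dimP lt_c) re_mk.
- rewrite cutE lt_c (model_dimP lt_c) im_mk /model_imc.
  by case: (is_cplx S); rewrite ?qval0 ?rmorph0.
- exact: cut_out.
Qed.

Lemma decidable_satisfiesc f g :
  computable f -> computable g -> decidable_pred (fun x => satisfiesc (f x) (g x)).
Proof.
move=> cf cg; rewrite /satisfiesc; apply: decidable_and; first by auto with computable.
apply: decidable_in_sqrtc; last by auto with computable.
apply: computable_normsqc => //; rewrite /model_rec /model_imc /model_dim.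
- by move=> a b c ca cb cc; auto 20 with computable.
- by move=> a b c ca cb cc; case: is_cplx; auto 20 with computable.
- by auto with computable.
- by case: D => [n|]; auto with computable.
Qed.

End Models.
#[global] Hint Resolve decidable_satisfiesc : computable.

(** * A [Pi02] description of the names *)

Lemma nthc_prefix f m i : (i < m)%N -> nthc (prefix_code f m) i = f i.
Proof. by move=> lt_i; rewrite nthc_code nth_mkseq. Qed.

Lemma sizec_prefix f m : sizec (prefix_code f m) = m.
Proof. by rewrite sizec_code size_mkseq. Qed.

(** The normal form quantifies over prefixes only, so the witness w is hidden in the length of the
    prefix, as its first component. The second component can be chosen large enough for the prefix
    to contain every position that [C] consults. *)
Lemma Pi02_local (C : nat -> nat -> (nat -> nat) -> bool) :
    decidable_pred (fun z => C (nfst z) (nfst (nsnd z)) (nthc (nsnd (nsnd z)))) ->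
    (forall t w g g', (forall i, (i <= t + w)%N -> g i = g' i) -> C t w g = C t w g') ->
  Pi02 (fun f => forall t, exists w, C t w f).
Proof.
move=> cC locC.
pose ok t s := (t + nfst (sizec s) < sizec s)%N && C t (nfst (sizec s)) (nthc s).
exists (fun z => nat_of_bool (~~ ok (nfst z) (nsnd z))); split.
  apply: decidable_neg; apply: decidable_and; first by auto 20 with computable.
  have := computable_comp cC (computable_pair (computable_fst computable_id) (computable_pair
    (computable_fst (computable_sizec (computable_snd computable_id))) (computable_snd computable_id))).
  by apply: computable_ext => z; rewrite !(nfst_pair, nsnd_pair).
have okE f t m : ok t (prefix_code f m) = (t + nfst m < m)%N && C t (nfst m) f.
  rewrite /ok sizec_prefix; case: ltnP => //= lt_m; apply: locC => i le_i.
  by rewrite nthc_prefix // (leq_ltn_trans le_i).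
move=> f; split=> H t; have [w Cw] := H t.
  exists (npair w (t + w).+1); rewrite nfst_pair nsnd_pair okE nfst_pair Cw andbT.
  by rewrite (leq_trans _ (npair_le2 _ _)).
exists (nfst w); move: Cw; rewrite nfst_pair nsnd_pair okE.
by case: (_ && _) / andP => // -[].
Qed.

Definition inv_c (k : nat) := npair (npair 1 0) k.

Lemma ratr_inv_c (R : realType) k : ratr (qval (inv_c k)) = k.+1%:R^-1 :> R.
Proof. by rewrite unlock !(nfst_pair, nsnd_pair) subr0 div1r fmorphV rmorph_nat. Qed.

Definition nat_c (a : nat) := npair (npair a 0) 0.

Lemma ratr_nat_c (R : realType) a : ratr (qval (nat_c a)) = a%:R :> R.
Proof. by rewrite unlock !(nfst_pair, nsnd_pair) subr0 divr1 rmorph_nat. Qed.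

(* The interval [n] lies in [0, +oo[ and its square in ]a - 1/(k+1), a + 1/(k+1)[. *)
Definition sq_windowc (n a k : nat) : bool :=
  [&& ~~ qltc (lo_c n) 0,
      qltc (qaddc (nat_c a) (qoppc (inv_c k))) (qmulc (lo_c n) (lo_c n)) &
      qltc (qmulc (hi_c n) (hi_c n)) (qaddc (nat_c a) (inv_c k))].

Lemma sq_windowcE (R : realType) n a k : sq_windowc n a k =
  [&& 0 <= ratr (qval (lo_c n)) :> R,
      a%:R - k.+1%:R^-1 < ratr (qval (lo_c n)) ^+ 2 :> R &
      ratr (qval (hi_c n)) ^+ 2 < a%:R + k.+1%:R^-1 :> R].
Proof.
rewrite /sq_windowc !(qltc_ratr R) (qvalD (nat_c a) (qoppc (inv_c k))).
rewrite (qvalD (nat_c a) (inv_c k)) (qvalN (inv_c k)) (qvalM (lo_c n) (lo_c n)).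
rewrite (qvalM (hi_c n) (hi_c n)) qval0 rmorph0 -leNgt.
by rewrite !rmorphM rmorphB rmorphD /= ratr_inv_c ratr_nat_c !expr2.
Qed.

Section Conditions.
Variables (R : realType) (S : scalars R) (D : option nat).
Implicit Type g : nat -> nat.

Definition cond_model (s M : nat) g := all_below s (fun i => satisfiesc S D M (g i)).

Definition cond_upward (t w : nat) g :=
  let x := g (nfst t) in let n := nsnd t in
  (~~ qltc (lo_c (sndc x)) (lo_c n) && ~~ qltc (hi_c n) (hi_c (sndc x)))
  ==> (g w == pairc (hdc x) n)%N.

(** Limits of models satisfy the listed bounds only weakly. A listed interval strictly inside the
    given one restores strict inequalities. *)
Definition cond_round (t w : nat) g :=
  [&& (hdc (g w) == hdc (g t))%N, qltc (lo_c (sndc (g t))) (lo_c (sndc (g w))) &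
      qltc (hi_c (sndc (g w))) (hi_c (sndc (g t)))].

(** Short intervals make the norms in the models a Cauchy sequence, and one of them fits inside any
    given open interval around the limit norm. *)
Definition cond_small (t w : nat) g :=
  (hdc (g w) == nfst t)%N &&
  qltc (hi_c (sndc (g w))) (qaddc (lo_c (sndc (g w))) (inv_c (nsnd t))).

(* The norms of u_i and of u_i + u_l only control the real parts of scalar
   products, so over the complex numbers dimension n shows up as 2n vectors that
   are almost orthonormal for the real scalar product. *)
Definition kappa := (if is_cplx S then 2 else 1)%N.
Definition rank_ok (k : nat) := if D is Some n then (k <= kappa * n)%N else true.
(** Each of the k^2 scalar products is known up to (3/2) / (tol k + 1), and the total must stay
    below 1. *)
Definition tol (k : nat) := (2 * k.+1 * k.+1)%N.

(* The i-th entry of the list [nfst w] is an index at which [g] lists a rational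
   vector u_i with an interval for its norm; the (i, l) entry of the matrix
   [nsnd w] does the same for u_i + u_l. *)
Definition cond_indep (k w : nat) g :=
  rank_ok k ==> all_below k (fun i => let xi := g (nthc (nfst w) i) in
    sq_windowc (sndc xi) 1 (tol k) && all_below k (fun l =>
      let xl := g (nthc (nfst w) l) in let xil := g (nthc (nthc (nsnd w) i) l) in
      (hdc xil == catc (hdc xi) (hdc xl))%N &&
      sq_windowc (sndc xil) (if (i == l)%N then 4 else 2) (tol k))).

Definition cond (t w : nat) g : bool :=
  if nfst t == 0%N then cond_model (nsnd t) w g else
  if nfst t == 1%N then cond_upward (nsnd t) w g else
  if nfst t == 2%N then cond_round (nsnd t) w g else
  if nfst t == 3%N then cond_small (nsnd t) w g else cond_indep (nsnd t) w g.

(** Every position consulted is bounded by a component of [t] or of [w]; entries of a coded list are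
    covered because they do not exceed its code. *)
Lemma cond_local t w g g' :
  (forall i, (i <= t + w)%N -> g i = g' i) -> cond t w g = cond t w g'.
Proof.
move=> gg'; have gw i : (i <= w)%N -> g i = g' i.
  by move=> le_i; apply: gg'; rewrite (leq_trans le_i) ?leq_addl.
have gt i : (i <= nsnd t)%N -> g i = g' i.
  by move=> le_i; apply: gg'; rewrite (leq_trans le_i) // (leq_trans (nsnd_le t)) ?leq_addr.
have gn c i : (c <= w)%N -> g (nthc c i) = g' (nthc c i).
  by move=> le_c; apply: gw; rewrite (leq_trans (nthc_le _ _)).
rewrite /cond; case: (nfst t == 0%N).
  by apply: eq_in_all => i; rewrite mem_iota add0n => lt_i; rewrite gt // ltnW.
case: (nfst t == 1%N).
  by rewrite /cond_upward (gw w) // (gt (nfst (nsnd t))) // nfst_le.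
case: (nfst t == 2%N); first by rewrite /cond_round (gw w) // (gt (nsnd t)).
case: (nfst t == 3%N); first by rewrite /cond_small (gw w).
rewrite /cond_indep; congr (_ ==> _); apply: eq_in_all => i _; cbv beta zeta.
rewrite (gn (nfst w) i) ?nfst_le //; congr andb; apply: eq_in_all => l _ /=.
by rewrite (gn (nfst w) l) ?nfst_le // (gn (nthc (nsnd w) i)) // (leq_trans (nthc_le _ _)) ?nsnd_le.
Qed.

Lemma decidable_sq_windowc f a k : computable f -> computable a -> computable k ->
  decidable_pred (fun x => sq_windowc (f x) (a x) (k x)).
Proof.
by move=> cf ca ck; rewrite /sq_windowc /inv_c /nat_c; auto 30 with computable.
Qed.
#[local] Hint Resolve decidable_sq_windowc : computable.

Lemma decidable_cond :
  decidable_pred (fun z => cond (nfst z) (nfst (nsnd z)) (nthc (nsnd (nsnd z)))).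
Proof.
rewrite /cond; apply: decidable_if; first by auto with computable.
  by rewrite /cond_model; auto 30 with computable.
apply: decidable_if; first by auto with computable.
  by rewrite /cond_upward; auto 30 with computable.
apply: decidable_if; first by auto with computable.
  by rewrite /cond_round; auto 30 with computable.
apply: decidable_if; first by auto with computable.
  by rewrite /cond_small /inv_c; auto 30 with computable.
rewrite /cond_indep /tol; apply: decidable_imply.
  by rewrite /rank_ok; case: D => [n|]; auto 20 with computable.
by auto 50 with computable.
Qed.

End Conditions.

(** * From the conditions to a Hilbert space *)

Section Sufficiency.
Variables (R : realType) (S : scalars R) (D : option nat).

Lemma sq_windowP n a k (y : R) : sq_windowc n a k ->
  ratr (qval (lo_c n)) <= y <= ratr (qval (hi_c n)) -> `|y ^+ 2 - a%:R| <= k.+1%:R^-1.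
Proof.
rewrite (sq_windowcE R); move: (ratr (qval (lo_c n))) (ratr (qval (hi_c n))) => lo hi.
move: (k.+1%:R^-1) => e /and3P[lo0 He1 He2] /andP[lo_y y_hi].
have y0 : 0 <= y := le_trans lo0 lo_y.
have h1 : lo ^+ 2 <= y ^+ 2 by rewrite !expr2 ler_pM.
have h2 : y ^+ 2 <= hi ^+ 2 by rewrite !expr2 ler_pM.
by rewrite ler_norml; apply/andP; split; lra.
Qed.

Lemma cond_hilbert_name (f : nat -> nat) :
  (forall t, exists w, cond S D t w f) -> hilbert_name S D f.
Proof.
move=> condf.
have c0 s : exists M, cond_model S D s M f.
  by have [w] := condf (npair 0 s); rewrite /cond nfst_pair nsnd_pair; exists w.
have c1 t : exists w, cond_upward t w f.
  by have [w] := condf (npair 1 t); rewrite /cond nfst_pair nsnd_pair; exists w.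
have c2 t : exists w, cond_round t w f.
  by have [w] := condf (npair 2 t); rewrite /cond nfst_pair nsnd_pair; exists w.
have c3 t : exists w, cond_small t w f.
  by have [w] := condf (npair 3 t); rewrite /cond nfst_pair nsnd_pair; exists w.
have c4 k : exists w, cond_indep S D k w f.
  by have [w] := condf (npair 4 k); rewrite /cond nfst_pair nsnd_pair; exists w.
have [M MP] := choice c0.
pose lo n : R := ratr (qval (lo_c n)); pose hi n : R := ratr (qval (hi_c n)).
pose nms s m : R := rnorm (rat_vector (@qs _ S) (model_vec S D (M s)) m).
have fpair i : is_pairc (f i).
  by have /all_belowP/(_ i (ltnSn i))/satisfiescP[] := MP i.+1.
have sat i s : (i < s)%N -> lo (sndc (f i)) < nms s (hdc (f i)) < hi (sndc (f i)).
  by move=> lt_is; have /all_belowP/(_ i lt_is)/satisfiescP[] := MP s.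
have small m (e : R) : 0 < e -> exists2 i, hdc (f i) = m & hi (sndc (f i)) < lo (sndc (f i)) + e.
  move=> e0; have [k _ /(_ k (leqnn k)) ke] := near_infty_natSinv_lt (PosNum e0).
  have [ i ] := c3 (npair m k); rewrite /cond_small nfst_pair nsnd_pair => /andP[/eqP fi].
  rewrite (qltc_ratr R) qvalD rmorphD /= ratr_inv_c => lt_hi; exists i => //.
  by apply: lt_trans lt_hi _; rewrite ltrD2l.
(* An interval of length below e listed for m at position i contains the norm of m in every model s
   > i. *)
have nms_cvg m : cvgn (fun s => nms s m).
  apply: cauchy_cvg; apply/cauchyP => e e0; have [i fi lt_e] := small m e e0.
  exists (lo (sndc (f i))); suff H : \forall s \near \oo, ball (lo (sndc (f i))) e (nms s m) by exact: H.
  exists i.+1 => // s /= lt_is; have := sat i s lt_is; rewrite fi => /andP[h1 h2].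
  rewrite -ball_normE /ball_ /= ltr_distlC; apply/andP; split; lra.
pose nm m := limn (fun s => nms s m).
have nm_in i : lo (sndc (f i)) <= nm (hdc (f i)) <= hi (sndc (f i)).
  apply/andP; split; [apply: limr_ge | apply: limr_le]; try exact: nms_cvg;
    exists i.+1 => // s /= /(sat i s)/andP[]; by move=> /ltW ? /ltW ?.
have indep k : (if D is Some n then (k <= kappa S * n)%N else true) ->
  exists u : 'I_k -> nat,
  \sum_i \sum_l `|(nm (catc (u i) (u l)) ^+ 2 - nm (u i) ^+ 2 - nm (u l) ^+ 2) / 2
                  - (i == l)%:R| < 1.
  move=> rk; have [w] := c4 k; rewrite /cond_indep /rank_ok rk implyTb => /all_belowP H.
  exists (fun i : 'I_k => hdc (f (nthc (nfst w) i))).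
  set e : R := (tol k).+1%:R^-1.
  have u1 (i : 'I_k) : `|nm (hdc (f (nthc (nfst w) i))) ^+ 2 - 1%:R| <= e.
    have /andP[W _] := H i (ltn_ord i); exact: (sq_windowP W (nm_in _)).
  have u2 (i l : 'I_k) : `|nm (catc (hdc (f (nthc (nfst w) i))) (hdc (f (nthc (nfst w) l)))) ^+ 2
      - (if i == l then 4 else 2)%:R| <= e.
    have /andP[_ /all_belowP/(_ l (ltn_ord l))/andP[/eqP<- W]] := H i (ltn_ord i).
    exact: (sq_windowP W (nm_in _)).
  (* With target squares 1, 1 and 2 (or 4 on the diagonal), half of the difference is 0 (or 1).
     Three errors of at most e, halved, give 3/2 e. *)
  apply: (@le_lt_trans _ _ (\sum_(i < k) \sum_(l < k) (3 / 2 * e))).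
    apply: ler_sum => i _; apply: ler_sum => l _.
    have := u1 i; have := u1 l; have := u2 i l.
    set a := nm (catc _ _) ^+ 2; set b := nm (hdc (f (nthc _ i))) ^+ 2.
    set c := nm (hdc (f (nthc _ l))) ^+ 2; move: a b c => a b c; rewrite !ler_norml.
    by case: eqP => _; rewrite ?mulr1n ?mulr0n => /andP[? ?] /andP[? ?] /andP[? ?]; apply/andP; split; lra.
  have -> : \sum_(i < k) \sum_(l < k) (3 / 2 * e) = k%:R * (k%:R * (3 / 2)) * e.
    by rewrite !sumr_const !card_ord -!mulrA !mulr_natl.
  have eE : (tol k).+1%:R = 2 * (k%:R + 1) * (k%:R + 1) + 1 :> R.
    by rewrite /tol -natr1 !natrM -(natr1 k).
  have k0 : 0 <= (k%:R : R) by rewrite ler0n.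
  rewrite /e ltr_pdivrMr ?ltr0n // mul1r eE; move: (k%:R) k0 => q q0.
  nra.
have [|Rp [pR nmE]] := @limit_of_models R S D (fun s => model_vec S D (M s))
  (fun s => model_dim D (M s)) nm _ nms_cvg indep.
  by move=> s j c; exact: cut_out.
exists Rp; split=> //; rewrite /names; apply/seteqP; split=> x.
  move=> [i _ <-]; exists (hdc (f i)), (sndc (f i)); split; first exact: is_paircE.
  rewrite l2_normE in_rat_interval_rl nmE.
  (* Roundness turns the weak bounds of [nm_in] into the strict ones that the diagram demands. *)
  have [w /and3P[/eqP hd]] := c2 i; rewrite !(qltc_ratr R) => l1 h1.
  have := nm_in w; rewrite hd => /andP[l2 h2].
  by rewrite (lt_le_trans l1) //= (le_lt_trans h2).
move=> [m [n [-> ]]]; rewrite l2_normE in_rat_interval_rl nmE -/(lo n) -/(hi n) => /andP[lt_lo lt_hi].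
(* A listed interval of length below e whose closure contains [nm m] lies inside the interval n, and
   upward closure then lists n as well. *)
pose e := Num.min (nm m - lo n) (hi n - nm m).
have e0 : 0 < e by rewrite /e lt_min !subr_gt0 lt_lo.
have [i fi lt_e] := small m e e0; have := nm_in i; rewrite fi => /andP[l1 h1].
have e1 : e <= nm m - lo n by rewrite /e ge_min lexx.
have e2 : e <= hi n - nm m by rewrite /e ge_min lexx orbT.
have [w] := c1 (npair i n); rewrite /cond_upward nfst_pair nsnd_pair.
rewrite !(qltc_ratr R) -!leNgt -/(lo _) -/(lo _) -/(hi _) -/(hi _) => /implyP W.
exists w => //; rewrite (eqP (W _)) ?paircE ?fi //.
by apply/andP; split; lra.
Qed.

End Sufficiency.

(** * Approximation by rational vectors and rational models *)

Section RationalApproximation.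
Variables (R : realType) (S : scalars R).

Lemma ratr_dense (x e : R) : 0 < e -> exists q : rat, `|x - ratr q| < e.
Proof.
move=> e0; have [|q] := @rat_in_itvoo R (x - e) (x + e); first by lra.
by rewrite in_itv /= => /andP[h1 h2]; exists q; rewrite ltr_distlC; apply/andP; split; lra.
Qed.

Lemma nsq_lt (z : S) (e : R) : `|re z| < e -> `|im z| < e -> nsq z < 2 * e ^+ 2.
Proof.
move=> re_lt im_lt; rewrite /nsq mulr2n mulrDl !mul1r ltrD // -[X in X < _]real_normK ?num_real //;
  by rewrite ltr_pXn2r ?nnegrE // (le_trans _ (ltW re_lt)).
Qed.

Lemma qs_dense (z : S) (e : R) : 0 < e -> exists k, Num.sqrt (nsq (z - qs S k)) < e.
Proof.
move=> e0; have e20 : 0 < e / 2 by rewrite divr_gt0.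
have [a za] := ratr_dense (re z) e20; have [b zb] := ratr_dense (im z) e20.
have [k [ka kb]] := qs_surj S a b; exists k.
rewrite -(@ltr_pXn2r _ 2) ?nnegrE ?sqrtr_ge0 ?(ltW e0) // sqr_sqrtr ?nsq_ge0 //.
have := @nsq_lt (z - qs S k) (e / 2); rewrite !scalE re_qs im_qs ka kb => H.
apply: (@lt_le_trans _ _ (2 * (e / 2) ^+ 2)); last by rewrite exprMn; nra.
apply: H => //; case: (boolP (is_cplx S)) zb => // /negbTE cS _.
by rewrite im_real // rmorph0 subr0 normr0.
Qed.

Lemma rnorm_dist D (x y : l2 S D) : `|rnorm x - rnorm y| <= rnorm (x - y).
Proof.
have := rnormD (x - y) y; have := rnormD (y - x) x.
rewrite !subrK -[rnorm (y - x)]rnormN opprB ler_norml => ? ?.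
by apply/andP; split; lra.
Qed.

Lemma rat_vector_dense D (Rp : nat -> l2_space S D) (x : l2 S D) (e : R) :
  presentation Rp -> 0 < e -> exists m, rnorm (x - rat_vector (@qs _ S) Rp m) < e.
Proof.
move=> /presentationP pR e0; have e20 : 0 < e / 2 by rewrite divr_gt0.
have [|y [s ->]] := pR x (rl S (e / 2)); first by rewrite -(rmorph0 (rl S)) rl_lt.
rewrite l2_normE rl_lt => xs.
have [s' ss'] : exists s' : seq (nat * nat),
    rnorm (\sum_(p <- s) p.1 *: Rp p.2 - \sum_(p <- s') qs S p.1 *: Rp p.2) < e / 2.
  elim: s {xs} (e / 2) e20 => [|[c j] s IHs] d d0.
    by exists [::]; rewrite !big_nil subrr /rnorm (@sqn_trunc _ _ _ _ 0) // /trunc big_ord0 sqrtr0.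
  have [|s' hs'] := IHs (d / 2); first by rewrite divr_gt0.
  (* The added 1 keeps the divisor positive when [Rp j] is zero. *)
  have n1 : 0 < rnorm (Rp j) + 1 by rewrite ltr_wpDl ?rnorm_ge0.
  have [|k hk] := @qs_dense c (d / 2 / (rnorm (Rp j) + 1)); first by rewrite !divr_gt0.
  exists ((k, j) :: s'); rewrite !big_cons /= opprD addrACA -scalerBl.
  apply: (le_lt_trans (rnormD _ _)); rewrite [X in _ < X](splitr d) ltr_leD ?ltW //.
  rewrite rnormZ; apply: (@le_lt_trans _ _ (Num.sqrt (nsq (c - qs S k)) * (rnorm (Rp j) + 1))).
    by rewrite ler_wpM2l ?sqrtr_ge0 // lerDl.
  by rewrite -ltr_pdivlMr.
exists (pickle s'); rewrite rat_vector_pickle.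
rewrite -(subrK (\sum_(p <- s) p.1 *: Rp p.2) x) -addrA.
by apply: (le_lt_trans (rnormD _ _)); rewrite (splitr e) ltrD.
Qed.

(** The cut becomes the dimension of a model. For [Some n] that dimension is prescribed, and cutting
    at n changes nothing; otherwise the k tails are made small simultaneously. *)
Lemma l2cut_approx_all D (y : nat -> l2 S D) (k : nat) (e : R) : 0 < e ->
  exists N, (forall n, D = Some n -> N = n) /\
    forall j, (j < k)%N -> rnorm (y j - l2cut D (y j) N) < e.
Proof.
move=> e0; case ED : D y => [n|] y.
  exists n; split=> [m [->] //|j _].
  suff -> : y j = l2cut (Some n) (y j) n.
    rewrite (_ : _ - _ = 0); first by rewrite /rnorm (@sqn_trunc _ _ _ _ 0) // /trunc big_ord0 sqrtr0.
    by apply: l2_eq => i; rewrite l2D l2N !cutE; case: ifP => // H; rewrite ?H subrr.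
  apply: l2_eq => i; rewrite cutE /=; case: ltnP => // le_ni /=.
  by apply: l2_dim; rewrite /= -leqNgt.
have mono j A B : (A <= B)%N -> sqn (y j) - trunc B (y j) <= sqn (y j) - trunc A (y j).
  by move=> AB; rewrite lerD2l lerN2 trunc_mono.
have [L HL] : exists L, forall j, (j < k)%N -> sqn (y j) - trunc L (y j) < e ^+ 2.
  elim: k => [|m [L HL]]; first by exists 0%N.
  have /cvgrPdist_lt/(_ (e ^+ 2)) := @trunc_cvg _ _ _ (y m).
  rewrite exprn_gt0 // => /(_ isT)[P _ /(_ P (leqnn P)) HP].
  exists (maxn L P) => j; rewrite ltnS leq_eqVlt => /orP[/eqP->|lt_j].
    apply: (le_lt_trans (mono _ _ _ (leq_maxr L P))).
    by apply: le_lt_trans HP; exact: ler_norm.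
  by apply: (le_lt_trans (mono _ _ _ (leq_maxl L P))); exact: HL.
exists L; split=> // j lt_j.
rewrite -(@ltr_pXn2r _ 2) ?nnegrE ?rnorm_ge0 ?(ltW e0) // rnorm_sqr.
by apply: (le_lt_trans (sqn_cut (y j) L)); exact: HL.
Qed.

Lemma model_approx D (y : nat -> l2 S D) (k : nat) (e : R) : 0 < e ->
  exists M, forall j, (j < k)%N -> rnorm (y j - model_vec S D M j) < e.
Proof.
move=> e0; have e20 : 0 < e / 2 by rewrite divr_gt0.
have [N [ND HN]] := l2cut_approx_all y k e20.
have N1 : 0 < (N.+1%:R : R) by rewrite ltr0n.
(* N coordinates, each with squared error below 2d^2, contribute at most 2 (N + 1) d^2 = e^2 / (8 (N
   + 1)), which is below (e/2)^2. The remaining e/2 is spent on the cut. *)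
pose d := e / 4 / N.+1%:R; have d0 : 0 < d by rewrite !divr_gt0.
have Hre j c : exists a, `|re (y j c) - ratr (qval a)| < d.
  by have [q Hq] := ratr_dense (re (y j c)) d0; have [a Ha] := qval_surj q; exists a; rewrite Ha.
have Him j c : exists a, `|im (y j c) - ratr (qval a)| < d.
  by have [q Hq] := ratr_dense (im (y j c)) d0; have [a Ha] := qval_surj q; exists a; rewrite Ha.
have [a Ha] := choice (fun z : nat * nat => Hre z.1 z.2).
have [b Hb] := choice (fun z : nat * nat => Him z.1 z.2).
pose M := npair N (seqcode (mkseq (fun j => seqcode (mkseq (fun c => npair (a (j, c)) (b (j, c))) N)) k)).
have dimM : model_dim D M = N.
  rewrite /model_dim; case E: D => [n|]; [exact/esym/ND | exact: nfst_pair].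
have coordM j c : (j < k)%N -> (c < N)%N ->
    nthc (nthc (nsnd M) j) c = npair (a (j, c)) (b (j, c)).
  by move=> lt_j lt_c; rewrite nsnd_pair nthc_code nth_mkseq // nthc_code nth_mkseq.
exists M => j lt_j.
rewrite -(subrK (l2cut D (y j) N) (y j)) -addrA.
apply: (le_lt_trans (rnormD _ _)); rewrite (splitr e) ltr_leD ?HN //.
apply: rnorm_le; first exact: ltW.
have dE : N.+1%:R * (2 * d ^+ 2) <= (e / 2) ^+ 2.
  have -> : N.+1%:R * (2 * d ^+ 2) = (e / 2) ^+ 2 / 2 * N.+1%:R^-1.
    by rewrite /d; field; rewrite gt_eqF.
  rewrite ler_pdivrMr //; have : 1 <= (N.+1%:R : R) by rewrite ler1n.
  have := sqr_ge0 (e / 2); nra.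
move=> P; apply: le_trans dE.
have out c : (N <= c)%N -> (l2cut D (y j) N - model_vec S D M j) c = 0.
  by move=> le_c; rewrite l2D l2N !cut_out ?dimM // subrr.
apply: (le_trans (trunc_le_sqn P _)); rewrite (sqn_trunc out).
apply: (@le_trans _ _ (\sum_(c < N) 2 * d ^+ 2)); last first.
  have dd0 : 0 <= 2 * d ^+ 2 by rewrite mulr_ge0 ?sqr_ge0.
  by rewrite sumr_const card_ord -[X in X <= _]mulr_natl ler_wpM2r // ler_nat.
apply: ler_sum => c _; rewrite l2D l2N !cutE dimM ltn_ord /=.
case: ifP => _; last by rewrite subrr nsq0 mulr_ge0 ?sqr_ge0.
apply/ltW/nsq_lt; rewrite !scalE.
  by rewrite /model_rec coordM // nfst_pair; exact: (Ha (j, nat_of_ord c)).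
rewrite im_mk /model_imc; case: (boolP (is_cplx S)) => [_|/negbTE cS].
  by rewrite coordM // nsnd_pair; exact: (Hb (j, nat_of_ord c)).
by rewrite (im_real _ cS) subr0 normr0.
Qed.

End RationalApproximation.

Lemma interval_between (R : realType) (a y b : R) : a < y < b ->
  exists n, [/\ a < ratr (qval (lo_c n)), ratr (qval (lo_c n)) < y,
                y < ratr (qval (hi_c n)) & ratr (qval (hi_c n)) < b].
Proof.
move=> /andP[ay yb].
have [p] := rat_in_itvoo ay; rewrite in_itv /= => /andP[ap py].
have [q] := rat_in_itvoo yb; rewrite in_itv /= => /andP[yq qb].
have [|n [lo_n hi_n]] := @interval_code p q; first by rewrite -(ltr_rat R) (lt_trans py).
by exists n; rewrite lo_n hi_n.
Qed.

(** Rational end points are chosen between the roots of a - 1/(k+1) and a + 1/(k+1), on either side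
    of y; the first root makes sense because a is at least 1. *)
Lemma sq_window_code (R : realType) (y : R) a k : (0 < a)%N -> 0 <= y ->
  `|y ^+ 2 - a%:R| < k.+1%:R^-1 ->
  exists n, sq_windowc n a k /\ ratr (qval (lo_c n)) < y < ratr (qval (hi_c n)).
Proof.
move=> a0 y0; set e := k.+1%:R^-1; rewrite ltr_norml => /andP[h1 h2].
have e1 : e <= 1 by rewrite invf_le1 ?ltr0n // ler1n.
have e0 : 0 < e by rewrite invr_gt0 ltr0n.
have a1 : 1 <= (a%:R : R) by rewrite ler1n.
have ae0 : 0 <= a%:R - e by lra.
have ae1 : 0 <= a%:R + e by lra.
have [|n [s_lo lo_y y_hi hi_s]] := @interval_between R (Num.sqrt (a%:R - e)) y (Num.sqrt (a%:R + e)).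
  rewrite -!(@ltr_pXn2r _ 2 isT (Num.sqrt _)) -?(@ltr_pXn2r _ 2 isT y) ?nnegrE ?sqrtr_ge0 //.
  by rewrite !sqr_sqrtr //; apply/andP; split; lra.
exists n; split; last by rewrite lo_y y_hi.
rewrite (sq_windowcE R) -/e; move: s_lo lo_y y_hi hi_s.
move: (ratr (qval (lo_c n))) (ratr (qval (hi_c n))) => lo hi s_lo lo_y y_hi hi_s.
have lo0 : 0 < lo by rewrite (le_lt_trans _ s_lo) ?sqrtr_ge0.
have hi0 : 0 < hi by rewrite (le_lt_trans y0).
rewrite (ltW lo0) /=.
rewrite -[X in (X < lo ^+ 2)]sqr_sqrtr // -[X in (hi ^+ 2 < X)]sqr_sqrtr //.
by rewrite !ltr_pXn2r ?nnegrE ?sqrtr_ge0 ?(ltW lo0) ?(ltW hi0) // s_lo.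
Qed.

(** * Every name satisfies the conditions *)

Section Necessity.
Variables (R : realType) (S : scalars R) (D : option nat).

(* A real orthonormal family: over the complex numbers it consists of the
   vectors delta_a and i delta_a. *)
Lemma orthonormal_family : exists b : nat -> l2 S D, forall i l,
  in_dim D (i %/ kappa S)%N -> in_dim D (l %/ kappa S)%N ->
  sqn (b i) = 1 /\ sqn (b i + b l) = (if (i == l)%N then 4 else 2)%:R.
Proof.
(* The quotient of the index by [kappa] selects a unit vector and the remainder the factor 1 or i.
   When [kappa] is 1 all remainders are 0 and only the factor 1 occurs. *)
pose z i : S := if (i %% kappa S == 0)%N then 1 else mk S 0 1.
have re_z i : re (z i) = (i %% kappa S == 0)%N%:R.
  by rewrite /z; case: ifP => _; rewrite ?re1 ?re_mk.
have im_z i : im (z i) = (i %% kappa S != 0)%N%:R.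
  rewrite /z; case: ifP => h; rewrite ?im1 ?im_mk //=.
  by move: h; rewrite /kappa; case: (is_cplx S) => //; rewrite modn1.
exists (fun i => z i *: l2delta S D (i %/ kappa S)%N) => i l iD lD.
have zz : re (z i) * re (z l) + im (z i) * im (z l) = (i %% kappa S == l %% kappa S)%N%:R.
  rewrite !re_z !im_z; have kap : (kappa S <= 2)%N by rewrite /kappa; case: ifP.
  have kap0 : (0 < kappa S)%N by rewrite /kappa; case: ifP.
  have := ltn_pmod i kap0; have := ltn_pmod l kap0.
  move=> /leq_trans/(_ kap) + /leq_trans/(_ kap).
  move: (i %% _)%N (l %% _)%N => [|[|//]] [|[|//]] _ _ /=;
    by rewrite ?mulr0 ?mul0r ?mulr1 ?addr0 ?add0r.
have sq1 k : in_dim D (k %/ kappa S)%N -> sqn (z k *: l2delta S D (k %/ kappa S)%N) = 1.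
  move=> kD; rewrite sqnZ /nsq re_z im_z.
  have -> : sqn (l2delta S D (k %/ kappa S)%N) = 1.
    rewrite (@sqn_trunc _ _ _ _ (k %/ kappa S)%N.+1); last by move=> c; exact: cut_out.
    rewrite truncS {1}/trunc big1 ?add0r => [|c _].
      by rewrite deltaE // eqxx -(rmorph1 (rl S)) nsq_rl expr1n.
    by rewrite deltaE // ltn_eqF // nsq0.
  by case: eqP => _ /=; rewrite ?expr1n ?expr0n ?addr0 ?add0r mulr1.
split; first exact: sq1.
set a := (i %/ kappa S)%N in iD *; set b := (l %/ kappa S)%N in lD *.
pose N := (maxn a b).+1.
have := @cross_sqn R S D (z i *: l2delta S D a) (z l *: l2delta S D b) N.
rewrite (sq1 i) // (sq1 l) // => H.
have -> : sqn (z i *: l2delta S D a + z l *: l2delta S D b) =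
    2 + 2 * cross N (z i *: l2delta S D a) (z l *: l2delta S D b).
  rewrite H; first by field.
    by move=> c le_c; rewrite l2Z cut_out ?mulr0 // (leq_trans _ le_c) // ltnS leq_maxl.
  by move=> c le_c; rewrite l2Z cut_out ?mulr0 // (leq_trans _ le_c) // ltnS leq_maxr.
have -> : cross N (z i *: l2delta S D a) (z l *: l2delta S D b) = (i == l)%:R.
  have lt_a : (a < N)%N by rewrite ltnS leq_maxl.
  have crossE c : re ((z i *: l2delta S D a) c) * re ((z l *: l2delta S D b) c) +
      im ((z i *: l2delta S D a) c) * im ((z l *: l2delta S D b) c) =
      (re (z i) * re (z l) + im (z i) * im (z l)) * ((c == a) && (c == b))%:R.
    rewrite !l2Z !deltaE // !reM !imM.
    have re_b (d : bool) : re (d%:R : S) = d%:R by case: d; rewrite ?re1 ?re0.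
    have im_b (d : bool) : im (d%:R : S) = 0 by case: d; rewrite ?im1 ?im0.
    by rewrite !re_b !im_b; case: (c == a); case: (c == b) => /=; ring.
  rewrite /cross (bigD1 (Ordinal lt_a)) // big1 => [|c ne_c]; last first.
    rewrite crossE (_ : (nat_of_ord c == a) = false) ?mulr0 //.
    by apply: contra_neqF ne_c => /eqP ca; apply: val_inj.
  rewrite crossE zz eqxx /= -natrM mulnb [X in X + 0 = _](_ : _ = (i == l)%:R) ?addr0 //.
  congr (_%:R); congr nat_of_bool; apply/andP/eqP => [[/eqP em /eqP ed]|il]; last by rewrite /a /b il !eqxx.
  by rewrite (divn_eq i (kappa S)) (divn_eq l (kappa S)) em; congr (_ * _ + _)%N.
by case: eqP => _; rewrite ?mulr1 ?mulr0 ?addr0 // -natrD.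
Qed.

(** A formal expression mentions finitely many generators, and each of them is well approximated by
    all late models. *)
Lemma rat_vector_model_cvg (y : nat -> l2 S D) (M : nat -> nat) m :
  (forall k j, (j < k)%N -> rnorm (y j - model_vec S D (M k) j) < k.+1%:R^-1) ->
  rnorm (rat_vector (@qs _ S) (model_vec S D (M k)) m) @[k --> \oo] -->
  rnorm (rat_vector (@qs _ S) y m).
Proof.
move=> HM; apply/cvgrPdist_lt => e e0.
suff : \forall k \near \oo, rnorm (rat_vector (@qs _ S) y m - rat_vector (@qs _ S) (model_vec S D (M k)) m) < e.
  by apply: filterS => k; apply: le_lt_trans; exact: rnorm_dist.
rewrite /rat_vector; move: (odflt _ _) => s.
elim: s e e0 => [|p s IHs] e e0.
  apply: nearW => k; rewrite !big_nil subrr /rnorm (@sqn_trunc _ _ _ _ 0) //.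
  by rewrite /trunc big_ord0 sqrtr0.
have e20 : 0 < e / 2 by rewrite divr_gt0.
have q1 : 0 < Num.sqrt (nsq (qs S p.1)) + 1 by rewrite ltr_wpDl ?sqrtr_ge0.
have d0 : 0 < e / 2 / (Num.sqrt (nsq (qs S p.1)) + 1) by rewrite divr_gt0.
have near_p : \forall k \near \oo, rnorm (y p.2 - model_vec S D (M k) p.2) <
    e / 2 / (Num.sqrt (nsq (qs S p.1)) + 1).
  have near_k : \forall k \near \oo, (p.2 < k)%N by exists p.2.+1.
  have near_e := near_infty_natSinv_lt (PosNum d0).
  by apply: filterS2 near_k near_e => k /= lt_k lt_e; exact: lt_trans (HM k _ lt_k) lt_e.
apply: filterS2 near_p (IHs _ e20) => k hp hs.
rewrite !big_cons opprD addrACA -scalerBr.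
apply: (le_lt_trans (rnormD _ _)); rewrite [X in _ < X](splitr e) ltr_leD //; last exact: ltW.
rewrite rnormZ; apply: le_lt_trans (_ : _ <= rnorm (y p.2 - model_vec S D (M k) p.2) * (Num.sqrt (nsq (qs S p.1)) + 1)) _.
  by rewrite mulrC ler_wpM2l ?rnorm_ge0 // lerDl.
by rewrite -ltr_pdivlMr.
Qed.

Lemma hilbert_name_cond (f : nat -> nat) :
  hilbert_name S D f -> forall t, exists w, cond S D t w f.
Proof.
move=> [Rp [pR nR]].
pose lo n : R := ratr (qval (lo_c n)); pose hi n : R := ratr (qval (hi_c n)).
pose nm m : R := rnorm (rat_vector (@qs _ S) Rp m).
have memf m n : lo n < nm m < hi n -> exists i, f i = pickle (m, n).
  move=> mn; have : range f (pickle (m, n)).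
    by rewrite nR; exists m, n; split=> //; rewrite l2_normE in_rat_interval_rl.
  by move=> [i _ fi]; exists i.
have fmem i : is_pairc (f i) /\ lo (sndc (f i)) < nm (hdc (f i)) < hi (sndc (f i)).
  have : diagram (@qs _ S) Rp (f i) by rewrite -nR; exists i.
  move=> [m [n [-> ]]]; rewrite l2_normE in_rat_interval_rl => mn.
  by have [-> -> ->] := pickle_is_pairc m n.
have nm_ge0 m : 0 <= nm m by exact: rnorm_ge0.
(* Each listed interval is an open condition on one norm, so all sufficiently late approximating
   models satisfy any finite number of them. *)
have c_model s : exists M, cond_model S D s M f.
  have inv0 k : 0 < (k.+1%:R^-1 : R) by rewrite invr_gt0 ltr0n.
  have [M HM] := choice (fun k => model_approx Rp k (inv0 k)).
  have near_i i : \forall k \near \oo, satisfiesc S D (M k) (f i).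
    have [fi /andP[h1 h2]] := fmem i.
    have cv := rat_vector_model_cvg (m := hdc (f i)) HM.
    have near1 : \forall k \near \oo, lo (sndc (f i)) <
        rnorm (rat_vector (@qs _ S) (model_vec S D (M k)) (hdc (f i))).
      exact: (cvgr_gt _ cv).
    have near2 : \forall k \near \oo,
        rnorm (rat_vector (@qs _ S) (model_vec S D (M k)) (hdc (f i))) < hi (sndc (f i)).
      exact: (cvgr_lt _ cv).
    apply: filterS2 near1 near2 => k k1 k2; apply/satisfiescP; split=> //.
    by apply/andP; split.
  have near_s : \forall k \near \oo, cond_model S D s (M k) f.
    elim: s => [|s IHs]; first exact: nearW.
    apply: filterS2 IHs (near_i s) => k /all_belowP ks sk; apply/all_belowP => i.
    by rewrite ltnS leq_eqVlt => /orP[/eqP->|/ks].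
  have [k _ /(_ k (leqnn k)) Hk] := near_s.
  by exists (M k).
have c_upward t : exists w, cond_upward t w f.
  rewrite /cond_upward; set x := f (nfst t); set n := nsnd t.
  case: (boolP (_ && _)) => [|_]; last by exists 0%N.
  rewrite !(qltc_ratr R) -!leNgt => /andP[h1 h2].
  have [_ /andP[h3 h4]] := fmem (nfst t); have [|w fw] := memf (hdc x) n.
    by apply/andP; split; [exact: le_lt_trans h1 h3 | exact: lt_le_trans h4 h2].
  by exists w; rewrite fw paircE eqxx.
have c_round t : exists w, cond_round t w f.
  have [_ /interval_between[n [h1 h2 h3 h4]]] := fmem t.
  have [|w fw] := memf (hdc (f t)) n; first by apply/andP; split.
  exists w; rewrite /cond_round fw; have [_ -> ->] := pickle_is_pairc (hdc (f t)) n.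
  by rewrite eqxx !(qltc_ratr R) h1 h4.
have c_small t : exists w, cond_small t w f.
  pose e : R := (nsnd t).+1%:R^-1.
  have e0 : 0 < e by rewrite invr_gt0 ltr0n.
  have [|n [h1 h2 h3 h4]] := @interval_between R (nm (nfst t) - e / 2) (nm (nfst t)) (nm (nfst t) + e / 2).
    by apply/andP; split; lra.
  have [|w fw] := memf (nfst t) n; first by apply/andP; split.
  exists w; rewrite /cond_small fw; have [_ -> ->] := pickle_is_pairc (nfst t) n.
  by rewrite eqxx (qltc_ratr R) (qvalD (lo_c n)) rmorphD /= ratr_inv_c -/e; lra.
have c_indep k : exists w, cond_indep S D k w f.
  rewrite /cond_indep; case: (boolP (rank_ok S D k)) => [rk|_]; last by exists 0%N.
  have [b bP] := orthonormal_family.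
  have kdim i : (i < k)%N -> in_dim D (i %/ kappa S)%N.
    move=> lt_ik; move: rk; rewrite /rank_ok /in_dim; case: (D) => // n le_k.
    by rewrite ltn_divLR; [rewrite mulnC (leq_trans lt_ik) | rewrite /kappa; case: ifP].
  pose eta : R := (tol k).+1%:R^-1.
  have eta0 : 0 < eta by rewrite invr_gt0 ltr0n.
  have eta1 : eta <= 1 by rewrite invf_le1 ?ltr0n // ler1n.
  (* Sums of two vectors are approximated within 2e, and the exact norms are at most 2. Hence
     squares differ by at most 2e (4 + 2e), which is less than 16e. *)
  pose e := eta / 16; have e0 : 0 < e by rewrite divr_gt0.
  have [u uP] := choice (fun i => rat_vector_dense (b i) pR e0).
  have sq_close (x y : R) (a : R) : 0 <= x -> 0 <= y -> x ^+ 2 = a -> a <= 4 ->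
      `|x - y| <= 2 * e -> `|y ^+ 2 - a| < eta.
    move=> x0 y0 xa a4 xy; have x2 : x <= 2.
      by rewrite -(@ler_pXn2r _ 2) ?nnegrE // xa -natrX.
    move: xy; rewrite ler_norml => /andP[h1 h2]; rewrite ltr_norml -xa /e in h1 h2 *.
    by apply/andP; split; nra.
  (* The bound i < k is moved inside the existential so that [choice] yields a total function; the
     same is done in [w2]. *)
  have w1 i : exists p, (i < k)%N ->
      hdc (f p) = u i /\ sq_windowc (sndc (f p)) 1 (tol k).
    case: (ltnP i k) => [lt_i|]; last by exists 0%N.
    have [s1 _] := bP i i (kdim _ lt_i) (kdim _ lt_i).
    have H : `|nm (u i) ^+ 2 - 1%:R| < eta.
      apply: (sq_close (rnorm (b i))); rewrite ?rnorm_ge0 ?rnorm_sqr //; first by lra.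
      apply: (le_trans (rnorm_dist _ _)); have := uP i; lra.
    have [n [W mn]] := sq_window_code (ltnSn 0) (nm_ge0 _) H.
    have [p fp] := memf _ _ mn; exists p => _; rewrite fp.
    by have [_ -> ->] := pickle_is_pairc (u i) n.
  have w2 i l : exists p, (i < k)%N -> (l < k)%N ->
      hdc (f p) = catc (u i) (u l) /\
      sq_windowc (sndc (f p)) (if (i == l)%N then 4 else 2) (tol k).
    case: (ltnP i k) => [lt_i|]; last by exists 0%N.
    case: (ltnP l k) => [lt_l|]; last by exists 0%N.
    have [_ s2] := bP i l (kdim _ lt_i) (kdim _ lt_l).
    have H : `|nm (catc (u i) (u l)) ^+ 2 - (if (i == l)%N then 4 else 2)%:R| < eta.
      apply: (sq_close (rnorm (b i + b l))); rewrite ?rnorm_ge0 ?rnorm_sqr //.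
        by case: ifP => _; rewrite ler_nat.
      apply: (le_trans (rnorm_dist _ _)); rewrite rat_vector_catc opprD addrACA.
      by apply: (le_trans (rnormD _ _)); have := uP i; have := uP l; lra.
    have a0 : (0 < (if (i == l)%N then 4 else 2))%N by case: ifP.
    have [n [W mn]] := sq_window_code a0 (nm_ge0 _) H.
    have [p fp] := memf _ _ mn; exists p => _ _; rewrite fp.
    by have [_ -> ->] := pickle_is_pairc (catc (u i) (u l)) n.
  have [p pP] := choice w1; have [q qP] := choice (fun z : nat * nat => w2 z.1 z.2).
  exists (npair (seqcode (mkseq p k))
                (seqcode (mkseq (fun i => seqcode (mkseq (fun l => q (i, l)) k)) k))).
  rewrite implyTb nfst_pair nsnd_pair; apply/all_belowP => i lt_i.
  have pE j : (j < k)%N -> nthc (seqcode (mkseq p k)) j = p j.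
    by move=> lt_j; rewrite nthc_code nth_mkseq.
  rewrite pE //; have [hi_ ->] := pP i lt_i; apply/all_belowP => l lt_l.
  rewrite pE // nthc_code nth_mkseq // nthc_code nth_mkseq //.
  have [hl_ _] := pP l lt_l; have [-> ->] := qP (i, l) lt_i lt_l.
  by rewrite hi_ hl_ eqxx.
move=> t; rewrite /cond.
case: (nfst t == 0%N); first exact: c_model.
case: (nfst t == 1%N); first exact: c_upward.
case: (nfst t == 2%N); first exact: c_round.
case: (nfst t == 3%N); first exact: c_small.
exact: c_indep.
Qed.

Lemma Pi02_hilbert_name : Pi02 (hilbert_name S D).
Proof.
have [r [cr rP]] := Pi02_local (decidable_cond S D) (@cond_local R S D).
exists r; split=> // f; rewrite -rP; split; first exact: hilbert_name_cond.
exact: cond_hilbert_name.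
Qed.

End Necessity.

(** * Hardness *)

(** The reduction evaluates the given [Pi02] matrix on shorter prefixes of its oracle, so these must
    be computed from the prefix at hand. *)
Lemma prefix_code_iteri g m :
  prefix_code g m = iteri m (fun k acc => (npair (g (m - k.+1)%N) acc).+1) 0%N.
Proof.
suff H k : (k <= m)%N -> iteri k (fun k acc => (npair (g (m - k.+1)%N) acc).+1) 0%N
    = seqcode (drop (m - k) (mkseq g m)).
  by rewrite H // subnn drop0.
elim: k => [|k IHk] lt_k; first by rewrite subn0 drop_oversize // size_mkseq.
rewrite /= IHk ?(ltnW lt_k) // [in RHS](drop_nth 0%N) ?size_mkseq; last by lia.
by rewrite nth_mkseq /= ?subnSK //; lia.
Qed.

Lemma computable_prefix_code s m : computable s -> computable m ->
  computable (fun x => prefix_code (nthc (s x)) (m x)).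
Proof.
move=> cs cm; apply: (@computable_app2 (fun a b => prefix_code (nthc a) b)) => //.
apply: (@computable_ext (fun z => iteri (nsnd z)
  (fun k acc => (npair (nthc (nfst z) (nsnd z - k.+1)%N) acc).+1) 0%N)).
  by move=> z; rewrite prefix_code_iteri.
by auto 30 with computable.
Qed.
#[global] Hint Resolve computable_prefix_code : computable.

Section Hardness.
Variables (R : realType) (S : scalars R) (D : option nat).

(** In dimension n the vectors with index j >= n are zero, so every expression still denotes a
    vector. *)
Definition std_vec (j : nat) : l2_space S D := l2delta S D j.

Lemma std_presentation : presentation std_vec.
Proof.
apply/presentationP => x e e0; have [N xN] := cut_approx x (gt0_re e0).
exists (l2cut D x N); last by rewrite l2_normE (ge0_rl (ltW e0)) rl_lt.
by rewrite cut_delta; apply: lin_span_sum => l _; apply: lin_spanZ; exact: lin_span_gen.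
Qed.

Definition std_rec (j c : nat) : nat := if (c == j)%N && in_dim D c then qone else 0%N.

(** An expression with code m mentions only indices up to m, so its vector is determined by the
    first m + 1 coordinates. *)
Definition std_diagramc (x : nat) : bool :=
  is_pairc x &&
  in_sqrtc (normsqc S std_rec (fun _ _ => 0%N) (hdc x) (hdc x).+1) (sndc x).

Lemma std_diagramP x : diagram (@qs _ S) std_vec x <-> std_diagramc x.
Proof.
have normE m : ratr (qval (normsqc S std_rec (fun _ _ => 0%N) m m.+1)) =
    rnorm (rat_vector (@qs _ S) std_vec m) ^+ 2 :> R.
  pose v j : l2 S D := l2cut D (fun c => (c == j)%:R) m.+1.
  rewrite (@normsqcE R S D _ _ v m.+1); last 3 first.
  - move=> j c lt_c; rewrite cutE lt_c /= /std_rec.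
    by case: (c == j) => /=; case: (in_dim D c); rewrite ?re1 ?re0 ?qval1 ?qval0 ?rmorph1 ?rmorph0.
  - move=> j c lt_c; rewrite cutE lt_c qval0 rmorph0 /=.
    by case: (c == j) => /=; case: (in_dim D c); rewrite ?im1 ?im0.
  - by move=> j c; exact: cut_out.
  rewrite rnorm_sqr !rat_vector_nthc; congr sqn; apply: eq_bigr => i _; case: ifP => // _.
  congr (_ *: _); apply: l2_eq => c; rewrite !cutE.
  have le_m : (sndc (nthc m i) <= m)%N.
    rewrite (leq_trans _ (nthc_le m i)) // (leq_trans (nfst_le _)) // (leq_trans (leq_pred _)) //.
    by rewrite (leq_trans (nsnd_le _)) // leq_pred.
  case: (ltngtP c (sndc (nthc m i))) => [lt_c|lt_c|->].
  - by rewrite !ltnS (ltnW lt_c) (leq_trans (ltnW lt_c) le_m).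
  - by rewrite [X in _ = X](_ : _ = 0) ?if_same //; case: ifP.
  - by rewrite !ltnS leqnn le_m.
have inE m n : in_rat_interval `|rat_vector (@qs _ S) std_vec m| n =
    in_sqrtc (normsqc S std_rec (fun _ _ => 0%N) m m.+1) n.
  rewrite l2_normE in_rat_interval_rl.
  by rewrite (@in_sqrtcE R (rnorm (rat_vector (@qs _ S) std_vec m))) ?rnorm_ge0.
split=> [[m [n [-> ]]]|/andP[px xn]].
  by rewrite /std_diagramc inE; have [-> -> ->] := pickle_is_pairc m n.
by exists (hdc x), (sndc x); split; [exact: is_paircE | rewrite inE].
Qed.

Lemma decidable_std_diagramc : decidable_pred std_diagramc.
Proof.
rewrite /std_diagramc; apply: decidable_and; first by auto with computable.
apply: decidable_in_sqrtc; last by auto with computable.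
apply: (@computable_normsqc R S (fun _ => std_rec) (fun _ _ _ => 0%N) _ _ (fun=> 0%N)).
- move=> a b c ca cb cc; rewrite /std_rec; apply: computable_if; try by auto with computable.
  by apply: decidable_and; [|rewrite /in_dim; case: D => [n|]]; auto with computable.
- by move=> *; auto with computable.
- by auto with computable.
- by auto with computable.
- by auto with computable.
Qed.

Lemma diagram_interval (Rp : nat -> l2_space S D) m (a b : R) :
  a < rnorm (rat_vector (@qs _ S) Rp m) < b ->
  exists n, [/\ a < ratr (qval (lo_c n)), ratr (qval (hi_c n)) < b &
                diagram (@qs _ S) Rp (pickle (m, n))].
Proof.
move=> /interval_between[n [h1 h2 h3 h4]]; exists n; split=> //; exists m, n; split=> //.
by rewrite l2_normE in_rat_interval_rl h2.
Qed.

Lemma diagram_sub_eq (Rp Rp' : nat -> l2_space S D) :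
  diagram (@qs _ S) Rp' `<=` diagram (@qs _ S) Rp ->
  diagram (@qs _ S) Rp' = diagram (@qs _ S) Rp.
Proof.
move=> sub; suff eq_n m : rnorm (rat_vector (@qs _ S) Rp' m) = rnorm (rat_vector (@qs _ S) Rp m).
  apply/seteqP; split=> k [m [n [-> H]]]; exists m, n; split=> //; move: H;
    by rewrite !l2_normE eq_n.
have in_Rp n : diagram (@qs _ S) Rp (pickle (m, n)) ->
    ratr (qval (lo_c n)) < rnorm (rat_vector (@qs _ S) Rp m) < ratr (qval (hi_c n)).
  move=> [m' [n' [/(pcan_inj pickleK)[<- <-]]]].
  by rewrite l2_normE in_rat_interval_rl.
set x := rnorm (rat_vector _ Rp' m); set y := rnorm (rat_vector _ Rp m) in in_Rp *.
have [lt_xy|lt_yx|//] := ltgtP x y.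
  have [|n [_ hn /sub/in_Rp]] := @diagram_interval Rp' m (x - 1) y.
    by rewrite -/x lt_xy andbT; lra.
  by rewrite -/y => /andP[_]; rewrite ltNge (ltW hn).
have [|n [hn _ /sub/in_Rp]] := @diagram_interval Rp' m y (x + 1).
  by rewrite -/x lt_yx /=; lra.
by rewrite -/y => /andP[]; rewrite ltNge (ltW hn).
Qed.

Lemma hilbert_name_hard (P : (nat -> nat) -> Prop) : Pi02 P ->
  exists F, computable_operator F /\ forall f, P f <-> hilbert_name S D (F f).
Proof.
move=> [r [cr rP]].
(* The diagram contains an entry for every expression code m, and pickling m with an interval gives
   a number above m. *)
have std_unbounded B : exists2 x, (B < x)%N & diagram (@qs _ S) std_vec x.
  have [|n [_ _ dn]] := @diagram_interval std_vec B.+1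
    (rnorm (rat_vector (@qs _ S) std_vec B.+1) - 1)
    (rnorm (rat_vector (@qs _ S) std_vec B.+1) + 1); first by apply/andP; split; lra.
  exists (pickle (B.+1, n)) => //; rewrite pickle_pairE /= ltnS.
  by rewrite (leq_trans (leqnSn B)) // ltnW // npair_lt1.
have [x0 _ /std_diagramP x0P] := std_unbounded 0%N.
(* The operator must be total, so a fixed element [x0] of the diagram is repeated whenever there is
   nothing else to list. *)
pose d i := if std_diagramc i then i else x0.
have dP i : diagram (@qs _ S) std_vec (d i).
  by apply/std_diagramP; rewrite /d; case: ifP.
(* The requirements j < i must all be witnessed by prefixes of length at most m; this is decidable
   from the first m values of [g]. *)
pose ok g i m := all_below i (fun j => ~~ all_below m.+1 (fun m' =>
  r (npair j (prefix_code g m')) != 0%N)).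
pose F f n := if ok f (nfst n) (nsnd n) then d (nfst n) else x0.
have ok_local g g' i m : (forall k, (k < m)%N -> g k = g' k) -> ok g i m = ok g' i m.
  move=> gg'; apply: eq_in_all => j _; congr negb; apply: eq_in_all => m'.
  rewrite mem_iota add0n ltnS => le_m'; congr (r (npair j (seqcode _)) != 0%N).
  by apply/eq_in_map => k; rewrite mem_iota add0n => lt_k; apply: gg'; apply: leq_trans lt_k _.
have c_r f : computable f -> computable (fun x => r (f x)) by exact: computable_app1.
exists F; split.
  (* The value at n is released exactly when the prefix has length [nsnd n]: shorter prefixes must
     return 0, and this length already contains all that [ok] inspects. *)
  exists (fun z => if (sizec (nsnd z) == nsnd (nfst z))%N
    then (F (nthc (nsnd z)) (nfst z)).+1 else 0%N); split.
    apply: computable_if; [by auto 20 with computable| |exact: computable_const].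
    apply: computable_succ; rewrite /F; apply: computable_if.
    - by rewrite /ok; auto 40 with computable.
    - rewrite /d; apply: computable_if; try by auto with computable.
      exact: computable_app1 decidable_std_diagramc (computable_fst (computable_fst computable_id)).
    - exact: computable_const.
  move=> f n; exists (nsnd n); split.
    rewrite !(nfst_pair, nsnd_pair) sizec_prefix eqxx; congr (_.+1); rewrite /F.
    by rewrite (ok_local _ f) // => k lt_k; rewrite nthc_prefix.
  by move=> k lt_k; rewrite !(nfst_pair, nsnd_pair) sizec_prefix ltn_eqF.
have F_diag f : range (F f) `<=` diagram (@qs _ S) std_vec.
  by move=> _ [n _ <-]; rewrite /F; case: ifP => _ //; apply/std_diagramP.
move=> f; split=> [/rP Pf|[Rp [_ nR]]].
  exists std_vec; split; first exact: std_presentation.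
  rewrite /names; apply/seteqP; split; first exact: F_diag.
  move=> x /std_diagramP dx.
  have [m okm] : exists m, ok f x m.
    elim: x {dx} => [|x [m /all_belowP okm]]; first by exists 0%N.
    have [m' rm'] := Pf x; exists (maxn m m'); apply/all_belowP => j.
    rewrite ltnS leq_eqVlt => /orP[/eqP->|lt_j].
      apply/negP => /all_belowP/(_ m'); rewrite rm' eqxx ltnS leq_maxr => /(_ isT).
      by [].
    apply: contra (okm _ lt_j) => /all_belowP H; apply/all_belowP => k lt_k.
    by apply: H; rewrite (leq_trans lt_k) // ltnS leq_maxl.
  by exists (npair x m) => //; rewrite /F nfst_pair nsnd_pair okm /d dx.
apply/rP => j0; apply: contrapT => no_m.
(* A requirement [j0] without witness blocks every i > j0, so [F f] is bounded. Were its range a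
   diagram, it would be the whole standard diagram, which is unbounded. *)
have F_le n : (F f n <= maxn j0 x0)%N.
  rewrite /F; case: ifP => [/all_belowP okn|_]; last exact: leq_maxr.
  have le_n : (nfst n <= j0)%N.
    rewrite leqNgt; apply/negP => /okn/negP; apply; apply/all_belowP => m _.
    by apply/eqP => rm; apply: no_m; exists m.
  by rewrite /d; case: ifP => _; rewrite leq_max ?le_n ?leqnn ?orbT.
have eq_d : range (F f) = diagram (@qs _ S) std_vec.
  by rewrite nR; apply: diagram_sub_eq; rewrite -nR; exact: F_diag.
have [x lt_x] := std_unbounded (maxn j0 x0); rewrite -eq_d => -[n _ Fx].
by have := F_le n; rewrite Fx leqNgt lt_x.
Qed.

Lemma hilbert_name_complete : Pi02_complete (hilbert_name S D).
Proof. by split; [exact: Pi02_hilbert_name | exact: hilbert_name_hard]. Qed.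

End Hardness.

Lemma Pi02_complete_ext (P Q : (nat -> nat) -> Prop) :
  (forall f, P f <-> Q f) -> Pi02_complete P -> Pi02_complete Q.
Proof. by move=> PQ; have -> : P = Q by apply/funext => f; apply/propext. Qed.

Lemma names_pres_complete (R : realType) (S : scalars R) :
  Pi02_complete (names_pres_of (@qs _ S) (@iso_l2 S)) /\
  forall n, Pi02_complete (names_pres_of (@qs _ S) (@iso_l2n S n)).
Proof.
split=> [|n]; apply: Pi02_complete_ext (hilbert_name_complete S _) => f; apply: iff_sym.
  exact: names_pres_l2.
exact: names_pres_l2n.
Qed.

Theorem theorem5p2 (R : realType) :
  (* F = R *)
  (Pi02_complete (names_pres_of (@qscalR R) (@iso_l2 R)) /\
   forall n : nat, (1 <= n)%N ->
     Pi02_complete (names_pres_of (@qscalR R) (@iso_l2n R n))) /\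
  (* F = C *)
  (Pi02_complete (names_pres_of (@qscalC R) (@iso_l2 R[i])) /\
   forall n : nat, (1 <= n)%N ->
     Pi02_complete (names_pres_of (@qscalC R) (@iso_l2n R[i] n))).
Proof.
have [l2R l2nR] := names_pres_complete (real_scalars R).
have [l2C l2nC] := names_pres_complete (complex_scalars R).
by split; split.
Qed.
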